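(* Let $f = \frac1n\sum_{i=1}^n f_i$ with $f_i(x) = \mathbb{E}_{\xi_i \sim \mathcal{D}_i}[F_i(x;\xi_i)]$ for $x \in \mathbb{R}^d$. Suppose that: (1) there exists $f^\star > -\infty$ with $f(x) \ge f^\star$ for any $x \in \mathbb{R}^d$; (2) $f_i$ is $L$-smooth for all $i \in [n]$; (3) there exists $\sigma^2$ such that $\mathbb{E}_{\xi_i \sim \mathcal{D}_i}\|\nabla F_i(x;\xi_i) - \nabla f_i(x)\|^2 \le \sigma^2$ for all $i \in [n]$ and $x \in \mathbb{R}^d$; (4) there exists $\zeta^2$ such that $\frac1n\sum_{i=1}^n \|\nabla f_i(x) - \nabla f(x)\|^2 \le \zeta^2$ for all $x \in \mathbb{R}^d$. Let $W^{(1)},\dots,W^{(m)}$ be the mixing matrices of the Base-$(k+1)$ Graph $\mathcal{A}_k(V)$ on $V = [n]$, and consider decentralized SGD (DSGD) on it with learning rate $\eta$, i.e. the iterates $$x_i^{(r+1)} = \sum_{j=1}^n W_{ij}^{(1+\mathrm{mod}(r,m))}\left(x_j^{(r)} - \eta \nabla F_j(x_j^{(r)};\xi_j^{(r)})\right), \qquad i \in [n],\ r \ge 0.$$ Let $\bar{x}^{(r)} = \frac1n\sum_{i=1}^n x_i^{(r)}$ and $F_0 = f(\bar{x}^{(0)}) - f^\star$. Then, for any number of nodes $n \in \mathbb{N}$ and maximum degree $k \in [n-1]$, there exists $\eta$ such that the averages $\bar{x}^{(r)}$ generated by these iterates satisfy $$\frac{1}{R+1}\sum_{r=0}^{R}\mathbb{E}\left\|\nabla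 f(\bar{x}^{(r)})\right\|^2 \le \epsilon$$ after $$R = \mathcal{O}\left(\frac{\sigma^2}{n\epsilon^2} + \frac{\zeta\log_{k+1}(n) + \sigma\sqrt{\log_{k+1}(n)}}{\epsilon^{3/2}} + \frac{\log_{k+1}(n)}{\epsilon}\right)\cdot L F_0$$ iterations.
   Context: Stochastic setting: $n$ is the number of nodes; $\mathcal{D}_i$ is the data distribution held by node $i$; $f_i$ is the loss function of node $i$; $F_i(x;\xi_i)$ is the loss of node $i$ at data sample $\xi_i$, and $\nabla F_i(x;\xi_i)$ denotes the stochastic gradient; $\xi_j^{(r)}$ is the data sample (from $\mathcal{D}_j$) used by node $j$ at iteration $r$; $x_i^{(r)} \in \mathbb{R}^d$ is the parameter of node $i$ at iteration $r$. A function $g$ is $L$-smooth if it is differentiable with $\|\nabla g(x)-\nabla g(y)\| \le L\|x-y\|$ for all $x,y$. $\sigma,\zeta \ge 0$ are the square roots of $\sigma^2,\zeta^2$; $\epsilon>0$ is the target accuracy. Notation: $[n] = \{1,\dots,n\}$; $\mathrm{mod}(a,n)$ is the remainder of $a$ divided by $n$. All sequences of graphs below live on a common node set, so a sequence of graphs is written as a sequence of (weighted, undirected) edge sets $(E^{(1)},\dots,E^{(m)})$; its length is $|(E^{(1)},\dots,E^{(m)})| = m$. If $\mathcal{S}$ is a sequence, $E(\mathcal{S}^{(j)})$ is the edge set of its $j$-th graph. The mixing matrix $W \in [0,1]^{n\times n}$ of a weighted graph has $W_{ij}$ equal to the weight of edge $(i,j)$ (and $0$ for $i\ne j$ not joined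 by an edge). Self-loops are not listed; their weights $W_{ii}$ are determined by requiring $W$ to be doubly stochastic. A node is isolated in $E^{(m)}$ if no edge added so far to $E^{(m)}$ is incident to it. Wherever choices are made (ordering of nodes, splitting, selection of nodes, choice of a minimal factorization), any fixed choice is allowed. **$k$-peer Hyper-hypercube Graph $\mathcal{H}_k(V)$.** Defined for $V = \{v_1,\dots,v_n\}$ when all prime factors of $n$ are at most $k+1$. Write $n = n_1 \times \cdots \times n_L$ with $L \ge 1$ minimum such that $n_l \in [k+1]$ for all $l \in [L]$ (for $n=1$: $L=1$, $n_1=1$; this $L$ is unrelated to the smoothness constant). For $i \in [n]$ write $i-1 = \sum_{l=1}^L d_l(i) \prod_{l'<l} n_{l'}$ with digits $0 \le d_l(i) < n_l$. For each $l \in [L]$, $E^{(l)}$ consists of all edges $(v_i,v_j)$, $i \neq j$, such that $d_{l'}(i) = d_{l'}(j)$ for all $l' \neq l$, each with weight $1/n_l$. Then $\mathcal{H}_k(V) = (E^{(1)},\dots,E^{(L)})$. **Simple Base-$(k+1)$ Graph $\mathcal{A}_k^{\mathrm{simple}}(V)$**, $|V| = n$. Write $n$ in base $k+1$: $n = a_1(k+1)^{p_1} + \cdots + a_L(k+1)^{p_L}$ with $p_1 > \cdots > p_L \ge 0$ and $a_l \in [k]$. (i) If all prime factors of $n$ are at most $k+1$, return $\mathcal{H}_k(V)$. (ii) Otherwise, split $V$ into disjoint subsets $V_1,\dots,V_L$ with $|V_l| = a_l(k+1)^{p_l}$, and split each $V_l$ into disjoint subsets $V_{l,1},\dots,V_{l,a_l}$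 with $|V_{l,a}| = (k+1)^{p_l}$. Construct all $\mathcal{H}_k(V_l)$ and $\mathcal{H}_k(V_{l,a})$, and let $m_1 = |\mathcal{H}_k(V_1)|$. Initialize $b_l = 0$ for all $l \in [L]$ and $m = 0$. While $b_1 < |\mathcal{H}_k(V_{1,1})|$: set $m \leftarrow m+1$, $E^{(m)} \leftarrow \emptyset$, and for $l = L, L-1, \dots, 1$ in this order do the first applicable case: - if $m \le m_1$: add $E(\mathcal{H}_k(V_l)^{(m')})$ to $E^{(m)}$, where $m' = \mathrm{mod}(m-1, |\mathcal{H}_k(V_l)|)+1$; - else if $m < m_1 + l$: for each $v \in V_l$, select isolated nodes $u_1 \in V_{m-m_1,1}, \dots, u_{a_{m-m_1}} \in V_{m-m_1,a_{m-m_1}}$ and add the edges $(v,u_1),\dots,(v,u_{a_{m-m_1}})$ to $E^{(m)}$, each with weight $\frac{|V_{m-m_1}|}{a_{m-m_1}\sum_{l'=m-m_1}^{L}|V_{l'}|}$; - else if $m = m_1 + l$ and $l \ne L$: while there are two or more isolated nodes in $V_l$, let $c$ be their number, select a set $V'$ of $\min\{k+1,c\}$ isolated nodes of $V_l$, and add to $E^{(m)}$ all edges of the complete graph on $V'$ with weights $1/|V'|$; - else: set $b_l \leftarrow b_l + 1$; if $p_l \neq 0$, add $E(\mathcal{H}_k(V_{l,a})^{(m')})$ to $E^{(m)}$ for every $a \in [a_l]$, where $m' = \mathrm{mod}(b_l - 1, |\mathcal{H}_k(V_{l,a})|)+1$; if $p_l = 0$, add $E(\mathcal{H}_k(V_l)^{(m')})$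 to $E^{(m)}$, where $m' = \mathrm{mod}(b_l-1,|\mathcal{H}_k(V_l)|)+1$. Return $(E^{(1)},\dots,E^{(m)})$. **Base-$(k+1)$ Graph $\mathcal{A}_k(V)$**, $|V| = n$. Write $n = p \times q$ where all prime factors of $p$ are at most $k+1$ and $q$ is coprime to each of $2,3,\dots,k+1$. Split $V$ into disjoint subsets $V_1,\dots,V_p$ with $|V_l| = q$, and construct $\mathcal{A}_k^{\mathrm{simple}}(V_l)$ for all $l \in [p]$ (all built in the same way, so of equal length). For $m = 1,\dots,|\mathcal{A}_k^{\mathrm{simple}}(V_1)|$ let $E^{(m)} = \bigcup_{l \in [p]} E(\mathcal{A}_k^{\mathrm{simple}}(V_l)^{(m)})$. Split $V$ into disjoint subsets $U_1,\dots,U_q$ with $|U_l| = p$ and $|U_l \cap V_{l'}| = 1$ for all $l,l'$, and construct $\mathcal{H}_k(U_l)$ for all $l \in [q]$ (built in the same way, using the same factorization of $p$). For $m = 1,\dots,|\mathcal{H}_k(U_1)|$ let $E^{(m+|\mathcal{A}_k^{\mathrm{simple}}(V_1)|)} = \bigcup_{l\in[q]} E(\mathcal{H}_k(U_l)^{(m)})$. Let $\mathcal{E}$ be the resulting sequence, of length $|\mathcal{A}_k^{\mathrm{simple}}(V_1)| + |\mathcal{H}_k(U_1)|$. If $|\mathcal{A}_k^{\mathrm{simple}}(V)| < |\mathcal{E}|$, return $\mathcal{A}_k^{\mathrm{simple}}(V)$; otherwise return $\mathcal{E}$.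
   Formalization: All nodes are assumed to start from one common deterministic point, x_i^(0) = x_j^(0) for all i, j; with arbitrary initial parameters the stated bound, which ignores the initial disagreement of the nodes, is false. *)

(* Defs.v *)
From HB Require Import structures.
From mathcomp Require Import all_boot all_order all_algebra.
From mathcomp Require Import all_classical all_reals all_analysis.
Import Order.TTheory GRing.Theory Num.Theory.
Import numFieldNormedType.Exports.

Set Implicit Arguments.
Unset Strict Implicit.
Unset Printing Implicit Defensive.

Local Open Scope classical_set_scope.
Local Open Scope ring_scope.

(* The node set is 'I_n.  A set of weighted undirected edges is its weighted
  adjacency matrix E : 'M[R]_n: symmetric, zero diagonal, and E u v = 0 exactly
  when u and v are not joined (every edge below has a positive weight).  The
  unions of edge sets taken below are always unions of disjoint edge sets, so
  they are sums of matrices.  Sequences and blocks are numbered from 1. *)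

Definition graph_at (R : realType) (n : nat) (S : seq 'M[R]_n) (m : nat) :
  'M[R]_n := nth 0 S m.-1.

(* The graph of S used at round m when S is repeated cyclically *)
Definition cyclic_at (R : realType) (n : nat) (S : seq 'M[R]_n) (m : nat) :
  'M[R]_n := graph_at S (m.-1 %% size S).+1.

Definition isolated (R : realType) (n : nat) (E : 'M[R]_n) (v : 'I_n) : bool :=
  [forall u, (E v u == 0) && (E u v == 0)].

Definition edge (R : realType) (n : nat) (w : R) (u v : 'I_n) : 'M[R]_n :=
  w *: (delta_mx u v + delta_mx v u).

Definition complete_graph (R : realType) (n : nat) (V : {set 'I_n}) :
  'M[R]_n :=
  \matrix_(u, v) if [&& u \in V, v \in V & u != v] then #|V|%:R^-1 else 0.

(* The self-loop weights make every row (and, E being symmetric, every column)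
   sum to 1. *)
Definition mixing (R : realType) (n : nat) (E : 'M[R]_n) : 'M[R]_n :=
  \matrix_(i, j) if i == j then 1 - \sum_(j' | j' != i) E i j' else E i j.

Definition split_into (n : nat) (V : {set 'I_n}) (J : seq nat)
    (B : nat -> {set 'I_n}) : Prop :=
  V = (\bigcup_(j <- J) B j)%SET /\
  {in J &, forall i j, i != j -> (B i :&: B j)%SET = finset.set0}.

Definition smooth_number (k n : nat) : Prop :=
  forall p, prime p -> (p %| n)%N -> (p <= k.+1)%N.

Definition factorization (k n : nat) (ns : seq nat) : Prop :=
  [/\ (0 < size ns)%N, {in ns, forall x, (0 < x <= k.+1)%N}
    & n = (\prod_(x <- ns) x)%N].

Definition min_factorization (k n : nat) (ns : seq nat) : Prop :=
  factorization k n ns /\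
  forall ms, factorization k n ms -> (size ns <= size ms)%N.

(* Mixed-radix digit number l.+1 of i. *)
Definition digit (ns : seq nat) (l i : nat) : nat :=
  ((i %/ \prod_(x <- take l ns) x) %% nth 1 ns l)%N.

(* Edge set number l.+1; pos v is the index, minus 1, of v in the ordering
   of V. *)
Definition hyper_edges (R : realType) (n : nat) (ns : seq nat)
    (V : {set 'I_n}) (pos : 'I_n -> nat) (l : nat) : 'M[R]_n :=
  \matrix_(u, v)
    if [&& u \in V, v \in V, u != v &
           [forall l' : 'I_(size ns),
             (nat_of_ord l' != l) ==>
               (digit ns l' (pos u) == digit ns l' (pos v))]]
    then (nth 1%N ns l)%:R^-1 else 0.

(* S is H_k(V) for the factorization ns of #|V| and some ordering of V. *)
Definition hyper_with (R : realType) (n k : nat) (ns : seq nat)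
    (V : {set 'I_n}) (S : seq 'M[R]_n) : Prop :=
  min_factorization k #|V| ns /\
  exists pos : 'I_n -> nat,
    [/\ {in V &, injective pos}, {in V, forall v, (pos v < #|V|)%N}
      & S = mkseq (hyper_edges R ns V pos) (size ns)].

Definition hyper_hypercube (R : realType) (n k : nat) (V : {set 'I_n})
    (S : seq 'M[R]_n) : Prop :=
  smooth_number k #|V| /\ exists ns, hyper_with k ns V S.

(* The choices made in the construction of the simple Base-(k+1) graph when the
   number of nodes has a prime factor above k+1. *)
Record simple_setup (R : realType) (n : nat) := SimpleSetup {
  nblk : nat;                            (* L *)
  coef : nat -> nat;                     (* a_l *)
  expo : nat -> nat;                     (* p_l *)
  blk  : nat -> {set 'I_n};              (* V_l *)
  sub  : nat -> nat -> {set 'I_n};       (* V_{l,a} *)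
  hblk : nat -> seq 'M[R]_n;             (* H_k(V_l) *)
  hsub : nat -> nat -> seq 'M[R]_n       (* H_k(V_{l,a}) *)
}.

Definition base_expansion (k N L : nat) (a p : nat -> nat) : Prop :=
  [/\ N = (\sum_(1 <= l < L.+1) a l * k.+1 ^ p l)%N,
      forall l l', (0 < l)%N -> (l < l')%N -> (l' <= L)%N -> (p l' < p l)%N
    & forall l, (0 < l <= L)%N -> (0 < a l <= k)%N].

Definition valid_setup (R : realType) (n k : nat) (V : {set 'I_n})
    (s : simple_setup R n) : Prop :=
  [/\ base_expansion k #|V| (nblk s) (coef s) (expo s),
      split_into V (iota 1 (nblk s)) (blk s)
    & forall l, (0 < l <= nblk s)%N ->
      [/\ #|blk s l| = (coef s l * k.+1 ^ expo s l)%N,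
          hyper_hypercube k (blk s l) (hblk s l),
          split_into (blk s l) (iota 1 (coef s l)) (sub s l)
        & forall a, (0 < a <= coef s l)%N ->
            #|sub s l a| = (k.+1 ^ expo s l)%N /\
            hyper_hypercube k (sub s l a) (hsub s l a)]].

Definition len1 (R : realType) (n : nat) (s : simple_setup R n) : nat :=
  size (hblk s 1).

(* The last of the four cases applies to block l at round m. *)
Definition last_case (R : realType) (n : nat) (s : simple_setup R n)
    (l m : nat) : bool :=
  ~~ [|| (m <= len1 s)%N, (m < len1 s + l)%N
       | (m == len1 s + l)%N && (l != nblk s)].

(* The value of b_l once block l has been treated at round m. *)
Definition counter (R : realType) (n : nat) (s : simple_setup R n)
    (l m : nat) : nat := count (last_case s l) (iota 1 m).

(* Second case, for the nodes vs of V_l in turn: v is joined to isolated nodes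
   u 1, ..., u a_j of V_{j,1}, ..., V_{j,a_j}. *)
Inductive link_all (R : realType) (n : nat) (s : simple_setup R n) (j : nat)
    (w : R) : seq 'I_n -> 'M[R]_n -> 'M[R]_n -> Prop :=
| link_nil E : link_all s j w [::] E E
| link_cons v vs (u : nat -> 'I_n) E E' :
    (forall a, (0 < a <= coef s j)%N -> u a \in sub s j a /\ isolated E (u a)) ->
    link_all s j w vs (E + \sum_(1 <= a < (coef s j).+1) edge w v (u a)) E' ->
    link_all s j w (v :: vs) E E'.

Definition link_weight (R : realType) (n : nat) (s : simple_setup R n)
    (j : nat) : R :=
  #|blk s j|%:R /
    ((coef s j)%:R * (\sum_(j <= l < (nblk s).+1) #|blk s l|)%N%:R).

Definition isolated_in (R : realType) (n : nat) (E : 'M[R]_n)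
    (V : {set 'I_n}) : {set 'I_n} := [set v in V | isolated E v]%SET.

(* Third case: one merge_step for each turn of the inner loop. *)
Inductive merge_isolated (R : realType) (n k : nat) (V : {set 'I_n}) :
    'M[R]_n -> 'M[R]_n -> Prop :=
| merge_stop E : (#|isolated_in E V| < 2)%N -> merge_isolated k V E E
| merge_step E (V' : {set 'I_n}) E' :
    (2 <= #|isolated_in E V|)%N ->
    V' \subset isolated_in E V ->
    #|V'| = minn k.+1 #|isolated_in E V| ->
    merge_isolated k V (E + complete_graph R V') E' ->
    merge_isolated k V E E'.

(* Treating block l at round m turns E into E'. *)
Definition simple_step (R : realType) (n k : nat) (s : simple_setup R n)
    (m l : nat) (E E' : 'M[R]_n) : Prop :=
  let m1 := len1 s in
  if (m <= m1)%N then E' = E + cyclic_at (hblk s l) m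
  else if (m < m1 + l)%N then
    exists vs, perm_eq vs (enum (blk s l)) /\
      link_all s (m - m1) (link_weight s (m - m1)) vs E E'
  else if (m == m1 + l)%N && (l != nblk s) then merge_isolated k (blk s l) E E'
  else if expo s l != 0%N then
    E' = E + \sum_(1 <= a < (coef s l).+1) cyclic_at (hsub s l a) (counter s l m)
  else E' = E + cyclic_at (hblk s l) (counter s l m).

(* X l is the edge set of round m when the blocks L, ..., l.+1 have been
   treated. *)
Definition simple_round (R : realType) (n k : nat) (s : simple_setup R n)
    (m : nat) (E : 'M[R]_n) : Prop :=
  exists X : nat -> 'M[R]_n,
    [/\ X (nblk s) = 0,
        forall l, (0 < l <= nblk s)%N -> simple_step k s m l (X l) (X l.-1)
      & E = X 0%N].

Definition simple_base_graph (R : realType) (n k : nat) (V : {set 'I_n})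
    (S : seq 'M[R]_n) : Prop :=
  (smooth_number k #|V| /\ hyper_hypercube k V S) \/
  (~ smooth_number k #|V| /\
   exists s : simple_setup R n,
     [/\ valid_setup k V s,
         forall m, (m < size S)%N -> (counter s 1 m < size (hsub s 1 1))%N,
         (size (hsub s 1 1) <= counter s 1 (size S))%N
       & forall m, (0 < m <= size S)%N -> simple_round k s m (graph_at S m)]).

Definition product_graph (R : realType) (n k : nat) (S : seq 'M[R]_n) : Prop :=
  exists (p q : nat) (Vb Ub : nat -> {set 'I_n}) (A H : nat -> seq 'M[R]_n)
         (ns : seq nat),
    [/\ [/\ n = (p * q)%N, smooth_number k p
          & forall j, (2 <= j <= k.+1)%N -> coprime q j],
        split_into [set: 'I_n]%SET (iota 1 p) Vb /\
        (forall l, (0 < l <= p)%N ->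
           [/\ #|Vb l| = q, simple_base_graph k (Vb l) (A l)
             & size (A l) = size (A 1%N)]),
        split_into [set: 'I_n]%SET (iota 1 q) Ub /\
        (forall l, (0 < l <= q)%N ->
           [/\ #|Ub l| = p, hyper_with k ns (Ub l) (H l)
             & forall l', (0 < l' <= p)%N -> #|(Ub l :&: Vb l')%SET| = 1%N])
      & S = [seq \sum_(1 <= l < p.+1) graph_at (A l) m
              | m <- iota 1 (size (A 1%N))] ++
            [seq \sum_(1 <= l < q.+1) graph_at (H l) m
              | m <- iota 1 (size (H 1%N))]].

Definition base_graph (R : realType) (n k : nat) (S : seq 'M[R]_n) : Prop :=
  exists A E : seq 'M[R]_n,
    [/\ simple_base_graph k [set: 'I_n]%SET A, product_graph k E
      & S = if (size A < size E)%N then A else E].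

(* The library norm on row vectors is the sup norm, not the Euclidean one. *)
Definition enorm (R : realType) (d : nat) (x : 'rV[R]_d) : R :=
  Num.sqrt (\sum_(j < d) x 0 j ^+ 2).

Definition grad (R : realType) (d : nat) (g : 'rV[R]_d -> R) (x : 'rV[R]_d) :
  'rV[R]_d := \row_j 'D_(delta_mx 0 j) g x.

Definition smooth (R : realType) (d : nat) (L : R) (g : 'rV[R]_d -> R) : Prop :=
  (forall x, differentiable g x) /\
  forall x y, enorm (grad g x - grad g y) <= L * enorm (x - y).

Definition average (R : realType) (d n : nat) (x : 'I_n -> 'rV[R]_d) :
  'rV[R]_d := n%:R^-1 *: \sum_(i < n) x i.

Definition mutually_independent (R : realType) (dO dX : measure_display)
    (Omega : measurableType dO) (X : measurableType dX)
    (P : probability Omega R) (I : choiceType) (Y : I -> Omega -> X) : Prop :=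
  forall (s : seq I) (A : I -> set X),
    uniq s -> (forall i, measurable (A i)) ->
    P (\bigcap_(i in [set` s]) (Y i @^-1` A i)) =
      (\prod_(i <- s) P (Y i @^-1` A i))%E.

Definition independent_samples (R : realType) (dO dX : measure_display)
    (Omega : measurableType dO) (X : measurableType dX)
    (P : probability Omega R) (n : nat) (D : 'I_n -> probability X R)
    (xi : 'I_n -> nat -> Omega -> X) : Prop :=
  [/\ forall j r, measurable_fun [set: Omega] (xi j r),
      forall j r (A : set X), measurable A -> P (xi j r @^-1` A) = D j A
    & mutually_independent P (fun jr : 'I_n * nat => xi jr.1 jr.2)].

(* The graph used at iteration r' has number 1 + r' mod m in S, where m = size S,
   and nth counts from 0. *)
Fixpoint dsgd (R : realType) (n d : nat) (Omega X : Type) (S : seq 'M[R]_n)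
    (eta : R) (F : 'I_n -> 'rV[R]_d -> X -> R) (xi : 'I_n -> nat -> Omega -> X)
    (x0 : 'I_n -> 'rV[R]_d) (r : nat) (w : Omega) (i : 'I_n) : 'rV[R]_d :=
  if r is r'.+1 then
    \sum_(j < n) mixing (nth 0 S (r' %% size S)) i j *:
      (dsgd S eta F xi x0 r' w j -
       eta *: grad (F j ^~ (xi j r' w)) (dsgd S eta F xi x0 r' w j))
  else x0 i.

Definition log_base (R : realType) (b x : R) : R := ln x / ln b.

Definition rate (R : realType) (n k : nat) (sigma zeta eps : R) : R :=
  let lg := log_base k.+1%:R n%:R in
  sigma ^+ 2 / (n%:R * eps ^+ 2)
  + (zeta * lg + sigma * Num.sqrt lg) / eps `^ (3%:R / 2%:R)
  + lg / eps.

(* Main.v *)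
(* The rounds of the Base-(k+1) Graph multiply to the exact averaging matrix, and
   there are m = O(log_{k+1} n) of them; hence only the noise and the gradient
   heterogeneity of the last 2 m rounds contribute to the deviation of the nodes
   from their mean. With eta L m <= 1/6 this bounds the mean squared deviation
   by O(eta^2 (m^2 zeta^2 + m sigma^2)) per node, the descent lemma along the
   averages turns the bound into a convergence rate, and eta is chosen to balance
   the terms.

   That the stochastic gradients are unbiased is not assumed, and domination of
   the difference quotients of F is not available. It follows from the variance
   bound: the increment of F - f along a segment is at most the integral of its
   derivative, proved with a Vitali-Caratheodory majorant since the derivative
   need not be continuous, and this makes the difference quotients uniformly
   integrable. *)

(* Averaging is tracked through sums: the linking weights are such that each set V_{j,a} receives
   exactly its share of the global sum, and from then on it only has to average internally. Since
   the shorter of two candidate sequences is returned, its length can be estimated on the simple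
   graph. The window has 2 m rounds rather than m because a window starting in mid-cycle multiplies
   the matrices in a rotated order, for which the construction gives no averaging guarantee; 2 m
   rounds always contain an aligned cycle. Heterogeneity enters with m^2 and noise only with m: the
   former is summed by Cauchy-Schwarz, the latter by orthogonality over distinct pairs of node and
   round. As the iterates depend on earlier samples, this orthogonality rests on the independence of
   a fresh sample from the whole sigma-algebra of the past, turned into a Tonelli formula that takes
   the place of conditional expectations. The deviation bound is self-referential, since gradients
   taken at deviating nodes deviate too; the condition eta L m <= 1/6 keeps the feedback factor
   below 1/2. *)
Require Import Defs.
From HB Require Import structures.
From mathcomp Require Import all_boot all_order all_algebra.
From mathcomp Require Import all_classical all_reals all_analysis.
From mathcomp Require Import measurable_realfun.
From mathcomp Require Import zify ring lra.
Import Order.TTheory GRing.Theory Num.Theory.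
Import numFieldNormedType.Exports.

Set Implicit Arguments.
Unset Strict Implicit.
Unset Printing Implicit Defensive.

Local Open Scope classical_set_scope.
Local Open Scope ring_scope.

(** * Mixing matrices as an action on vectors *)

Section gossip.
Variables (R : realType) (n : nat).
Implicit Types (E : 'M[R]_n) (x y : 'I_n -> R) (S : seq 'M[R]_n) (V : {set 'I_n}).

(* The action of [mixing E] on vectors; unlike [mixing] it is affine in E and
   insensitive to the diagonal of E. *)
Definition estep E x : 'I_n -> R := fun i => x i + \sum_j E i j * (x j - x i).

Definition run S x : 'I_n -> R := foldl (fun y E => estep E y) x S.

(** The conditions under which [mixing E] is doubly stochastic: with row sums at most 1 the
    self-loop weights stay nonnegative. *)
Definition gossip E : Prop :=
  [/\ forall i j, E i j = E j i, forall i j, 0 <= E i j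
    & forall i, \sum_j E i j <= 1].

Definition supported V E : Prop :=
  forall i j, E i j != 0 -> (i \in V) && (j \in V).

Definition averages V S : Prop :=
  forall x i, i \in V -> run S x i = #|V|%:R^-1 * \sum_(j in V) x j.

Lemma run_cat S T x : run (S ++ T) x = run T (run S x).
Proof. exact: foldl_cat. Qed.

Lemma run_rcons S E x : run (rcons S E) x = estep E (run S x).
Proof. by rewrite /run foldl_rcons. Qed.

Lemma run_take_S S m x : (m < size S)%N ->
  run (take m.+1 S) x = estep (nth 0 S m) (run (take m S) x).
Proof. by move=> mS; rewrite (take_nth 0) // run_rcons. Qed.

Lemma eq_estep E x y i : (forall j, (j == i) || (E i j != 0) -> x j = y j) ->
  estep E x i = estep E y i.
Proof.
move=> xy; rewrite /estep xy ?eqxx//; congr (_ + _); apply: eq_bigr => j _.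
have [->|Eij] := eqVneq (E i j) 0; first by rewrite !mul0r.
by rewrite xy ?Eij ?orbT.
Qed.

Lemma eq_estep_supported V E x y i : supported V E -> i \in V ->
  {in V, x =1 y} -> estep E x i = estep E y i.
Proof.
move=> sE iV xy; apply: eq_estep => j /orP[/eqP ->|/sE/andP[_ jV]];
  by rewrite xy.
Qed.

Lemma supported_row0 V E i : supported V E -> i \notin V -> forall j, E i j = 0.
Proof.
move=> sE iV j; apply/eqP/negPn/negP => /sE /andP[]; by rewrite (negPf iV).
Qed.

Lemma supported_col0 V E i : supported V E -> i \notin V -> forall j, E j i = 0.
Proof.
move=> sE iV j; apply/eqP/negPn/negP => /sE /andP[_]; by rewrite (negPf iV).
Qed.

Lemma supportedS (V V' : {set 'I_n}) E : V \subset V' -> supported V E -> supported V' E.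
Proof.
by move=> /fintype.subsetP VV' sE i j /sE/andP[/VV' -> /VV' ->].
Qed.

Lemma supported0 V : supported V (0 : 'M[R]_n).
Proof. by move=> i j; rewrite mxE eqxx. Qed.

Lemma estep_cst V E x i c : supported V E -> i \in V ->
  {in V, forall j, x j = c} -> estep E x i = c.
Proof.
move=> sE iV xc; rewrite /estep xc// big1 ?addr0// => j _.
have [->|/sE/andP[_ jV]] := eqVneq (E i j) 0; first by rewrite mul0r.
by rewrite !xc// subrr mulr0.
Qed.

(** By symmetry the flows E i j (x j - x i) cancel in pairs, and no edge leaves V, so both members
    of each pair lie in the sum. *)
Lemma sum_estep V E x : (forall i j, E i j = E j i) ->
  (forall i j, i \in V -> E i j != 0 -> j \in V) ->
  \sum_(i in V) estep E x i = \sum_(i in V) x i.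
Proof.
move=> symE clV; rewrite /estep big_split /= -[RHS]addr0; congr (_ + _).
have E0 i : i \in V ->
    \sum_j E i j * (x j - x i) = \sum_(j in V) E i j * (x j - x i).
  move=> iV; rewrite [RHS]big_mkcond /=; apply: eq_bigr => j _.
  case: ifP => // /negbT jV; have [->|] := eqVneq (E i j) 0.
    by rewrite mul0r.
  by move=> /(clV _ _ iV); rewrite (negPf jV).
rewrite (eq_bigr _ E0); set s := (X in X = 0).
suff: s = - s by move=> ?; lra.
rewrite /s [in LHS]exchange_big /= -sumrN; apply: eq_bigr => j _.
rewrite -sumrN; apply: eq_bigr => i _.
by rewrite symE -mulrN opprB.
Qed.

Lemma gossip0 : gossip 0.
Proof.
split=> [i j|i j|i]; rewrite ?mxE//.
by rewrite big1 ?ler01// => j _; rewrite mxE.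
Qed.

End gossip.

Arguments averages {R n} V S.

(** Row i only sees the block that contains i; this lets graphs on disjoint blocks run side by side
    without interaction. *)
Lemma supported_sum_in (R : realType) n (J : seq nat) (B : nat -> {set 'I_n})
    (M : nat -> 'M[R]_n) l i j : uniq J -> l \in J ->
  {in J &, forall l l', l != l' -> (B l :&: B l')%SET = finset.set0} ->
  {in J, forall l, supported (B l) (M l)} -> i \in B l ->
  (\sum_(l' <- J) M l') i j = M l i j.
Proof.
move=> uJ lJ dB sM iB; rewrite summxE (bigD1_seq l)//= big_seq_cond.
rewrite big1 ?addr0// => l' /andP[l'J l'l].
apply: (supported_row0 (sM _ l'J)); apply/negP => iB'.
have : i \in (B l' :&: B l)%SET by rewrite finset.in_setI iB'.
by rewrite dB// finset.in_set0.
Qed.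

Lemma supported_sum (R : realType) n (J : seq nat) (B : nat -> {set 'I_n})
    (V : {set 'I_n}) (M : nat -> 'M[R]_n) :
  {in J, forall l, B l \subset V} ->
  {in J, forall l, supported (B l) (M l)} ->
  supported V (\sum_(l <- J) M l).
Proof.
move=> BV sM i j; rewrite summxE => s0.
have /hasP[l lJ] : has (fun l => M l i j != 0) J.
  apply: contraNT s0; rewrite -all_predC => /allP h.
  by rewrite big_seq big1// => l /h /= /negPn/eqP.
exact: (supportedS (BV _ lJ) (sM _ lJ)).
Qed.

Lemma gossip_sum (R : realType) n (J : seq nat) (B : nat -> {set 'I_n})
    (M : nat -> 'M[R]_n) : uniq J ->
  {in J &, forall l l', l != l' -> (B l :&: B l')%SET = finset.set0} ->
  {in J, forall l, supported (B l) (M l)} ->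
  {in J, forall l, gossip (M l)} -> gossip (\sum_(l <- J) M l).
Proof.
move=> uJ dB sM gM; split=> [i j|i j|i].
- by rewrite !summxE !big_seq; apply: eq_bigr => l /gM[+ _ _]; apply.
- by rewrite summxE big_seq; apply: sumr_ge0 => l /gM[_ + _]; apply.
have [/hasP[l lJ iB]|] := boolP (has (fun l => i \in B l) J).
  under eq_bigr do rewrite (supported_sum_in _ uJ lJ dB sM iB).
  by have [_ _] := gM _ lJ; apply.
rewrite -all_predC => /allP h; rewrite big1 ?ler01// => j _.
rewrite summxE big_seq big1// => l lJ.
by apply: (supported_row0 (sM _ lJ)); exact: h.
Qed.

Lemma estep_sum_in (R : realType) n (J : seq nat) (B : nat -> {set 'I_n})
    (M : nat -> 'M[R]_n) l x i : uniq J -> l \in J ->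
  {in J &, forall l l', l != l' -> (B l :&: B l')%SET = finset.set0} ->
  {in J, forall l, supported (B l) (M l)} -> i \in B l ->
  estep (\sum_(l' <- J) M l') x i = estep (M l) x i.
Proof.
move=> uJ lJ dB sM iB; rewrite /estep; congr (_ + _); apply: eq_bigr => j _.
by rewrite (supported_sum_in _ uJ lJ dB sM iB).
Qed.

(** * The hyper-hypercube graph *)

Section digits.
Variable ns : seq nat.
Hypothesis ns_gt0 : {in ns, forall x, (0 < x)%N}.

Let P l := (\prod_(x <- take l ns) x)%N.
Let nl l := nth 1%N ns l.

Let nl_gt0 l : (0 < nl l)%N.
Proof.
rewrite /nl; case: (ltnP l (size ns)) => lS; last by rewrite nth_default.
by rewrite ns_gt0// mem_nth.
Qed.

Let P_gt0 l : (0 < P l)%N.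
Proof.
by rewrite /P big_seq prodn_cond_gt0// => x /mem_take /ns_gt0.
Qed.

Let PS l : (l < size ns)%N -> P l.+1 = (P l * nl l)%N.
Proof. by move=> lS; rewrite /P (take_nth 1%N)// big_rcons/= mulnC. Qed.

Let P_dvd l l' : (l <= l')%N -> (P l %| P l')%N.
Proof.
move=> ll'; rewrite /P -(subnKC ll') takeD big_cat /=; exact: dvdn_mulr.
Qed.

Let mixed_lt a b c d : (a < c)%N -> (b < d)%N -> (a + c * b < c * d)%N.
Proof.
move=> ac bd; apply: (@leq_trans (c * b.+1)).
  by rewrite mulnS ltn_add2r.
by rewrite leq_mul2l bd orbT.
Qed.

Let digitE l i : digit ns l i = ((i %/ P l) %% nl l)%N. Proof. by []. Qed.

Let modPS l i : (l < size ns)%N ->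
  (i %% P l.+1 = i %% P l + P l * digit ns l i)%N.
Proof.
move=> lS; rewrite PS// digitE.
have h : (i = (i %/ P l %/ nl l) * (P l * nl l) +
    (i %% P l + P l * ((i %/ P l) %% nl l)))%N.
  rewrite {1}(divn_eq i (P l)) {1}(divn_eq (i %/ P l) (nl l)).
  by move: (i %/ P l %/ nl l)%N (i %% P l)%N ((i %/ P l) %% nl l)%N => *; lia.
rewrite {1}h modnMDl modn_small//.
by apply: mixed_lt; rewrite ltn_pmod.
Qed.

Let divPS l i : (l < size ns)%N ->
  (i %/ P l = digit ns l i + nl l * (i %/ P l.+1))%N.
Proof.
by move=> lS; rewrite PS// digitE divnMA addnC mulnC -divn_eq.
Qed.

Let low p q l : (l <= size ns)%N ->
  (forall l', (l' < l)%N -> digit ns l' p = digit ns l' q) ->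
  (p %% P l = q %% P l)%N.
Proof.
elim: l => [|l IH] lS h; first by rewrite /P take0 big_nil !modn1.
by rewrite !modPS// h// IH// ?(ltnW lS)// => l' l'l; rewrite h// ltnS ltnW.
Qed.

Let high p q l : (p < P (size ns))%N -> (q < P (size ns))%N ->
  (l <= size ns)%N ->
  (forall l', (l <= l' < size ns)%N -> digit ns l' p = digit ns l' q) ->
  (p %/ P l = q %/ P l)%N.
Proof.
move=> pN qN; move k : (size ns - l)%N => k'.
elim: k' l k => [|k IH] l lk lS h.
  have -> : l = size ns by lia.
  by rewrite !divn_small.
have lS' : (l < size ns)%N by lia.
rewrite (divPS p lS') (divPS q lS') h ?leqnn// (IH l.+1)//; first lia.
by move=> l' /andP[ll' l'S]; rewrite h// (ltnW ll').
Qed.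

Let digit_low p q l l' : (p %% P l = q %% P l)%N -> (l <= size ns)%N ->
  (l' < l)%N -> digit ns l' p = digit ns l' q.
Proof.
move=> pq lS l'l; have l'S : (l' < size ns)%N := leq_trans l'l lS.
suff h i : (digit ns l' i = (i %% P l) %% P l'.+1 %/ P l')%N by rewrite !h pq.
rewrite modn_dvdm ?P_dvd// modPS// mulnC addnC divnMDl ?P_gt0// [X in (_ + X)%N]divn_small ?addn0//.
exact: ltn_pmod.
Qed.

Let digit_high p q l l' : (p %/ P l = q %/ P l)%N -> (l <= l')%N ->
  digit ns l' p = digit ns l' q.
Proof.
move=> pq ll'; rewrite !digitE -(divnK (P_dvd ll')) mulnC.
by rewrite !divnMA pq.
Qed.

Definition other_digits l p q : bool :=
  [forall l' : 'I_(size ns), (nat_of_ord l' != l) ==>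
     (digit ns l' p == digit ns l' q)].

Definition set_digit l p t : nat :=
  (p %% P l + P l * t + P l.+1 * (p %/ P l.+1))%N.

Lemma set_digit_mod l p t : (l < size ns)%N ->
  (set_digit l p t %% P l = p %% P l)%N.
Proof.
move=> lS; rewrite /set_digit PS// -addnA -mulnA -mulnDr addnC mulnC modnMDl.
by rewrite modn_mod.
Qed.

Lemma set_digit_div l p t : (l < size ns)%N -> (t < nl l)%N ->
  (set_digit l p t %/ P l.+1 = p %/ P l.+1)%N.
Proof.
move=> lS tn; rewrite /set_digit addnC mulnC divnMDl ?P_gt0// [X in (_ + X)%N]divn_small ?addn0//.
rewrite PS//. by apply: mixed_lt; rewrite ?ltn_pmod ?P_gt0.
Qed.

Lemma set_digit_digit l p t : (l < size ns)%N -> (t < nl l)%N ->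
  digit ns l (set_digit l p t) = t.
Proof.
move=> lS tn; rewrite digitE /set_digit PS// -addnA -mulnA -mulnDr addnC.
rewrite [(P l * _)%N]mulnC divnMDl ?P_gt0//.
rewrite [(p %% P l %/ P l)%N]divn_small ?ltn_pmod ?P_gt0// addn0 addnC mulnC.
by rewrite modnMDl modn_small.
Qed.

Lemma set_digit_lt l p t : (l < size ns)%N -> (t < nl l)%N ->
  (p < P (size ns))%N -> (set_digit l p t < P (size ns))%N.
Proof.
move=> lS tn pN; have D := P_dvd lS.
rewrite -(divnK D) -ltn_divLR// set_digit_div//.
by rewrite ltn_divLR// divnK.
Qed.

(** The digits below l fix the remainder modulo the partial product and those above l fix the
    quotient. Hence the nodes that round l averages with p sit exactly at the positions
    [set_digit l p t]. *)
Lemma set_digitK l p q : (l < size ns)%N ->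
  (p < P (size ns))%N -> (q < P (size ns))%N -> other_digits l p q ->
  set_digit l p (digit ns l q) = q.
Proof.
move=> lS pN qN /forallP h.
have e l' : (l' < size ns)%N -> l' != l -> digit ns l' p = digit ns l' q.
  by move=> l'S l'l; apply/eqP; have := h (Ordinal l'S); rewrite /= l'l.
have E1 : (p %% P l = q %% P l)%N.
  apply: low; first exact: ltnW.
  by move=> l' l'l; apply: e; rewrite ?(ltn_eqF l'l) ?(ltn_trans l'l).
have E2 : (p %/ P l.+1 = q %/ P l.+1)%N.
  apply: high => // l' /andP[ll' l'S]; apply: e => //.
  by rewrite gtn_eqF.
rewrite /set_digit E1 E2 -modPS// [RHS](divn_eq _ (P l.+1)).
by rewrite addnC mulnC.
Qed.

Lemma other_digits_set_digit l p t : (l < size ns)%N -> (t < nl l)%N ->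
  other_digits l p (set_digit l p t).
Proof.
move=> lS tn; apply/forallP => l'; apply/implyP => l'l; apply/eqP.
have [ll'|l'l'] := ltnP l l'.
  by apply: (@digit_high _ _ l.+1) => //; rewrite set_digit_div.
apply: (@digit_low _ _ l) => //; [|exact: ltnW|].
  by rewrite set_digit_mod.
by rewrite ltn_neqAle l'l.
Qed.

(** Induction step of the averaging: the intervals of length [P l] belonging to the values t of
    digit l tile the interval of length [P l.+1] that contains p. *)
Lemma sum_set_digit (R : realType) (y : nat -> R) l p : (l < size ns)%N ->
  \sum_(0 <= t < nl l) \sum_(0 <= s < P l)
     y (s + P l * (set_digit l p t %/ P l))%N =
  \sum_(0 <= s < P l.+1) y (s + P l.+1 * (p %/ P l.+1))%N.
Proof.
move=> lS; rewrite [X in _ = \sum_(_ <= _ < X) _]PS// mulnC big_nat_mul.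
apply: eq_big_nat => t /andP[_ tn].
rewrite -[X in _ = \sum_(X <= _ < _) _]add0n big_addn mulSn addnK.
apply: eq_bigr => s _; congr y.
have -> : (set_digit l p t %/ P l = t + nl l * (p %/ P l.+1))%N.
  by rewrite divPS// set_digit_digit// set_digit_div.
by have := PS lS; move: (p %/ P l.+1)%N => a; move: (P l.+1) => b ->; lia.
Qed.

End digits.

Section hyper_hypercube.
Variables (R : realType) (n : nat) (ns : seq nat) (V : {set 'I_n}).
Variable pos : 'I_n -> nat.
Hypothesis ns_gt0 : {in ns, forall x, (0 < x)%N}.
Hypothesis cardV : #|V| = (\prod_(x <- ns) x)%N.
Hypothesis pos_inj : {in V &, injective pos}.
Hypothesis pos_lt : {in V, forall v, (pos v < #|V|)%N}.

Let P l := (\prod_(x <- take l ns) x)%N.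
Let nl l := nth 1%N ns l.

Let P_size : P (size ns) = #|V|.
Proof. by rewrite /P take_size cardV. Qed.

Let P0 : P 0 = 1%N.
Proof. by rewrite /P take0 big_nil. Qed.

Let PS l : (l < size ns)%N -> P l.+1 = (nl l * P l)%N.
Proof. by move=> lS; rewrite /P (take_nth 1%N lS) big_rcons /= mulnC. Qed.

Let nl_gt0 l : (0 < nl l)%N.
Proof.
rewrite /nl; case: (ltnP l (size ns)) => lS; last by rewrite nth_default.
by rewrite ns_gt0// mem_nth.
Qed.

Let pos_onto p : (p < #|V|)%N -> exists2 v, v \in V & pos v = p.
Proof.
case N : #|V| => [//|N'] pN.
pose g (v : 'I_n) : 'I_N'.+1 := inord (pos v).
have pv v : v \in V -> (g v : nat) = pos v.
  by move=> vV; rewrite inordK//; move: (pos_lt vV); rewrite N.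
have gV : (g @: V)%SET = [set: 'I_N'.+1]%SET.
  apply/eqP; rewrite eqEcard finset.subsetT cardsT card_ord card_in_imset ?N /= ?leqnn//.
  by move=> u v uV vV /(congr1 val) /=; rewrite !pv//; apply: pos_inj.
have : Ordinal pN \in (g @: V)%SET by rewrite gV finset.in_setT.
by case/imsetP => v vV e; exists v => //; rewrite -pv// -e.
Qed.

(** Inverse of [pos] on V; the default [i0] is returned only for p outside the range of
    positions. *)
Let at_ (i0 : 'I_n) p : 'I_n := odflt i0 [pick u in V | pos u == p].

Let at_P i0 p : (p < #|V|)%N -> at_ i0 p \in V /\ pos (at_ i0 p) = p.
Proof.
move=> /pos_onto[v vV vp]; rewrite /at_; case: pickP => [u /andP[uV /eqP]//|].
by move=> /(_ v); rewrite vV vp eqxx.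
Qed.

Let at_pos i0 v : v \in V -> at_ i0 (pos v) = v.
Proof.
by move=> vV; have [aV ap] := at_P i0 (pos_lt vV); apply: pos_inj.
Qed.

Let P_lt : {in V, forall v, (pos v < \prod_(x <- take (size ns) ns) x)%N}.
Proof. by move=> v vV; rewrite take_size -cardV pos_lt. Qed.

Let set_lt l t i : (l < size ns)%N -> (t < nl l)%N -> i \in V ->
  (set_digit ns l (pos i) t < #|V|)%N.
Proof.
move=> lS tn iV; rewrite cardV -[X in (_ < \prod_(x <- X) _)%N](take_size ns).
by apply: set_digit_lt => //; exact: P_lt.
Qed.

Let sum_other (h : 'I_n -> R) l i : (l < size ns)%N -> i \in V ->
  \sum_(u | (u \in V) && other_digits ns l (pos i) (pos u)) h u =
  \sum_(0 <= t < nl l) h (at_ i (set_digit ns l (pos i) t)).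
Proof.
move=> lS iV; rewrite big_mkord.
rewrite (reindex_onto (fun t : 'I_(nl l) => at_ i (set_digit ns l (pos i) t))
  (fun u => Ordinal (ltn_pmod (pos u %/ P l) (nl_gt0 l)))) /=; last first.
  move=> u /andP[uV iu]; rewrite set_digitK ?at_pos//; exact: P_lt.
apply: eq_bigl => t.
have [aV ap] := at_P i (set_lt lS (ltn_ord t) iV).
rewrite aV ap other_digits_set_digit//=; apply/eqP/val_inj => /=.
exact: set_digit_digit.
Qed.

Let hyperE l i j : hyper_edges R ns V pos l i j =
  if [&& i \in V, j \in V, i != j & other_digits ns l (pos i) (pos j)]
  then (nl l)%:R^-1 else 0.
Proof. by rewrite mxE. Qed.

Lemma supported_hyper_edges l : supported V (hyper_edges R ns V pos l).
Proof.
move=> i j; rewrite hyperE; case: ifP; last by rewrite eqxx.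
by case/and4P => -> ->.
Qed.

Lemma gossip_hyper_edges l : (l < size ns)%N ->
  gossip (hyper_edges R ns V pos l).
Proof.
move=> lS; split=> [i j|i j|i].
- rewrite !hyperE; congr (if _ then _ else _).
  rewrite andbCA (eq_sym i j); congr [&& _, _, _ & _].
  by apply: eq_forallb => l'; congr (_ ==> _); rewrite eq_sym.
- by rewrite hyperE; case: ifP => // _; rewrite invr_ge0.
have [iV|iV] := boolP (i \in V); last first.
  by rewrite big1 ?ler01// => j _; rewrite hyperE (negPf iV).
apply: (@le_trans _ _ (\sum_(u | (u \in V) && other_digits ns l (pos i) (pos u))
   (nl l)%:R^-1)).
  rewrite [leRHS]big_mkcond; apply: ler_sum => j _; rewrite hyperE iV /=.
  by case: (j \in V) => //=; case: eqP => //= _; case: ifP; rewrite ?invr_ge0.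
rewrite sum_other// sumr_const_nat subn0 -(mulr_natl (_^-1)).
by rewrite divff// pnatr_eq0 -lt0n.
Qed.

Let estep_hyper x l i : (l < size ns)%N -> i \in V ->
  estep (hyper_edges R ns V pos l) x i =
  (nl l)%:R^-1 * \sum_(0 <= t < nl l) x (at_ i (set_digit ns l (pos i) t)).
Proof.
move=> lS iV; rewrite /estep.
rewrite (_ : \sum_j _ =
  \sum_(u | (u \in V) && other_digits ns l (pos i) (pos u))
   (nl l)%:R^-1 * (x u - x i)); last first.
  rewrite [RHS]big_mkcond; apply: eq_bigr => j _; rewrite hyperE iV /=.
  case: (j \in V) => /=; last by rewrite mul0r.
  have [->|_] /= := eqVneq i j; first by rewrite subrr !mulr0 if_same.
  by case: ifP; rewrite ?mul0r.
rewrite sum_other// -mulr_sumr sumrB.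
rewrite sumr_const_nat subn0 -(mulr_natl (x i)) mulrBr.
by rewrite mulKf ?subrKC// pnatr_eq0 -lt0n.
Qed.

(** After l rounds a node holds the average over all nodes that share its digits from l on, that is,
    over one interval of [P l] consecutive positions. *)
Let run_hyper x l i : (l <= size ns)%N -> i \in V ->
  run (mkseq (hyper_edges R ns V pos) l) x i =
  (P l)%:R^-1 *
    \sum_(0 <= s < P l) x (at_ i (s + P l * (pos i %/ P l))%N).
Proof.
elim: l i => [|l IH] i lS iV.
  by rewrite P0 big_nat1 invr1 mul1r mul1n divn1 add0n (at_pos _ iV).
have P_S := PS lS; rewrite mkseqS run_rcons estep_hyper// P_S natrM invfM -mulrA; congr (_ * _).
rewrite -P_S -(sum_set_digit ns_gt0 (fun p => x (at_ i p)) (pos i) lS).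
rewrite mulr_sumr; apply: eq_big_nat => t /andP[_ tn].
have [aV ap] := at_P i (set_lt lS tn iV).
rewrite IH ?(ltnW lS)// ap; congr (_ * _).
apply: eq_big_nat => s /andP[_ sP].
have : (s + P l * (set_digit ns l (pos i) t %/ P l) < #|V|)%N.
  rewrite -P_size; have D : (P l %| P (size ns))%N.
    by rewrite /P take_size -{2}(cat_take_drop l ns) big_cat dvdn_mulr.
  have Pl0 : (0 < P l)%N by case: (P l) sP.
  rewrite -(divnK D) -ltn_divLR// addnC mulnC divnMDl//.
  rewrite (divn_small sP) addn0.
  by rewrite ltn_divLR// divnK// P_size; exact: set_lt.
move=> /[dup] /(at_P i)[bV bp] /(at_P (at_ i (set_digit ns l (pos i) t)))[cV cp].
by congr x; apply: pos_inj; rewrite // bp cp.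
Qed.

Lemma averages_hyper : averages V (mkseq (hyper_edges R ns V pos) (size ns)).
Proof.
move=> x i iV; rewrite run_hyper// P_size; congr (_ * _).
under eq_big_nat do rewrite divn_small ?pos_lt// muln0 addn0.
rewrite big_mkord (reindex_onto (fun t : 'I_#|V| => at_ i t)
  (fun u => insubd (Ordinal (pos_lt iV)) (pos u))) /=; last first.
  by move=> u uV; rewrite insubdK ?at_pos//; exact: pos_lt.
apply: eq_bigl => t; have [aV ap] := at_P i (ltn_ord t).
by rewrite aV ap /= valKd eqxx.
Qed.

End hyper_hypercube.

Lemma hyper_with_averages (R : realType) n k ns (V : {set 'I_n})
    (S : seq 'M[R]_n) : hyper_with k ns V S -> averages V S.
Proof.
move=> [[[_ ns_k cardV] _] [pos [pos_inj pos_lt ->]]].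
by apply: averages_hyper => // x /ns_k /andP[].
Qed.

Lemma hyper_with_edges (R : realType) n k ns (V : {set 'I_n})
    (S : seq 'M[R]_n) : hyper_with k ns V S ->
  {in S, forall E, gossip E /\ supported V E}.
Proof.
move=> [[[_ ns_k cardV] _] [pos [pos_inj pos_lt ->]]] E /mapP[l].
rewrite mem_iota add0n => /= lS ->; split; last exact: supported_hyper_edges.
by apply: gossip_hyper_edges => // x /ns_k /andP[].
Qed.

Lemma hyper_with_size (R : realType) n k ns (V : {set 'I_n})
    (S : seq 'M[R]_n) : hyper_with k ns V S -> size S = size ns.
Proof. by move=> [_ [pos [_ _ ->]]]; rewrite size_mkseq. Qed.

(** * Length of the hyper-hypercube graph *)

Lemma factorization_le k N ns : factorization k N ns -> (N <= k.+1 ^ size ns)%N.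
Proof.
move=> [_ ns_k ->]; elim: ns ns_k => [|x ns IH] h; first by rewrite big_nil.
rewrite big_cons expnS leq_mul//.
  by have /andP[] := h x (mem_head _ _).
by apply: IH => y ys; apply: h; rewrite inE ys orbT.
Qed.

(** Two factors with product below k+1 could be replaced by their product, so in a shortest
    factorization any two factors multiply to at least k+1; the factors are then grouped in
    pairs. *)
Lemma min_factorization_half k N ns : (1 < N)%N -> min_factorization k N ns ->
  (k.+1 ^ (size ns)./2 <= N)%N.
Proof.
move=> N1 [[_ ns_k Ne] nsmin].
(* Minimality is restated for lists that may be empty, a form inherited by the tail of [ns]; here
   the empty list is excluded because its product is 1 < N. *)
have {nsmin}: forall ms, {in ms, forall x, (0 < x <= k.+1)%N} ->
    (\prod_(x <- ms) x)%N = (\prod_(x <- ns) x)%N -> (size ns <= size ms)%N.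
  move=> [|m ms] h e; last by apply: nsmin; split=> //; rewrite Ne.
  by move: N1; rewrite Ne -e big_nil.
rewrite {}Ne {N1}; have [m] := ubnP (size ns).
elim: m ns ns_k => // m IH [|x [|y ns]] ns_k sm nsmin.
- by rewrite big_nil.
- rewrite big_seq1/= expn0.
  by have /andP[] := ns_k x (mem_head _ _).
have [/andP[x0 xk] /andP[y0 yk]] : (0 < x <= k.+1)%N /\ (0 < y <= k.+1)%N.
  by split; apply: ns_k; rewrite !inE eqxx ?orbT.
have xy : (k.+1 <= x * y)%N.
  rewrite leqNgt; apply/negP => xy.
  have := nsmin (x * y :: ns)%N; rewrite /= ltnn => h.
  suff: false by []; apply: h.
    move=> z; rewrite inE => /predU1P[->|zs]; first by rewrite muln_gt0 x0 y0 ltnW.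
    by apply: ns_k; rewrite !inE zs !orbT.
  by rewrite !big_cons mulnA.
rewrite /= !big_cons mulnA expnS leq_mul//; apply: IH.
- by move=> z zs; apply: ns_k; rewrite !inE zs !orbT.
- by move: sm => /=; lia.
move=> ms h e; have := nsmin (x :: y :: ms); rewrite /= !ltnS; apply.
  by move=> z; rewrite !inE => /or3P[/eqP->|/eqP->|/h//]; rewrite ?x0 ?y0.
by rewrite !big_cons e.
Qed.

Section hyper_facts.
Variables (R : realType) (n k : nat) (V : {set 'I_n}) (S : seq 'M[R]_n).
Hypothesis HV : hyper_hypercube k V S.

Lemma hyper_averages : averages V S.
Proof. by case: HV => _ [ns /hyper_with_averages]. Qed.

Lemma hyper_edge E : E \in S -> gossip E /\ supported V E.
Proof. by case: HV => _ [ns /hyper_with_edges]; apply. Qed.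

Lemma hyper_size_gt0 : (0 < size S)%N.
Proof. by case: HV => _ [ns /[dup]/hyper_with_size -> [[[]]]]. Qed.

Lemma hyper_size_min ms : factorization k #|V| ms -> (size S <= size ms)%N.
Proof. by case: HV => _ [ns /[dup]/hyper_with_size -> [[_]]] h _; exact: h. Qed.

Lemma hyper_card_le : (#|V| <= k.+1 ^ size S)%N.
Proof.
by case: HV => _ [ns /[dup]/hyper_with_size -> [[]]] /factorization_le.
Qed.

Lemma hyper_card_half : (1 < #|V|)%N -> (k.+1 ^ (size S)./2 <= #|V|)%N.
Proof.
by case: HV => _ [ns /[dup]/hyper_with_size -> [/min_factorization_half]] h _ /h.
Qed.

Lemma hyper_size_coef a p : (0 < a <= k)%N -> #|V| = (a * k.+1 ^ p)%N ->
  (size S <= p.+1)%N.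
Proof.
move=> /andP[a0 ak] Ve; have := @hyper_size_min (a :: nseq p k.+1).
rewrite /= size_nseq; apply; split => //=.
  by move=> x; rewrite inE => /predU1P[->|/nseqP[->]]; lia.
by rewrite Ve big_cons big_nseq iter_muln muln1.
Qed.

Lemma hyper_size_expn p : (0 < k)%N -> (0 < p)%N -> #|V| = (k.+1 ^ p)%N ->
  size S = p.
Proof.
move=> k0 p0 Ve; apply/eqP; rewrite eqn_leq; apply/andP; split; last first.
  by have := hyper_card_le; rewrite Ve leq_exp2l.
have := @hyper_size_min (nseq p k.+1); rewrite size_nseq; apply.
split; first by rewrite size_nseq.
  by move=> x /nseqP[->]; rewrite leqnn.
by rewrite Ve big_nseq iter_muln muln1.
Qed.

Lemma cyclic_at_mem m : cyclic_at S m \in S.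
Proof. by rewrite /cyclic_at /graph_at /= mem_nth// ltn_pmod// hyper_size_gt0. Qed.

(** One full cycle makes the values on V constant, and every later round preserves constants. So a
    short sequence may be repeated for any T at least its length, not only for multiples of it. *)
Lemma cyclic_run (x : nat -> 'I_n -> R) T : (size S <= T)%N ->
  (forall t i, (t < T)%N -> i \in V ->
     x t.+1 i = estep (cyclic_at S t.+1) (x t) i) ->
  {in V, forall i, x T i = #|V|%:R^-1 * \sum_(j in V) x 0%N j}.
Proof.
move=> ST xS.
have xt t : (t <= size S)%N -> {in V, x t =1 run (take t S) (x 0)}.
  elim: t => [_ i _|t IH tS i iV]; first by rewrite take0.
  rewrite xS ?(leq_trans tS)// run_take_S//.
  have -> : cyclic_at S t.+1 = nth 0 S t.
    by rewrite /cyclic_at /graph_at /= modn_small.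
  apply: (@eq_estep_supported _ _ V) => //.
    by have [] := hyper_edge (mem_nth 0 tS).
  by apply: IH; exact: ltnW.
suff h d : (size S + d <= T)%N ->
    {in V, forall i, x (size S + d)%N i = #|V|%:R^-1 * \sum_(j in V) x 0%N j}.
  by have := h (T - size S)%N; rewrite subnKC//; apply.
elim: d => [_|d IH dT] i iV.
  by rewrite addn0 xt// take_size hyper_averages.
rewrite addnS in dT *; rewrite xS//.
apply: (@estep_cst _ _ V) => //.
  by have [] := hyper_edge (cyclic_at_mem (size S + d).+1).
by apply: IH; exact: ltnW.
Qed.

End hyper_facts.

(** * The simple Base-(k+1) graph *)

Lemma in_bigcup_seq n (J : seq nat) (B : nat -> {set 'I_n}) v :
  (v \in (\bigcup_(l <- J) B l)%SET) = has (fun l => v \in B l) J.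
Proof.
elim: J => [|l J IH]; first by rewrite big_nil finset.in_set0.
by rewrite big_cons finset.in_setU IH.
Qed.

Lemma addmxE (R : realType) m n (A B : 'M[R]_(m, n)) i j :
  (A + B) i j = A i j + B i j.
Proof. by rewrite mxE. Qed.

Lemma isolated_row (R : realType) n (E : 'M[R]_n) v : Defs.isolated E v ->
  forall u, E v u = 0 /\ E u v = 0.
Proof. by move=> /forallP h u; have /andP[/eqP -> /eqP ->] := h u. Qed.

Section complete.
Variables (R : realType) (n : nat) (V : {set 'I_n}).

Lemma supported_complete_graph : supported V (complete_graph R V).
Proof.
by move=> i j; rewrite mxE; case: ifP; rewrite ?eqxx// => /and3P[-> ->].
Qed.

Lemma gossip_complete_graph : gossip (complete_graph R V).
Proof.
split=> [i j|i j|i].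
- by rewrite !mxE andbCA (eq_sym i j).
- by rewrite mxE; case: ifP; rewrite ?invr_ge0.
have [iV|iV] := boolP (i \in V); last first.
  by rewrite big1 ?ler01// => j _; rewrite mxE (negPf iV).
apply: (@le_trans _ _ (\sum_(j in V) #|V|%:R^-1)).
  rewrite [leRHS]big_mkcond; apply: ler_sum => j _; rewrite mxE iV /=.
  by case: (j \in V) => //=; case: eqP => //= _; rewrite invr_ge0.
rewrite sumr_const -(mulr_natl (_^-1)) divff// pnatr_eq0 -lt0n.
by apply/card_gt0P; exists i.
Qed.

End complete.

(** Each row of the sum comes from only one of the two graphs, so row sums do not add up. *)
Lemma gossipD (R : realType) n (V : {set 'I_n}) (E E' : 'M[R]_n) :
  gossip E -> gossip E' -> supported V E ->
  {in V, forall i j, E' i j = 0} -> gossip (E + E').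
Proof.
move=> [sE nE rE] [sE' nE' rE'] supE E'0; split=> [i j|i j|i].
- by rewrite 2!mxE sE sE'.
- by rewrite mxE addr_ge0.
have [iV|iV] := boolP (i \in V).
  by under eq_bigr do rewrite mxE E'0// addr0.
by under eq_bigr do rewrite mxE (supported_row0 supE iV) add0r.
Qed.

(** The nodes of a merged clique were isolated before and are not isolated afterwards. The cliques
    are therefore disjoint from one another and from E, and their union is again a gossip graph. *)
Lemma merge_isolated_sum (R : realType) n k (V : {set 'I_n}) (E E' : 'M[R]_n) :
  (0 < k)%N -> merge_isolated k V E E' ->
  exists M, [/\ E' = E + M, gossip M & supported (isolated_in E V) M].
Proof.
move=> k_gt0; elim=> {E E'} [E _|E V' E' c2 V'sub V'card _ [M [-> gM sM]]].
  by exists 0; rewrite addr0; split=> //; [exact: gossip0|exact: supported0].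
have V'iso i : i \in V' -> Defs.isolated E i.
  by move=> /(fintype.subsetP V'sub); rewrite inE => /andP[].
(* As k > 0, a clique has at least two nodes, so each of its nodes gains a neighbour and cannot be
   selected again. *)
have V'2 : (1 < #|V'|)%N by rewrite V'card leq_min c2 ltnS k_gt0.
have sK := @supported_complete_graph R n V'.
have iso_V' i : i \in V' -> ~~ Defs.isolated (E + complete_graph R V') i.
  move=> iV'; have : (0 < #|V' :\ i|)%N by have := cardsD1 i V'; rewrite iV'; lia.
  move=> /card_gt0P[u]; rewrite !inE => /andP[ui uV'].
  apply/negP => /isolated_row/(_ u)[+ _].
  rewrite addmxE mxE; have [-> _] := isolated_row (V'iso _ iV') u.
  rewrite iV' uV' eq_sym ui add0r => /eqP; rewrite invr_eq0 pnatr_eq0.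
  by move: V'2; case: #|V'|.
have isoS : isolated_in (E + complete_graph R V') V \subset isolated_in E V.
  apply/fintype.subsetP => i; rewrite !inE => /andP[-> /= iso].
  have iV' : i \notin V' by apply: contraL iso => /iso_V'.
  apply/forallP => u; have [e1 e2] := isolated_row iso u.
  move: e1 e2; rewrite !addmxE.
  rewrite (supported_row0 sK iV') (supported_col0 sK iV') !addr0 => -> ->.
  by rewrite eqxx.
exists (complete_graph R V' + M); split; first by rewrite addrA.
  apply: (@gossipD _ _ V') => //; first exact: gossip_complete_graph.
  move=> i iV'; apply: (supported_row0 sM).
  by rewrite inE negb_and iso_V' ?orbT.
move=> i j; have [K0|/sK/andP[iV' jV'] _] := eqVneq (complete_graph R V' i j) 0.
  by rewrite addmxE K0 add0r; apply: (supportedS isoS sM).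
by rewrite !(fintype.subsetP V'sub).
Qed.

(** * Linking the later blocks to one block *)

Section link.
Variables (R : realType) (n : nat) (B : {set 'I_n}) (a : nat).
Variables (Sb : nat -> {set 'I_n}) (w : R).
Hypothesis w_ge0 : 0 <= w.
Hypothesis B_split : split_into B (iota 1 a) Sb.

(** Invariant of the linking loop, with B the block V_j, [Sb b] its parts V_{j,b} and Q the nodes
    linked so far: every node of Q sends weight w into each part, and a node of B carries at most
    the weight of one edge. *)
Definition linked (Q : {set 'I_n}) (E : 'M[R]_n) : Prop :=
  [/\ forall i j, E i j = E j i, forall i j, 0 <= E i j,
      forall i j, E i j != 0 -> (i \in Q) && (j \in B) || (i \in B) && (j \in Q),
      forall v b, b \in iota 1 a -> \sum_(u in Sb b) E v u = w * (v \in Q)%:R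
    & {in B, forall u, \sum_v E u v <= w}].

Lemma linked0 : linked finset.set0 0.
Proof.
split=> [i j|i j|i j|v b _|u _]; rewrite ?mxE ?eqxx//.
  by rewrite finset.in_set0 mulr0 big1// => u _; rewrite mxE.
by rewrite big1// => v _; rewrite mxE.
Qed.

Let subB b u : b \in iota 1 a -> u \in Sb b -> u \in B.
Proof.
by move=> ba ub; case: B_split => -> _; rewrite in_bigcup_seq; apply/hasP; exists b.
Qed.

(** The row of a selected node was zero since the node was isolated, and becomes w; the parts being
    disjoint, no node is selected twice for the same v. *)
Lemma linkedU (Q : {set 'I_n}) (E : 'M[R]_n) v (u : nat -> 'I_n) :
  linked Q E -> v \notin B -> v \notin Q ->
  {in iota 1 a, forall b, u b \in Sb b /\ Defs.isolated E (u b)} ->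
  linked (v |: Q) (E + \sum_(b <- iota 1 a) edge w v (u b)).
Proof.
move=> [symE nnE supE colE rowE] vB vQ uP.
(* [q i] counts how often i is selected; w times q is row v of the new edges. Disjointness of the
   parts makes it 0 or 1. *)
pose q i : R := \sum_(b <- iota 1 a) (i == u b)%:R.
have q_ge0 i : 0 <= q i by apply: sumr_ge0.
have qB i : i \notin B -> q i = 0.
  move=> iB; rewrite /q big_seq big1// => b ba; case: eqP => // iu.
  by move: iB; rewrite iu (subB ba)//; have [] := uP _ ba.
have qS b i : b \in iota 1 a -> i \in Sb b -> q i = (i == u b)%:R.
  move=> ba ib; rewrite /q (bigD1_seq b) ?iota_uniq//= big_seq_cond big1 ?addr0//.
  move=> c /andP[ca cb]; case: eqP => // iu.
  have : i \in (Sb c :&: Sb b)%SET.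
    by rewrite finset.in_setI ib andbT iu; have [] := uP _ ca.
  by case: B_split => _ /(_ _ _ ca ba cb) ->; rewrite finset.in_set0.
have ME i j : (\sum_(b <- iota 1 a) edge w v (u b)) i j =
    w * ((i == v)%:R * q j + (j == v)%:R * q i).
  rewrite summxE !mulr_sumr -big_split mulr_sumr /=; apply: eq_bigr => b _.
  by rewrite !mxE -!natrM !mulnb [(i == u b) && _]andbC.
set M := \sum_(b <- _) _ in ME *.
have M_ge0 i j : 0 <= M i j.
  by rewrite ME mulr_ge0// addr_ge0// mulr_ge0.
have u_row b : b \in iota 1 a -> forall i, E (u b) i = 0.
  by move=> ba i; have [_ /isolated_row/(_ i)[]] := uP _ ba.
split=> [i j|i j|i j|i b ba|i iB].
- by rewrite 2!mxE symE !ME; congr (_ + w * _); rewrite addrC.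
- by rewrite mxE addr_ge0.
- rewrite mxE !finset.in_setU1.
  have [->|/supE + _] := eqVneq (E i j) 0; last first.
    by case/orP => /andP[-> ->]; rewrite ?orbT.
  rewrite add0r ME mulf_eq0 negb_or => /andP[_].
  have [iv|_] := eqVneq i v; have [jv|_] := eqVneq j v.
  + by rewrite iv jv qB// !mulr0 addr0 eqxx.
  + rewrite mul0r addr0 mul1r /=; apply: contraNT; rewrite negb_or.
    by move=> /andP[jB _]; rewrite qB.
  + rewrite mul0r add0r mul1r /=; apply: contraNT; rewrite negb_or => /andP[_].
    by rewrite andbT => iB; rewrite qB.
  + by rewrite !mul0r addr0 eqxx.
- under eq_bigr do rewrite mxE ME; rewrite big_split/= colE// -mulr_sumr.
  rewrite -mulrDr big_split/= -mulr_sumr.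
  rewrite (eq_bigr (fun j => (j == u b)%:R)); last by move=> j; exact: qS.
  have [ub _] := uP _ ba.
  rewrite [X in _ + (_ * X + _)](bigD1 (u b))//= eqxx big1 ?addr0; last first.
    by move=> j /andP[_ /negPf ->].
  rewrite mulr1 big1 ?addr0; last first.
    move=> j jb; case: eqP => [jv|_]; last by rewrite mul0r.
    by move: vB; rewrite -jv (subB ba).
  rewrite finset.in_setU1; congr (_ * _).
  by case: eqP => [->|_]; rewrite ?(negPf vQ) ?addr0 ?add0r.
have [b ba ib] : exists2 b, b \in iota 1 a & i \in Sb b.
  by case: B_split iB => -> _; rewrite in_bigcup_seq => /hasP.
have iv : i != v by apply: contraNneq vB => <-.
have -> : \sum_j (E + M) i j = \sum_j E i j + w * (i == u b)%:R.
  under eq_bigr do rewrite mxE ME (negPf iv) mul0r add0r (qS _ _ ba ib).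
  rewrite big_split/= -mulr_sumr; congr (_ + _ * _).
  by rewrite (bigD1 v)//= eqxx mul1r big1 ?addr0// => j /negPf ->; rewrite mul0r.
have [->|_] := eqVneq i (u b); last by rewrite mulr0 addr0 rowE.
by rewrite mulr1 big1 ?add0r// => j _; exact: u_row.
Qed.

End link.

Lemma estepDl (R : realType) n (E E' : 'M[R]_n) x i :
  (forall j, E' i j = 0) -> estep (E + E') x i = estep E x i.
Proof.
move=> E'0; rewrite /estep; congr (_ + _); apply: eq_bigr => j _.
by rewrite addmxE E'0 addr0.
Qed.

Lemma mem_iota1 l q : (l \in iota 1 q) = (0 < l <= q)%N.
Proof. by rewrite mem_iota add1n ltnS. Qed.

Lemma sum_iotaS (M : nmodType) q (f : nat -> M) :
  \sum_(l <- iota 1 q.+1) f l = \sum_(l <- iota 1 q) f l + f q.+1.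
Proof. by rewrite -(addn1 q) iotaD big_cat /= big_seq1 addnC. Qed.

Lemma sum_split (R : realType) n (V : {set 'I_n}) J B (f : 'I_n -> R) :
  uniq J -> split_into V J B ->
  \sum_(u in V) f u = \sum_(l <- J) \sum_(u in B l) f u.
Proof.
move=> + [->]; elim: J => [|l J IH] /=; first by rewrite !big_nil big_set0.
move=> /andP[lJ uJ] dB; rewrite !big_cons -IH//; last first.
  by move=> a b aJ bJ; apply: dB; rewrite inE ?aJ ?bJ orbT.
rewrite -bigU /=; first by apply: eq_bigl => u; rewrite !inE.
rewrite -setI_eq0; apply/eqP/setP => u; rewrite !inE in_bigcup_seq.
apply/negbTE/negP => /andP[ul /hasP[l' l'J ul']].
have ll' : l != l' by apply: contraNneq lJ => ->.
have := dB l l'; rewrite !inE eqxx l'J orbT => /(_ isT isT ll')/setP/(_ u).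
by rewrite !inE ul ul'.
Qed.

Lemma sumr_card (R : realType) n (V : {set 'I_n}) :
  \sum_(u in V) 1 = #|V|%:R :> R.
Proof. by rewrite sumr_const. Qed.

Lemma telescope_blocks (R : realType) n (X D : nat -> 'M[R]_n) q :
  (forall l, (0 < l <= q)%N -> X l.-1 = X l + D l) ->
  X 0%N = X q + \sum_(l <- iota 1 q) D l.
Proof.
elim: q => [|q IH] h; first by rewrite big_nil addr0.
rewrite sum_iotaS IH; last by move=> l /andP[l0 lq]; rewrite h// l0 ltnW.
by have /= -> := h q.+1 (leqnn _); rewrite -addrA; congr (_ + _); rewrite addrC.
Qed.

Section simple.
Variables (R : realType) (n k : nat) (V : {set 'I_n}) (S : seq 'M[R]_n).
Variable s : simple_setup R n.
Hypothesis k_gt0 : (0 < k)%N.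
Hypothesis V_gt0 : (0 < #|V|)%N.
Hypothesis nonsmooth : ~ smooth_number k #|V|.
Hypothesis valid : valid_setup k V s.
Hypothesis round_lt :
  forall m, (m < size S)%N -> (counter s 1 m < size (hsub s 1 1))%N.
Hypothesis round_end : (size (hsub s 1 1) <= counter s 1 (size S))%N.
Hypothesis rounds :
  forall m, (0 < m <= size S)%N -> simple_round k s m (graph_at S m).

Notation L := (nblk s).
Notation B := (blk s).
Notation p := (expo s).
Notation m1 := (len1 s).

Let V_split : split_into V (iota 1 L) B. Proof. by case: valid. Qed.

Let coef_le l : (0 < l <= L)%N -> (0 < Defs.coef s l <= k)%N.
Proof. by case: valid => -[_ _ h] _ _; exact: h. Qed.

Let p_lt l l' : (0 < l)%N -> (l < l')%N -> (l' <= L)%N -> (p l' < p l)%N.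
Proof. by case: valid => -[_ h _] _ _; exact: h. Qed.

Let cardB l : (0 < l <= L)%N -> #|B l| = (Defs.coef s l * k.+1 ^ p l)%N.
Proof. by case: valid => _ _ h /h[]. Qed.

Let hblkP l : (0 < l <= L)%N -> hyper_hypercube k (B l) (hblk s l).
Proof. by case: valid => _ _ h /h[]. Qed.

Let B_split l : (0 < l <= L)%N ->
  split_into (B l) (iota 1 (Defs.coef s l)) (Defs.sub s l).
Proof. by case: valid => _ _ h /h[]. Qed.

Let hsubP l a : (0 < l <= L)%N -> (0 < a <= Defs.coef s l)%N ->
  #|Defs.sub s l a| = (k.+1 ^ p l)%N /\
  hyper_hypercube k (Defs.sub s l a) (hsub s l a).
Proof. by case: valid => _ _ h /h[_ _ _]; apply. Qed.

(** A number a (k+1)^p with a <= k has only prime factors at most k+1, so a single block would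
    contradict [nonsmooth]. *)
Let L_gt1 : (1 < L)%N.
Proof.
rewrite ltnNge; apply/negP => L1; apply: nonsmooth => q q_prime.
have [[-> _ _] _ _] := valid.
case: (posnP L) => [L0|L0].
  by have [[e _ _] _ _] := valid; move: V_gt0; rewrite e L0 big_geq.
have -> : L = 1%N by lia.
have /coef_le/andP[a0 ak] : (0 < 1 <= L)%N by rewrite L0.
rewrite big_nat1 Euclid_dvdM// => /orP[/dvdn_leq|]; first by move/(_ a0); lia.
by rewrite Euclid_dvdX// => /andP[qk _]; exact: dvdn_leq qk.
Qed.

Let L_gt0 : (0 < L)%N. Proof. exact: ltnW. Qed.

Let p_le l : (0 < l <= L)%N -> (p l + l <= p 1 + 1)%N.
Proof.
elim: l => // -[|l] IH /andP[_ lL]; first by [].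
by have := @p_lt l.+1 l.+2 isT (ltnSn _) lL; have := IH (ltnW lL); lia.
Qed.

Let p_gt0 l : (0 < l < L)%N -> (0 < p l)%N.
Proof. by move=> /andP[l0 lL]; apply: leq_trans (@p_lt l L l0 lL _). Qed.

Let p1_le_m1 : (p 1 <= m1)%N.
Proof.
have L1 : (0 < 1 <= L)%N by rewrite L_gt0.
have := hyper_card_le (hblkP L1); rewrite cardB//.
move=> /(leq_trans _) => /(_ (k.+1 ^ p 1)%N); rewrite leq_pmull; last first.
  by case/andP: (coef_le L1).
by rewrite leq_exp2l//; apply.
Qed.

(** For l > 1 the length is at most p_l + 1 <= p_1 <= m_1, so the first m_1 rounds average every
    block, not only V_1. *)
Let hblk_le l : (0 < l <= L)%N -> (size (hblk s l) <= m1)%N.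
Proof.
move=> lL; case: (ltngtP l 1) => [|l1|->//]; first by case: l lL.
apply: leq_trans (hyper_size_coef (hblkP lL) (coef_le lL) (cardB lL)) _.
by apply: leq_trans p1_le_m1; have := p_le lL; lia.
Qed.

Let m1_gt0 : (0 < m1)%N.
Proof. by apply: (hyper_size_gt0 (hblkP _)); rewrite L_gt0. Qed.

Let hsub_size l a : (0 < l < L)%N -> (0 < a <= Defs.coef s l)%N ->
  size (hsub s l a) = p l.
Proof.
move=> lL aa; have lL' : (0 < l <= L)%N by case/andP: lL => -> /ltnW.
have [c h] := hsubP lL' aa; exact: (hyper_size_expn h k_gt0 (p_gt0 lL) c).
Qed.

Let counterE l m : (0 < l < L)%N -> counter s l m = (m - (m1 + l))%N.
Proof.
move=> /andP[l0 lL]; rewrite /counter.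
rewrite (eq_count (a2 := fun i => (m1 + l < i)%N)); last first.
  by move=> i; rewrite /last_case (ltn_eqF lL) andbT; lia.
elim: m => [|m IH]; first by rewrite sub0n.
rewrite -(addn1 m) iotaD count_cat IH /= add1n addn0.
by case: ltnP; lia.
Qed.

(** The counter b_1 is 0 through round m_1 + 1 and then grows by one in each round; the loop ends
    when it reaches p_1, the length of H_k(V_{1,1}). *)
Let sizeS : size S = (m1 + 1 + p 1)%N.
Proof.
have h11 : size (hsub s 1 1) = p 1.
  apply: hsub_size; first by rewrite L_gt1.
  by have := @coef_le 1; rewrite L_gt0 => /(_ isT) /andP[->].
have p1 : (0 < p 1)%N by apply: p_gt0; rewrite L_gt1.
move: round_end; rewrite h11 counterE ?L_gt1// => e.
have : (0 < size S)%N by case: size e => //; rewrite sub0n; lia.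
move=> s0; have := @round_lt (size S).-1; rewrite h11 counterE ?L_gt1//.
by rewrite prednK// leqnn => /(_ isT); lia.
Qed.

Let m1S : (m1 <= size S)%N. Proof. by rewrite sizeS -addnA leq_addr. Qed.

Let L_le : (L <= p 1 + 1)%N.
Proof. by have := @p_le L; rewrite L_gt0 leqnn => /(_ isT); lia. Qed.

Lemma simple_size_gt0 : (0 < size S)%N.
Proof. by rewrite sizeS addn1. Qed.

(** The witness is the leading exponent p_1: the length is m_1 + 1 + p_1 with m_1 <= p_1 + 1, and
    V_1 alone has at least (k+1)^(p_1) nodes. *)
Lemma simple_size : exists q, (size S <= 2 * q + 2)%N /\ (k.+1 ^ q <= #|V|)%N.
Proof.
have L1 : (0 < 1 <= L)%N by rewrite L_gt0.
exists (p 1); split.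
  rewrite sizeS.
  have : (m1 <= (p 1).+1)%N :=
    hyper_size_coef (hblkP L1) (coef_le L1) (cardB L1).
  by lia.
apply: (@leq_trans #|B 1|).
  by rewrite cardB// leq_pmull//; case/andP: (coef_le L1).
apply: subset_leq_card; apply/fintype.subsetP => v vB.
by case: V_split => -> _; rewrite in_bigcup_seq; apply/hasP; exists 1%N; rewrite ?mem_iota1.
Qed.

Let BV l : (0 < l <= L)%N -> B l \subset V.
Proof.
move=> lL; apply/fintype.subsetP => v vB.
by case: V_split => -> _; rewrite in_bigcup_seq; apply/hasP; exists l; rewrite ?mem_iota1.
Qed.

Let subB l a : (0 < l <= L)%N -> (0 < a <= Defs.coef s l)%N ->
  Defs.sub s l a \subset B l.
Proof.
move=> lL aa; apply/fintype.subsetP => v vB.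
by case: (B_split lL) => -> _; rewrite in_bigcup_seq; apply/hasP; exists a; rewrite ?mem_iota1.
Qed.

Let B_dis l l' v : (0 < l <= L)%N -> (0 < l' <= L)%N -> v \in B l ->
  v \in B l' -> l = l'.
Proof.
move=> lL lL' vl vl'; apply/eqP/negPn/negP => ll'.
have := (proj2 V_split) l l'; rewrite !mem_iota1 => /(_ lL lL' ll')/setP/(_ v).
by rewrite !inE vl vl'.
Qed.

Let inV v : v \in V -> exists2 l, (0 < l <= L)%N & v \in B l.
Proof.
case: V_split => -> _; rewrite in_bigcup_seq => /hasP[l].
by rewrite mem_iota1 => ? ?; exists l.
Qed.

(** The nodes from block j on; their number is the sum in the denominator of [link_weight s j]. *)
Let U j := (\bigcup_(l <- iota j (L.+1 - j)) B l)%SET.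

Let in_U j v : reflect (exists2 l, (j <= l <= L)%N & v \in B l) (v \in U j).
Proof.
rewrite in_bigcup_seq; apply: (iffP hasP) => -[l h vl]; exists l => //;
  by move: h; rewrite mem_iota; lia.
Qed.

Let U_split j : (0 < j)%N -> split_into (U j) (iota j (L.+1 - j)) B.
Proof.
move=> j0; split=> // l l'; rewrite !mem_iota => lL lL'.
by apply: (proj2 V_split); rewrite mem_iota1; lia.
Qed.

Let sumU j (f : 'I_n -> R) : (0 < j <= L)%N ->
  \sum_(u in U j) f u = \sum_(u in B j) f u + \sum_(u in U j.+1) f u.
Proof.
move=> /andP[j0 jL]; rewrite (sum_split _ _ (U_split j0)) ?iota_uniq//.
rewrite (sum_split _ _ (U_split (ltn0Sn j))) ?iota_uniq//.
by rewrite subSS subSn//= big_cons.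
Qed.

Let cardU j : (0 < j <= L)%N -> (#|U j| = \sum_(j <= l < L.+1) #|B l|)%N.
Proof.
move=> /andP[j0 jL]; apply/eqP; rewrite -(eqr_nat R) -sumr_card.
rewrite (sum_split _ _ (U_split j0)) ?iota_uniq// natr_sum.
by apply/eqP; apply: eq_bigr => l _; rewrite sumr_card.
Qed.

Let BU j : (0 < j <= L)%N -> B j \subset U j.
Proof.
move=> /andP[_ jL]; apply/fintype.subsetP => v vB; apply/in_U; exists j => //.
by rewrite leqnn.
Qed.

Let cardB_gt0 l : (0 < l <= L)%N -> (0 < #|B l|)%N.
Proof.
by move=> lL; rewrite cardB// muln_gt0 expn_gt0 andbT; case/andP: (coef_le lL).
Qed.

Let cardU_gt0 j : (0 < j <= L)%N -> (0 < #|U j|)%N.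
Proof.
by move=> jL; apply: leq_trans (cardB_gt0 jL) _; rewrite subset_leq_card ?BU.
Qed.

(** What block l contributes to round m when the last of the four cases applies to it. *)
Definition inner_graph l m : 'M[R]_n :=
  if p l != 0%N then
    \sum_(1 <= a < (Defs.coef s l).+1) cyclic_at (hsub s l a) (counter s l m)
  else cyclic_at (hblk s l) (counter s l m).

Let index_iota1 q : index_iota 1 q.+1 = iota 1 q.
Proof. by rewrite /index_iota subn1. Qed.

Let inner_graphP l m : (0 < l <= L)%N ->
  gossip (inner_graph l m) /\ supported (B l) (inner_graph l m).
Proof.
move=> lL; rewrite /inner_graph; case: ifP => _; last first.
  exact: (hyper_edge (hblkP lL) (cyclic_at_mem (hblkP lL) _)).
have hE a : a \in iota 1 (Defs.coef s l) ->
    gossip (cyclic_at (hsub s l a) (counter s l m)) /\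
    supported (Defs.sub s l a) (cyclic_at (hsub s l a) (counter s l m)).
  rewrite mem_iota1 => aa; have [_ h] := hsubP lL aa.
  exact: (hyper_edge h (cyclic_at_mem h _)).
rewrite index_iota1; split.
  by apply: (gossip_sum (iota_uniq _ _) (proj2 (B_split lL))) => a /hE[].
apply: (@supported_sum _ _ _ (Defs.sub s l)) => a aa; last by have [] := hE _ aa.
by move: aa; rewrite mem_iota1; exact: subB.
Qed.

Let estep_inner l m a x i : (0 < l <= L)%N -> p l != 0%N ->
  (0 < a <= Defs.coef s l)%N -> i \in Defs.sub s l a ->
  estep (inner_graph l m) x i =
  estep (cyclic_at (hsub s l a) (counter s l m)) x i.
Proof.
move=> lL p0 aa ia; rewrite /inner_graph p0 index_iota1.
apply: (estep_sum_in _ _ _ (proj2 (B_split lL))); rewrite ?iota_uniq ?mem_iota1//.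
move=> b; rewrite mem_iota1 => bb; have [_ h] := hsubP lL bb.
by have [] := hyper_edge h (cyclic_at_mem h (counter s l m)).
Qed.

Let iotaL l q : (q <= L)%N -> l \in iota 1 q -> (0 < l <= L)%N.
Proof. by move=> qL; rewrite mem_iota1 => /andP[-> /leq_trans->]. Qed.

Let inner_sumP q m : (q <= L)%N ->
  gossip (\sum_(l <- iota 1 q) inner_graph l m) /\
  supported V (\sum_(l <- iota 1 q) inner_graph l m).
Proof.
move=> qL; split.
  apply: (@gossip_sum _ _ _ B _ (iota_uniq _ _)) => [l l' /(iotaL qL) lL /(iotaL qL) lL'|l|l].
  - by apply: (proj2 V_split); rewrite mem_iota1.
  - by move=> /(iotaL qL)/(inner_graphP m)[].
  - by move=> /(iotaL qL)/(inner_graphP m)[].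
apply: (@supported_sum _ _ _ B) => l /(iotaL qL); first exact: BV.
by move=> /(inner_graphP m)[].
Qed.

Let estep_inner_sum q m l x i : (q <= L)%N -> (0 < l <= q)%N -> i \in B l ->
  estep (\sum_(l <- iota 1 q) inner_graph l m) x i =
  estep (inner_graph l m) x i.
Proof.
move=> qL lq il; apply: (@estep_sum_in _ _ _ B); rewrite ?iota_uniq ?mem_iota1//.
  by move=> a b /(iotaL qL) ? /(iotaL qL) ?; apply: (proj2 V_split); rewrite mem_iota1.
by move=> a /(iotaL qL)/(inner_graphP m)[].
Qed.

Let inner_sum_row0 q m j i : (q < j)%N -> (j <= L)%N -> i \in U j ->
  forall i', (\sum_(l <- iota 1 q) inner_graph l m) i i' = 0.
Proof.
move=> qj jL /in_U[l' l'L il'] i'; rewrite summxE big_seq big1// => l.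
rewrite mem_iota1 => lq; have lL : (0 < l <= L)%N by lia.
apply: (supported_row0 (proj2 (inner_graphP m lL))); apply/negP => il.
have /(B_dis lL)/(_ il il') : (0 < l' <= L)%N by lia.
by lia.
Qed.

Lemma first_round m : (0 < m <= m1)%N ->
  graph_at S m = \sum_(l <- iota 1 L) cyclic_at (hblk s l) m.
Proof.
move=> mm; have [|X [XL Xs ->]] := @rounds m; first by lia.
rewrite (@telescope_blocks _ _ X (fun l => cyclic_at (hblk s l) m) L) ?XL ?add0r//.
by move=> l /Xs; rewrite /simple_step; case/andP: mm => _ ->.
Qed.

Let simple_step_inner m l (E E' : 'M[R]_n) : (m1 + l < m)%N || ((l == L) && (m1 + L <= m)%N) ->
  (0 < l <= L)%N ->
  simple_step k s m l E E' -> E' = E + inner_graph l m.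
Proof.
move=> ml lL; rewrite /simple_step /inner_graph.
have -> : (m <= m1)%N = false by lia.
have -> : (m < m1 + l)%N = false by lia.
have -> : (m == m1 + l)%N && (l != L) = false by lia.
by case: ifP.
Qed.

Lemma late_round j : (L <= j)%N -> (m1 + j <= size S)%N ->
  graph_at S (m1 + j) = \sum_(l <- iota 1 L) inner_graph l (m1 + j).
Proof.
move=> Lj jS; have [|X [XL Xs ->]] := @rounds (m1 + j)%N; first by lia.
rewrite (@telescope_blocks _ _ X (fun l => inner_graph l (m1 + j)) L) ?XL ?add0r//.
by move=> l lL; have := Xs l lL; apply: simple_step_inner => //; lia.
Qed.

Let link_weight_ge0 j : 0 <= link_weight s j :> R.
Proof. by rewrite /link_weight divr_ge0// mulr_ge0. Qed.

Let link_weightE j : (0 < j <= L)%N ->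
  (Defs.coef s j)%:R * link_weight s j = #|B j|%:R / #|U j|%:R :> R.
Proof.
move=> jL; rewrite /link_weight -cardU// invfM mulrCA; congr (_ * _).
rewrite mulrA divff ?mul1r// pnatr_eq0 -lt0n; by case/andP: (coef_le jL).
Qed.

Let coef_weight_le1 j : (0 < j <= L)%N ->
  (Defs.coef s j)%:R * link_weight s j <= 1 :> R.
Proof.
move=> jL; rewrite link_weightE// ler_pdivrMr ?ltr0n ?cardU_gt0// mul1r ler_nat.
by rewrite subset_leq_card// BU.
Qed.

Let link_weight_le1 j : (0 < j <= L)%N -> link_weight s j <= 1 :> R.
Proof.
move=> jL; apply: le_trans (coef_weight_le1 jL); rewrite ler_peMl//.
by rewrite ler1n; case/andP: (coef_le jL).
Qed.

Let link_all_linked j vs (Q : {set 'I_n}) (E E' : 'M[R]_n) : (0 < j <= L)%N ->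
  link_all s j (link_weight s j) vs E E' -> uniq vs ->
  (forall v, v \in vs -> v \notin B j /\ v \notin Q) ->
  linked (B j) (Defs.coef s j) (Defs.sub s j) (link_weight s j) Q E ->
  linked (B j) (Defs.coef s j) (Defs.sub s j) (link_weight s j)
    (Q :|: [set v in vs])%SET E'.
Proof.
move=> jL h; elim: h Q => {vs E E'} [E Q _ _|v vs u E E' uP _ IH Q].
  by rewrite (_ : [set v in [::]]%SET = finset.set0) ?finset.setU0//; apply/setP => v; rewrite !inE.
move=> /andP[vvs uvs] vQ lE.
rewrite (_ : (Q :|: _)%SET = ((v |: Q) :|: [set w in vs])%SET); last first.
  by apply/setP => w; rewrite !inE orbCA !orbA.
have [vB vQ'] := vQ v (mem_head _ _).
apply: IH => //.
  move=> w wvs; have [wB wQ] : w \notin B j /\ w \notin Q.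
    by apply: vQ; rewrite inE wvs orbT.
  split=> //; rewrite finset.in_setU1 negb_or wQ andbT.
  by apply: contraNneq vvs => <-.
rewrite index_iota1; apply: linkedU => //; first exact: B_split.
by move=> b; rewrite mem_iota1; exact: uP.
Qed.

Let linkedP j := linked (B j) (Defs.coef s j) (Defs.sub s j) (link_weight s j).

Let linked_step j l E E' : (0 < j < l)%N -> (l <= L)%N ->
  linkedP j (U l.+1) E -> simple_step k s (m1 + j) l E E' ->
  linkedP j (U l) E'.
Proof.
move=> jl lL lE; rewrite /simple_step.
have -> : (m1 + j <= m1)%N = false by lia.
have -> : (m1 + j < m1 + l)%N by lia.
rewrite addKn => -[vs [vsB h]].
have jL : (0 < j <= L)%N by lia.
have lL' : (0 < l <= L)%N by lia.
have vsE v : (v \in vs) = (v \in B l) by rewrite (perm_mem vsB) mem_enum.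
have -> : U l = (U l.+1 :|: [set v in vs])%SET.
  apply/setP => v; rewrite !inE vsE.
  apply/in_U/orP => [[l' l'L vl']|[/in_U[l' l'L vl']|vl]].
  - by case: (ltngtP l l') => [ll'|ll'|<-] in vl' *; [left|lia|right];
      rewrite ?vsE//; apply/in_U; exists l' => //; lia.
  - by exists l' => //; lia.
  - by exists l => //; rewrite leqnn.
apply: (link_all_linked jL h) => //.
  by rewrite (perm_uniq vsB) enum_uniq.
move=> v; rewrite vsE => vl; split.
  by apply/negP => vj; have := B_dis lL' jL vl vj; lia.
apply/negP => /in_U[l' l'L vl'].
by have := B_dis lL' _ vl vl'; lia.
Qed.

Let linked_row j E i : (0 < j <= L)%N -> linkedP j (U j.+1) E ->
  \sum_(i' in B j) E i i' =
  (Defs.coef s j)%:R * link_weight s j * (i \in U j.+1)%:R.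
Proof.
move=> jL [_ _ _ colE _].
rewrite (sum_split _ _ (B_split jL)) ?iota_uniq// big_seq.
under eq_bigr => b ba do rewrite colE//.
rewrite -big_seq big_const_seq count_predT size_iota iter_addr addr0.
by rewrite -[LHS]mulr_natl mulrA.
Qed.

Let linked_gossip j E : (0 < j <= L)%N -> linkedP j (U j.+1) E -> gossip E.
Proof.
move=> jL lE; have [symE nnE supE _ rowE] := lE; split=> // i.
have [iB|iB] := boolP (i \in B j).
  exact: le_trans (rowE _ iB) (link_weight_le1 jL).
have -> : \sum_i' E i i' = \sum_(i' in B j) E i i'.
  rewrite [RHS]big_mkcond; apply: eq_bigr => i' _; case: ifP => // i'B.
  apply/eqP/negPn/negP => /supE; by rewrite i'B (negPf iB) andbF.
rewrite (linked_row i jL lE); apply: le_trans (coef_weight_le1 jL).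
by case: (i \in U j.+1); rewrite ?mulr1// mulr0n mulr0 mulr_ge0.
Qed.

Let linked_supported j E : (0 < j <= L)%N -> linkedP j (U j.+1) E ->
  supported (U j) E.
Proof.
move=> jL [_ _ supE _ _] i i' /supE.
have BUj := fintype.subsetP (BU jL).
have UUj v : v \in U j.+1 -> v \in U j.
  by move=> /in_U[l lL vl]; apply/in_U; exists l => //; lia.
by case/orP => /andP[]; [move=> /UUj -> /BUj ->|move=> /BUj -> /UUj ->].
Qed.

(** In this round the blocks after V_j are linked to V_j, the nodes of V_j left isolated are merged,
    and the earlier blocks already run their own graphs; K is the part living on [U j]. The last two
    clauses take V_j constant, as it is when the round is reached: the later nodes move towards c by
    a fixed fraction, and each V_{j,a} receives the same share of the excess of the later blocks
    over c. *)
Lemma link_round j : (0 < j < L)%N -> (m1 + j <= size S)%N ->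
  exists K, [/\ graph_at S (m1 + j) =
                 K + \sum_(l <- iota 1 j.-1) inner_graph l (m1 + j),
      gossip K, supported (U j) K,
      forall x c v, {in B j, forall i, x i = c} -> v \in U j.+1 ->
        estep K x v = x v + #|B j|%:R / #|U j|%:R * (c - x v)
    & forall x c a, {in B j, forall i, x i = c} -> (0 < a <= Defs.coef s j)%N ->
        \sum_(u in Defs.sub s j a) estep K x u =
        \sum_(u in Defs.sub s j a) c +
        link_weight s j * \sum_(v in U j.+1) (x v - c)].
Proof.
move=> jL jS; have [|X [XL Xs ->]] := @rounds (m1 + j)%N; first by lia.
have jL' : (0 < j <= L)%N by lia.
(* Descending induction over the blocks L, L-1, ..., j+1, with d the number of blocks already
   treated. *)
have lX d : (d <= L - j)%N -> linkedP j (U (L - d).+1) (X (L - d)%N).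
  elim: d => [_|d IH dL].
    rewrite subn0 XL (_ : U _ = finset.set0); last first.
      by apply/setP => v; rewrite finset.in_set0; apply/negP => /in_U[l]; lia.
    exact: linked0.
  have -> : (L - d.+1)%N = (L - d).-1 by lia.
  rewrite prednK; last by lia.
  apply: (@linked_step j (L - d)%N (X (L - d)%N)); [lia|lia| |].
    by apply: IH; lia.
  by apply: Xs; lia.
have {lX} lE : linkedP j (U j.+1) (X j) by have := lX _ (leqnn _); rewrite subKn//; lia.
have := Xs j jL'; rewrite /simple_step.
have -> : (m1 + j <= m1)%N = false by lia.
rewrite ltnn eqxx /= (_ : j != L); last by lia.
move=> /(merge_isolated_sum k_gt0)[M [XE gM sM]].
exists (X j + M); split.
- rewrite -XE; apply: telescope_blocks => l lj.
  by apply: simple_step_inner; [lia|lia|apply: Xs; lia].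
- apply: (@gossipD _ _ [set v | ~~ Defs.isolated (X j) v]%SET _ _ (linked_gossip jL' lE) gM).
    move=> i i' Xii'; rewrite !inE; apply/andP; split; apply/negP => /isolated_row h.
      by have [e _] := h i'; rewrite e eqxx in Xii'.
    by have [_ e] := h i; rewrite e eqxx in Xii'.
  move=> i; rewrite inE => iso; apply: (supported_row0 sM).
  by rewrite inE negb_and iso orbT.
- move=> i i'; have [Xe|/(linked_supported jL' lE)//] := eqVneq (X j i i') 0.
  rewrite addmxE Xe add0r => /sM; rewrite !inE => /andP[/andP[iB _] /andP[i'B _]].
  by rewrite !(fintype.subsetP (BU jL')).
- move=> x c v xc vU.
  have vB : v \notin B j.
    apply/negP => vj; have [l lL vl] := in_U _ _ vU.
    by have := @B_dis j l v jL' _ vj vl; lia.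
  rewrite estepDl; last first.
    by apply: (supported_row0 sM); rewrite inE negb_and vB.
  have [_ _ supE colE _] := lE.
  rewrite /estep; congr (_ + _).
  have -> : #|B j|%:R / #|U j|%:R = \sum_(i in B j) X j v i.
    by rewrite (linked_row v jL' lE) vU mulr1 link_weightE.
  rewrite mulr_suml [RHS]big_mkcond /=.
  apply: eq_bigr => i _; case: ifP => [iB|iB]; first by rewrite xc.
  rewrite (_ : X j v i = 0) ?mul0r//; apply/eqP/negPn/negP => /supE.
  by rewrite iB (negPf vB) andbF.
- move=> x c a xc aa; have [symE _ _ colE _] := lE.
  (* The merging edges in M join nodes of V_j only, where x is constant, so they move nothing. *)
  rewrite [LHS](eq_bigr (fun u => c + \sum_v X j u v * (x v - c))); last first.
    move=> u ua; have uB : u \in B j by exact: (fintype.subsetP (subB jL' aa)).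
    rewrite /estep xc//; congr (_ + _); apply: eq_bigr => v _.
    rewrite addmxE; have [->|/sM] := eqVneq (M u v) 0; first by rewrite addr0.
    by rewrite !inE => /andP[_ /andP[vB _]]; rewrite xc// subrr !mulr0.
  rewrite big_split /= exchange_big /=; congr (_ + _).
  rewrite mulr_sumr [RHS]big_mkcond; apply: eq_bigr => v _.
  rewrite -mulr_suml (eq_bigr _ (fun u _ => symE u v)) colE ?mem_iota1//.
  by case: ifP; rewrite ?mulr1// mulr0n mulr0 mul0r.
Qed.


Let UV j : (0 < j)%N -> U j \subset V.
Proof.
move=> j0; apply/fintype.subsetP => v /in_U[l lL]; apply: (fintype.subsetP (BV _)).
by lia.
Qed.

Let graph_at_gossip m : (0 < m <= size S)%N ->
  gossip (graph_at S m) /\ supported V (graph_at S m).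
Proof.
move=> mS; have [mm1|m1m] := leqP m m1.
  rewrite first_round; last by lia.
  have hE l : l \in iota 1 L -> gossip (cyclic_at (hblk s l) m) /\
      supported (B l) (cyclic_at (hblk s l) m).
    rewrite mem_iota1 => lL.
    exact: (hyper_edge (hblkP lL) (cyclic_at_mem (hblkP lL) _)).
  split.
    by apply: (gossip_sum (iota_uniq _ _) (proj2 V_split)) => l /hE[].
  apply: (@supported_sum _ _ _ B) => l lL; last by have [] := hE _ lL.
  by apply: BV; rewrite -mem_iota1.
have [j j0 mE] : exists2 j, (0 < j)%N & m = (m1 + j)%N.
  by exists (m - m1)%N; lia.
rewrite {}mE in mS *.
have jS : (m1 + j <= size S)%N by lia.
have [Lj|jL] := leqP L j; first by rewrite late_round//; exact: inner_sumP.
have jL' : (0 < j < L)%N by rewrite j0.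
have [K [-> gK sK _ _]] := link_round jL' jS.
have qL : (j.-1 <= L)%N by lia.
have [gD sD] := inner_sumP (m1 + j) qL; split.
  apply: (@gossipD _ _ (U j)) => // i iU.
  by apply: inner_sum_row0 iU; lia.
move=> i i'; rewrite addmxE.
have [->|/(supportedS (UV j0) sK)//] := eqVneq (K i i') 0.
by rewrite add0r => /sD.
Qed.

Lemma simple_edge E : E \in S -> gossip E /\ supported V E.
Proof.
move=> /(nthP 0)[i iS <-]; exact: (@graph_at_gossip i.+1).
Qed.

Let xs x m := run (take m S) x.

Let xsS x m : (m < size S)%N -> xs x m.+1 = estep (graph_at S m.+1) (xs x m).
Proof. exact: run_take_S. Qed.

Let inner_graph_step x m l i : (0 < l <= L)%N -> (m1 + l <= m < size S)%N ->
  i \in B l -> xs x m.+1 i = estep (inner_graph l m.+1) (xs x m) i.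
Proof.
move=> lL mS il; rewrite xsS; last by lia.
have -> : m.+1 = (m1 + (m.+1 - m1))%N by lia.
have jl : (l < m.+1 - m1)%N by lia.
have : (m1 + (m.+1 - m1) <= size S)%N by lia.
move: (m.+1 - m1)%N jl => j jl jS.
have [Lj|jL] := leqP L j.
  by rewrite late_round// (estep_inner_sum _ _ (leqnn L) lL il).
have jL' : (0 < j < L)%N by lia.
have [K [-> gK sK _ _]] := link_round jL' jS.
have qL : (j.-1 <= L)%N by lia.
have lq : (0 < l <= j.-1)%N by lia.
rewrite addrC estepDl; first by rewrite (estep_inner_sum _ _ qL lq il).
apply: (supported_row0 sK); apply/negP => /in_U[l' l'L il'].
have l'L' : (0 < l' <= L)%N by lia.
by have := B_dis lL l'L' il il'; lia.
Qed.

Let sum_preserved x m (W : {set 'I_n}) (E : 'M[R]_n) : gossip E -> supported W E ->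
  (m < size S)%N ->
  {in W, forall i, estep (graph_at S m.+1) (xs x m) i = estep E (xs x m) i} ->
  \sum_(i in W) xs x m.+1 i = \sum_(i in W) xs x m i.
Proof.
move=> [symE _ _] sE mS h; rewrite xsS// (eq_bigr _ h).
by apply: sum_estep => // i j iW /sE/andP[].
Qed.

Let sumV x m : (m <= size S)%N -> \sum_(i in V) xs x m i = \sum_(i in V) x i.
Proof.
elim: m => [_|m IH mS]; first by rewrite /xs take0.
rewrite -(IH (ltnW mS)); have [gE sE] := @graph_at_gossip m.+1 mS.
exact: (sum_preserved gE sE).
Qed.

Let blocks_const x l : (0 < l <= L)%N ->
  exists c, {in B l, forall i, xs x m1 i = c}.
Proof.
move=> lL; eexists; apply: (cyclic_run (hblkP lL) (hblk_le lL)).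
move=> t i tm il; rewrite xsS ?(leq_trans tm)// first_round; last by lia.
apply: (estep_sum_in _ _ _ (proj2 V_split)); rewrite ?iota_uniq ?mem_iota1//.
move=> b; rewrite mem_iota1 => bL.
by have [] := hyper_edge (hblkP bL) (cyclic_at_mem (hblkP bL) t.+1).
Qed.

Let UE : U 1 = V.
Proof. by case: V_split => -> _; rewrite /U subn1. Qed.

Let mean x : R := #|V|%:R^-1 * \sum_(i in V) x i.

(* Block j is linked to the later blocks with exactly the weight that brings
   the sum over each V_{j,a} to its global target; the mass left on the later
   blocks is then correct as well. *)
Let link_phase x j : (j < L)%N ->
  [/\ forall l, (j < l <= L)%N ->
        exists c, {in B l, forall i, xs x (m1 + j) i = c},
      forall l a, (0 < l <= j)%N -> (0 < a <= Defs.coef s l)%N ->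
        \sum_(i in Defs.sub s l a) xs x (m1 + j) i =
        #|Defs.sub s l a|%:R * mean x
    & \sum_(i in U j.+1) xs x (m1 + j) i = #|U j.+1|%:R * mean x].
Proof.
elim: j => [_|j IH jL].
  rewrite addn0; split; [exact: blocks_const| |]; first by move=> l; lia.
  by rewrite UE sumV// /mean mulVKf// pnatr_eq0 -lt0n.
have [I1 I2 I3] := IH (ltnW jL).
have jS : (m1 + j < size S)%N by rewrite sizeS; lia.
have jL' : (0 < j.+1 < L)%N by lia.
have jL2 : (0 < j.+1 <= L)%N by lia.
have jS' : (m1 + j.+1 <= size S)%N by lia.
have [K [GE gK sK S1 S2]] := link_round jL' jS'.
have GU i y : i \in U j.+1 ->
    estep (graph_at S (m1 + j).+1) y i = estep K y i.
  move=> iU; rewrite -addnS GE estepDl//.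
  by apply: inner_sum_row0 iU; lia.
have jjL : (j < j.+1 <= L)%N by lia.
have [c cB] := I1 _ jjL.
have UU v : v \in U j.+2 -> v \in U j.+1.
  by move=> /in_U[l lL vl]; apply/in_U; exists l => //; lia.
have BUj := fintype.subsetP (BU jL2).
have a_gt0 := coef_le jL2.
have cU : #|U j.+1|%:R = #|B j.+1|%:R + #|U j.+2|%:R :> R.
  by rewrite -!sumr_card sumU.
have newB a : (0 < a <= Defs.coef s j.+1)%N ->
    \sum_(i in Defs.sub s j.+1 a) xs x (m1 + j.+1) i =
    #|Defs.sub s j.+1 a|%:R * mean x.
  move=> aa; have sBa := fintype.subsetP (subB jL2 aa).
  rewrite addnS xsS// (eq_bigr (fun i => estep K (xs x (m1 + j)) i)); last first.
    by move=> i ia; apply: GU; apply/BUj/sBa.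
  rewrite (S2 _ c)// sumrB !sumr_const -[c *+ _]mulr_natl -[c *+ _]mulr_natl.
  move: I3; rewrite sumU// (eq_bigr (fun=> c)) => [|i iB]; last by rewrite cB.
  rewrite sumr_const -[c *+ _]mulr_natl => I3.
  have [cardS _] := hsubP jL2 aa.
  have U0 : (#|U j.+1|%:R != 0 :> R) by rewrite pnatr_eq0 -lt0n cardU_gt0.
  have a0 : ((Defs.coef s j.+1)%:R != 0 :> R).
    by rewrite pnatr_eq0 -lt0n; case/andP: a_gt0.
  have wE : link_weight s j.+1 = #|Defs.sub s j.+1 a|%:R / #|U j.+1|%:R :> R.
    apply: (mulfI a0); rewrite link_weightE// mulrA -natrM cardS -cardB//.
  (* The excess of the later blocks over c is |U| (mean - c). Since the link weight is |V_{j,a}| /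
     |U|, the transfer moves the sum over V_{j,a} from |V_{j,a}| c to exactly |V_{j,a}| mean. *)
  have -> : \sum_(i in U j.+2) xs x (m1 + j) i - #|U j.+2|%:R * c =
      #|U j.+1|%:R * (mean x - c).
    by rewrite mulrBr -I3 cU; ring.
  by rewrite wE mulrA divfK//; ring.
split.
- move=> l lL; have lL' : (j < l <= L)%N by lia.
  have [c' c'B] := I1 l lL'; eexists => i il.
  have iU : i \in U j.+2 by apply/in_U; exists l.
  rewrite addnS xsS// GU; last exact: UU.
  by rewrite (S1 _ c)// c'B.
- move=> l a lj aa; case: (ltngtP l j.+1) => [lj'||le]; [|lia|].
    have lL : (0 < l <= L)%N by lia.
    rewrite -(I2 l a)//; last by lia.
    have [_ h] := hsubP lL aa.
    have [gE sE] := hyper_edge h (cyclic_at_mem h (counter s l (m1 + j).+1)).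
    rewrite addnS; apply: (sum_preserved gE sE) => // i ia.
    have il := fintype.subsetP (subB lL aa) i ia.
    rewrite -xsS// (@inner_graph_step _ _ l)//; last by lia.
    apply: estep_inner => //; rewrite -lt0n; apply: p_gt0; lia.
  by rewrite le in aa *; exact: newB.
- have : \sum_(i in U j.+1) xs x (m1 + j.+1) i = #|U j.+1|%:R * mean x.
    rewrite -I3 addnS; apply: (sum_preserved gK sK) => // i iU; exact: GU.
  rewrite sumU// (sum_split _ _ (B_split jL2)) ?iota_uniq// big_seq.
  rewrite (eq_bigr (fun a => #|Defs.sub s j.+1 a|%:R * mean x)); last first.
    by move=> a; rewrite mem_iota1; exact: newB.
  rewrite -big_seq -mulr_suml.
  have <- : #|B j.+1|%:R = \sum_(a <- iota 1 (Defs.coef s j.+1)) #|Defs.sub s j.+1 a|%:R :> R.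
    rewrite -sumr_card (sum_split _ _ (B_split jL2)) ?iota_uniq//.
    by apply: eq_bigr => a _; rewrite sumr_card.
  by rewrite cU mulrDl => /addrI.
Qed.

(** For l < L, every V_{l,a} has the right sum after round m_1 + l, and the p_l rounds of its own
    hypercube still fit because p_l + l <= p_1 + 1. The last block is constant after round m_1 + L -
    1, and the mass left on it forces the constant to be the global mean. *)
Lemma simple_averages : averages V S.
Proof.
move=> x i iV; rewrite -[LHS]/(run S x i) -(take_size S) -/(xs x (size S)).
have [l lL il] := inV iV; rewrite -/(mean x).
case: (ltngtP l L) => [lL'||le]; [|lia|].
  have lL2 : (0 < l < L)%N by lia.
  have [a aa ia] : exists2 a, (0 < a <= Defs.coef s l)%N & i \in Defs.sub s l a.
    case: (B_split lL) il => -> _; rewrite in_bigcup_seq => /hasP[a].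
    by rewrite mem_iota1 => ? ?; exists a.
  have [_ h] := hsubP lL aa.
  have pl := p_le lL.
  have T : (size (hsub s l a) <= size S - (m1 + l))%N.
    by rewrite hsub_size// sizeS; lia.
  have lS : (m1 + l <= size S)%N by rewrite sizeS; lia.
  have := @cyclic_run _ _ _ _ _ h (fun b => xs x (m1 + l + b)) _ T.
  rewrite subnKC// addn0 => -> //; last first.
    move=> t i' tT i'a; have i'l := fintype.subsetP (subB lL aa) _ i'a.
    rewrite addnS (@inner_graph_step _ _ l)//; last by lia.
    rewrite (estep_inner _ _ lL _ aa i'a); last by rewrite -lt0n p_gt0.
    by rewrite counterE//; congr (estep (cyclic_at _ _) _ _); lia.
  have [_ I2 _] := @link_phase x l lL'.
  have sub0 : (0 < #|Defs.sub s l a|)%N by apply/card_gt0P; exists i.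
  by rewrite I2 ?mulKf// ?pnatr_eq0 -?lt0n//; lia.
rewrite {}le in il *.
have LL : (0 < L <= L)%N by lia.
have [] := @link_phase x L.-1; first by lia.
move=> /(_ L) [|c cB _]; first by lia.
rewrite prednK// sumU// [X in _ + X]big1; last by move=> j /in_U[l']; lia.
have UL : U L = B L.
  apply/setP => v; apply/in_U/idP => [[l' l'L]|vL]; last by exists L => //; lia.
  by have -> : l' = L by lia.
rewrite addr0 UL (eq_bigr (fun=> c)) => [|j jB]; last by rewrite cB.
rewrite sumr_const -[c *+ _]mulr_natl => /mulfI cE.
have {}cE : c = mean x by apply: cE; rewrite pnatr_eq0 -lt0n cardB_gt0.
suff h d : (m1 + L.-1 + d <= size S)%N ->
    {in B L, forall i, xs x (m1 + L.-1 + d) i = c}.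
  have := h (size S - (m1 + L.-1))%N; rewrite subnKC; last by rewrite sizeS; lia.
  by move=> -> //; rewrite leqnn.
elim: d => [_|d IH dS] j jB; first by rewrite addn0 cB.
rewrite addnS xsS; last by lia.
have -> : (m1 + L.-1 + d).+1 = (m1 + (L + d))%N by lia.
rewrite late_round; [|lia|lia]; rewrite (estep_inner_sum _ _ (leqnn L) LL jB).
have [_ sD] := inner_graphP (m1 + (L + d)) LL.
by apply: (estep_cst sD) => //; apply: IH; lia.
Qed.

End simple.

(** * The Base-(k+1) graph *)

Lemma simple_base_graphP (R : realType) n k (V : {set 'I_n}) (S : seq 'M[R]_n) :
  (0 < k)%N -> (0 < #|V|)%N -> simple_base_graph k V S ->
  [/\ averages V S, {in S, forall E, gossip E /\ supported V E}, (0 < size S)%N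
    & (1 < #|V|)%N ->
      exists q, (size S <= 2 * q + 2)%N /\ (k.+1 ^ q <= #|V|)%N].
Proof.
move=> k0 V0 [[_ h]|[ns [s [vs lt_s end_s rd_s]]]].
  split; [exact: hyper_averages h|by move=> E; exact: hyper_edge h _|
    exact: hyper_size_gt0 h|].
  move=> V1; exists (size S)./2; split; last exact: (hyper_card_half h).
  by have := odd_double_half (size S); case: (odd _) => /=; lia.
split.
- exact: (simple_averages k0 V0 ns vs lt_s end_s rd_s).
- by move=> E; exact: (simple_edge k0 V0 ns vs lt_s end_s rd_s).
- exact: (simple_size_gt0 k0 V0 ns vs lt_s end_s).
- by move=> _; exact: (simple_size k0 V0 ns vs lt_s end_s).
Qed.

Lemma run_parallel (R : realType) n (J : seq nat) (B : nat -> {set 'I_n})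
    (A : nat -> seq 'M[R]_n) T l x i : uniq J -> l \in J ->
  {in J &, forall l l', l != l' -> (B l :&: B l')%SET = finset.set0} ->
  {in J, forall l, size (A l) = T} ->
  {in J, forall l, {in A l, forall E, supported (B l) E}} -> i \in B l ->
  run [seq \sum_(l <- J) graph_at (A l) m | m <- iota 1 T] x i = run (A l) x i.
Proof.
move=> uJ lJ dB sA supA iB; rewrite -[in RHS](take_size (A l)) (sA _ lJ).
suff h t : (t <= T)%N -> {in B l, run [seq \sum_(l <- J) graph_at (A l) m | m <- iota 1 t] x
    =1 run (take t (A l)) x} by exact: h.
elim: t => [_ j _|t IH tT j jB]; first by rewrite take0.
rewrite -(addn1 t) iotaD map_cat run_cat /= addn1 run_take_S ?sA//.
have supt l' : l' \in J -> supported (B l') (graph_at (A l') t.+1).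
  by move=> l'J; apply: supA => //; rewrite mem_nth// sA.
rewrite (estep_sum_in _ uJ lJ dB supt jB).
apply: (eq_estep_supported (supt _ lJ)) => //; exact: IH (ltnW tT).
Qed.

Lemma parallel_gossip (R : realType) n (J : seq nat) (B : nat -> {set 'I_n})
    (A : nat -> seq 'M[R]_n) T : uniq J ->
  {in J &, forall l l', l != l' -> (B l :&: B l')%SET = finset.set0} ->
  {in J, forall l, size (A l) = T} ->
  {in J, forall l, {in A l, forall E, gossip E /\ supported (B l) E}} ->
  {in [seq \sum_(l <- J) graph_at (A l) m | m <- iota 1 T],
    forall E, gossip E}.
Proof.
move=> uJ dB sA hA E /mapP[m]; rewrite mem_iota => mT ->.
have h l : l \in J -> gossip (graph_at (A l) m) /\ supported (B l) (graph_at (A l) m).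
  by move=> lJ; apply: hA => //; rewrite mem_nth// sA//; lia.
by apply: (@gossip_sum _ _ _ B) => // l /h[].
Qed.

(** After the first half each V_l holds its own mean. Each U_l meets every V_l' in one node, so
    averaging over U_l averages the p block means, and blocks of equal size make this the global
    mean. *)
Lemma product_graphP (R : realType) n k (S : seq 'M[R]_n) :
  (0 < k)%N -> (0 < n)%N -> product_graph k S ->
  [/\ averages [set: 'I_n]%SET S, {in S, forall E, gossip E} & (0 < size S)%N].
Proof.
move=> k0 n0 [p [q [Vb [Ub [A [H [ns [[npq _ _] [Vsp hA] [Usp hH] ->]]]]]]]].
have p0 : (0 < p)%N by move: n0; rewrite npq muln_gt0 => /andP[].
have q0 : (0 < q)%N by move: n0; rewrite npq muln_gt0 => /andP[].
have gA l : l \in iota 1 p -> [/\ averages (Vb l) (A l),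
    {in A l, forall E, gossip E /\ supported (Vb l) E} & (0 < size (A l))%N].
  rewrite mem_iota1 => lp; have [c sb _] := hA _ lp.
  by have [] := simple_base_graphP k0 _ sb; rewrite ?c.
have sA : {in iota 1 p, forall l, size (A l) = size (A 1%N)}.
  by move=> l; rewrite mem_iota1 => /hA[].
have sH l : l \in iota 1 q -> size (H l) = size (H 1%N).
  rewrite mem_iota1 => /hH[_ hw _]; have [_ hw1 _] := hH 1%N q0.
  by rewrite (hyper_with_size hw) (hyper_with_size hw1).
have gH l : l \in iota 1 q -> {in H l, forall E, gossip E /\ supported (Ub l) E}.
  by rewrite mem_iota1 => /hH[_ hw _]; exact: (hyper_with_edges hw).
have -> : forall f, [seq \sum_(1 <= l < p.+1) f l m | m <- iota 1 (size (A 1%N))]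
    = [seq \sum_(l <- iota 1 p) f l m | m <- iota 1 (size (A 1%N))] :> seq 'M[R]_n.
  by move=> f; rewrite /index_iota subn1.
have -> : forall f, [seq \sum_(1 <= l < q.+1) f l m | m <- iota 1 (size (H 1%N))]
    = [seq \sum_(l <- iota 1 q) f l m | m <- iota 1 (size (H 1%N))] :> seq 'M[R]_n.
  by move=> f; rewrite /index_iota subn1.
split; last first.
- rewrite size_cat size_map size_iota.
  have [|_ _] := gA 1%N; first by rewrite mem_iota1 p0.
  by case: (size (A _)).
- move=> E; rewrite mem_cat => /orP[].
    by apply: (parallel_gossip (iota_uniq _ _) (proj2 Vsp) sA) => l /gA[].
  by apply: (parallel_gossip (iota_uniq _ _) (proj2 Usp) sH) => l /gH.
move=> x i _; rewrite run_cat.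
set y := run _ x.
have yE l j : l \in iota 1 p -> j \in Vb l ->
    y j = q%:R^-1 * \sum_(v in Vb l) x v.
  move=> lp jV; have [av ge _] := gA _ lp.
  have [c _ _] := hA l (etrans (esym (mem_iota1 _ _)) lp).
  rewrite /y (run_parallel _ (iota_uniq _ _) lp (proj2 Vsp) sA _ jV).
    by rewrite av// c.
  by move=> l' /gA[_ h _] E /h[].
have [l lq il] : exists2 l, l \in iota 1 q & i \in Ub l.
  by apply/hasP; rewrite -in_bigcup_seq -(proj1 Usp) finset.in_setT.
have [c hw cap] := hH l (etrans (esym (mem_iota1 _ _)) lq).
rewrite (run_parallel _ (iota_uniq _ _) lq (proj2 Usp) sH _ il); last first.
  by move=> l' /gH h E /h[].
rewrite (hyper_with_averages hw)// c.
have Usplit : split_into (Ub l) (iota 1 p) (fun l' => Ub l :&: Vb l')%SET.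
  split.
    apply/setP => v; rewrite in_bigcup_seq.
    have : v \in [set: 'I_n]%SET by rewrite finset.in_setT.
    rewrite {1}(proj1 Vsp) in_bigcup_seq => /hasP[l' l'p vl'].
    apply/idP/hasP => [vU|[l2 _]]; last by rewrite inE => /andP[].
    by exists l' => //; rewrite inE vU.
  move=> a b ap bp ab; apply/setP => v; rewrite !inE.
  have := (proj2 Vsp) _ _ ap bp ab => /setP/(_ v); rewrite !inE.
  by case: (v \in Vb a); case: (v \in Vb b); rewrite ?andbF.
rewrite (sum_split _ _ Usplit) ?iota_uniq//.
rewrite (eq_big_seq (fun l' => q%:R^-1 * \sum_(v in Vb l') x v)); last first.
  move=> l' l'p; rewrite (eq_bigr (fun=> q%:R^-1 * \sum_(v in Vb l') x v)).
    by rewrite sumr_const cap// -mem_iota1.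
  by move=> u; rewrite inE => /andP[_]; exact: yE.
rewrite -mulr_sumr -(sum_split _ _ Vsp) ?iota_uniq// mulrA -invfM -natrM.
by rewrite cardsT card_ord -npq; congr (_ * _); apply: eq_bigl => j; rewrite finset.in_setT.
Qed.

(** The returned sequence is never longer than the simple graph on all nodes, whichever candidate is
    chosen, so [simple_size] and its hypercube counterpart bound the length. *)
Lemma base_graphP (R : realType) n k (S : seq 'M[R]_n) :
  (1 <= k <= n - 1)%N -> base_graph k S ->
  [/\ forall (x : 'I_n -> R) i, run S x i = n%:R^-1 * \sum_j x j,
      {in S, forall E, gossip E}, (0 < size S)%N
    & exists q, (size S <= 2 * q + 2)%N /\ (k.+1 ^ q <= n)%N].
Proof.
move=> /andP[k0 kn] [A [E [sA pE ->]]].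
have n1 : (1 < n)%N by lia.
have cT : #|[set: 'I_n]%SET| = n by rewrite cardsT card_ord.
have T0 : (0 < #|[set: 'I_n]%SET|)%N by rewrite cT; lia.
have [avA gA A0 [|q [qA qn]]] := simple_base_graphP k0 T0 sA; first by rewrite cT.
have [avE gE E0] := product_graphP k0 (ltnW n1) pE.
have avT S' x i : averages [set: 'I_n]%SET S' ->
    run S' x i = n%:R^-1 * \sum_j x j :> R.
  move=> ->; rewrite ?finset.in_setT// cT; congr (_ * _).
  by apply: eq_bigl => j; rewrite finset.in_setT.
rewrite cT in qn; case: ltnP => AE; split=> //.
- by move=> x i; exact: avT.
- by move=> e /gA[].
- by exists q.
- by move=> x i; exact: avT.
- by exists q; split=> //; exact: leq_trans AE qA.
Qed.

(** * Deviation from the mean *)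

Section jensen.
Variable R : realType.

Lemma jensen_sqr (I : finType) (w x : I -> R) :
  (forall i, 0 <= w i) -> \sum_i w i = 1 ->
  (\sum_i w i * x i) ^+ 2 <= \sum_i w i * x i ^+ 2.
Proof.
move=> w0 w1; set mu := \sum_i w i * x i.
have : 0 <= \sum_i w i * (x i - mu) ^+ 2.
  by apply: sumr_ge0 => i _; rewrite mulr_ge0// sqr_ge0.
rewrite (eq_bigr (fun i => w i * x i ^+ 2 - 2 * mu * (w i * x i) + mu ^+ 2 * w i)).
  by rewrite big_split sumrB/= -!mulr_sumr w1 -/mu; lra.
by move=> i _; ring.
Qed.

Lemma sum_sqr_le t (x : 'I_t -> R) :
  (\sum_i x i) ^+ 2 <= t%:R * \sum_i x i ^+ 2.
Proof.
case: t x => [|t] x; first by rewrite !big_ord0 expr0n mul0r.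
have t0 : t.+1%:R != 0 :> R by rewrite pnatr_eq0.
have w0 (i : 'I_t.+1) : 0 <= t.+1%:R^-1 :> R by rewrite invr_ge0.
have := jensen_sqr x w0.
rewrite sumr_const card_ord -(mulr_natl (_^-1)) divff// -!mulr_sumr.
move=> /(_ erefl); rewrite exprMn -ler_pdivlMl ?exprn_gt0 ?invr_gt0//.
by rewrite exprVn invrK mulrA expr2 mulfK.
Qed.

End jensen.

(** * Doubly stochastic matrices and products of rounds *)

Section matrices.
Variables (R : realType) (n : nat).
Hypothesis n_gt0 : (0 < n)%N.

Definition dstoch (W : 'M[R]_n) : Prop :=
  [/\ forall i j, 0 <= W i j, forall i, \sum_j W i j = 1
    & forall j, \sum_i W i j = 1].

Definition fro2 d (X : 'M[R]_(n, d)) : R := \sum_i \sum_a X i a ^+ 2.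

Definition Jmx : 'M[R]_n := const_mx n%:R^-1.

Let nR : n%:R != 0 :> R. Proof. by rewrite pnatr_eq0 -lt0n. Qed.

Lemma fro2_ge0 d (X : 'M[R]_(n, d)) : 0 <= fro2 X.
Proof. by apply: sumr_ge0 => i _; apply: sumr_ge0 => a _; exact: sqr_ge0. Qed.

Lemma fro2D d (X Y : 'M[R]_(n, d)) : fro2 (X + Y) <= 2 * fro2 X + 2 * fro2 Y.
Proof.
rewrite /fro2 !mulr_sumr -big_split; apply: ler_sum => i _ /=.
rewrite !mulr_sumr -big_split; apply: ler_sum => a _ /=.
rewrite mxE; have := sqr_ge0 (X i a - Y i a); rewrite !expr2; lra.
Qed.

Lemma fro2Z d c (X : 'M[R]_(n, d)) : fro2 (c *: X) = c ^+ 2 * fro2 X.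
Proof.
rewrite /fro2 mulr_sumr; apply: eq_bigr => i _.
by rewrite mulr_sumr; apply: eq_bigr => a _; rewrite mxE exprMn.
Qed.

Lemma fro2_sum d t (X : 'I_t -> 'M[R]_(n, d)) :
  fro2 (\sum_u X u) <= t%:R * \sum_u fro2 (X u).
Proof.
rewrite /fro2 [X in _ <= _ * X]exchange_big mulr_sumr; apply: ler_sum => i _ /=.
rewrite [X in _ <= _ * X]exchange_big mulr_sumr; apply: ler_sum => a _ /=.
by rewrite summxE sum_sqr_le.
Qed.

(** Row sums equal to 1 allow Jensen in each row; column sums equal to 1 then bring the total back
    to the norm of X. *)
Lemma fro2_dstoch d W (X : 'M[R]_(n, d)) : dstoch W -> fro2 (W *m X) <= fro2 X.
Proof.
move=> [W0 W1 W2]; rewrite /fro2 exchange_big [leRHS]exchange_big.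
apply: ler_sum => a _ /=.
apply: (@le_trans _ _ (\sum_i \sum_j W i j * X j a ^+ 2)).
  by apply: ler_sum => i _; rewrite mxE jensen_sqr.
rewrite exchange_big; apply: ler_sum => j _ /=.
by rewrite -mulr_suml W2 mul1r.
Qed.

Lemma dstoch1 : dstoch 1%:M.
Proof.
split=> [i j|i|j]; first by rewrite mxE.
  rewrite (bigD1 i)//= mxE eqxx big1 ?addr0// => l li.
  by rewrite mxE eq_sym (negPf li).
by rewrite (bigD1 j)//= mxE eqxx big1 ?addr0// => l lj; rewrite mxE (negPf lj).
Qed.

Lemma dstochM W W' : dstoch W -> dstoch W' -> dstoch (W *m W').
Proof.
move=> [W0 W1 W2] [W'0 W'1 W'2]; split=> [i j|i|j].
- by rewrite mxE sumr_ge0// => l _; rewrite mulr_ge0.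
- under eq_bigr do rewrite mxE; rewrite exchange_big /=.
  by under eq_bigr do rewrite -mulr_sumr W'1 mulr1.
- under eq_bigr do rewrite mxE; rewrite exchange_big /=.
  by under eq_bigr do rewrite -mulr_suml W2 mul1r.
Qed.

Lemma dstoch_mulJ W : dstoch W -> W *m Jmx = Jmx.
Proof.
move=> [_ W1 _]; apply/matrixP => i j; rewrite !mxE.
by under eq_bigr do rewrite mxE; rewrite -mulr_suml W1 mul1r.
Qed.

Lemma Jmul_dstoch W : dstoch W -> Jmx *m W = Jmx.
Proof.
move=> [_ _ W2]; apply/matrixP => i j; rewrite !mxE.
by under eq_bigr do rewrite mxE; rewrite -mulr_sumr W2 mulr1.
Qed.

Lemma mulJmx d (X : 'M[R]_(n, d)) i a :
  (Jmx *m X) i a = n%:R^-1 * \sum_j X j a.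
Proof. by rewrite mxE mulr_sumr; apply: eq_bigr => j _; rewrite mxE. Qed.

Lemma dstoch_const d W (C : 'M[R]_(n, d)) : dstoch W ->
  (forall i j a, C i a = C j a) -> W *m C = C.
Proof.
move=> [_ W1 _] hC; apply/matrixP => i a; rewrite mxE.
by under eq_bigr => j _ do rewrite (hC j i); rewrite -mulr_suml W1 mul1r.
Qed.

Lemma dstochJ : dstoch Jmx.
Proof.
have e : \sum_(i < n) (n%:R^-1 : R) = 1.
  by rewrite sumr_const card_ord -(mulr_natl (_^-1)) divff.
by split=> [i j|i|j]; rewrite ?mxE ?invr_ge0//; under eq_bigr do rewrite mxE.
Qed.

(** In each column, subtracting the mean is an orthogonal projection. *)
Lemma fro2_dev d (X : 'M[R]_(n, d)) : fro2 (X - Jmx *m X) <= fro2 X.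
Proof.
rewrite /fro2 exchange_big [leRHS]exchange_big; apply: ler_sum => a _ /=.
under eq_bigr do rewrite 2!mxE mulJmx.
set mu := n%:R^-1 * _.
rewrite (eq_bigr (fun i => X i a ^+ 2 - 2 * mu * X i a + mu ^+ 2)); last first.
  by move=> i _; ring.
rewrite big_split sumrB/= -mulr_sumr sumr_const card_ord -[mu ^+ 2 *+ _]mulr_natl.
have -> : \sum_i X i a = n%:R * mu by rewrite /mu mulVKf.
have : 0 <= n%:R * mu ^+ 2 :> R by rewrite mulr_ge0// sqr_ge0.
by rewrite !expr2; lra.
Qed.

Lemma mixing_mul d E (X : 'M[R]_(n, d)) i a :
  (mixing E *m X) i a = estep E (fun j => X j a) i.
Proof.
rewrite mxE /estep (bigD1 i)//= [in RHS](bigD1 i)//= subrr mulr0 add0r.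
rewrite mxE eqxx mulrBl mul1r -addrA; congr (_ + _).
rewrite addrC mulr_suml -sumrB; apply: eq_bigr => j ji.
by rewrite mxE eq_sym (negPf ji) mulrBr.
Qed.

Lemma mixing_dstoch E : gossip E -> dstoch (mixing E).
Proof.
move=> [symE E0 E1].
have row i : \sum_j mixing E i j = 1.
  rewrite (bigD1 i)//= mxE eqxx.
  rewrite [X in _ + X](eq_bigr (fun j => E i j)) ?subrK// => j ji.
  by rewrite mxE eq_sym (negPf ji).
split=> // [i j|j].
  rewrite mxE; case: eqP => // _; rewrite subr_ge0; apply: le_trans (E1 i).
  by rewrite [leRHS](bigD1 i)//= lerDr.
rewrite -(row j); apply: eq_bigr => i _; rewrite !mxE (eq_sym j i) symE.
by case: eqP => // ->.
Qed.

Section rounds.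
Variable S : seq 'M[R]_n.
Hypothesis S_gossip : {in S, forall E, gossip E}.
Hypothesis S_size : (0 < size S)%N.
Hypothesis S_avg : forall (x : 'I_n -> R) i, run S x i = n%:R^-1 * \sum_j x j.

Notation m := (size S).

Definition mix r : 'M[R]_n := mixing (nth 0 S (r %% size S)).

Fixpoint phi s t : 'M[R]_n :=
  if t is t'.+1 then mix (s + t') *m phi s t' else 1%:M.

Lemma mix_dstoch r : dstoch (mix r).
Proof. by apply/mixing_dstoch/S_gossip/mem_nth; rewrite ltn_pmod. Qed.

Lemma phi_dstoch s t : dstoch (phi s t).
Proof.
elim: t => [|t IH]; first exact: dstoch1.
by apply: dstochM => //; exact: mix_dstoch.
Qed.

Lemma phi_cat s t u : phi s (t + u) = phi (s + t) u *m phi s t.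
Proof.
elim: u => [|u IH]; first by rewrite addn0 mul1mx.
by rewrite addnS /= IH mulmxA addnA.
Qed.

Lemma phi_cycle q : phi (q * m) m = Jmx.
Proof.
have h t (X : 'M[R]_n) i a : (t <= m)%N ->
    (phi (q * m) t *m X) i a = run (take t S) (fun j => X j a) i.
  elim: t i => [|t IH] i tm; first by rewrite mul1mx take0.
  rewrite /= -mulmxA /mix modnMDl modn_small// mixing_mul run_take_S//.
  by apply: eq_estep => j _; rewrite IH// ltnW.
rewrite -[LHS]mulmx1; apply/matrixP => i a.
by rewrite h// take_size S_avg -[Jmx]mulmx1 mulJmx.
Qed.

(** The first multiple q m of m above s is at most s + m, so the cycle starting there ends by s + 2
    m. Its product is [Jmx], which absorbs the doubly stochastic factors on both sides. *)
Lemma phi_full s t : (2 * m <= t)%N -> phi s t = Jmx.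
Proof.
move=> mt; pose q := (s %/ m).+1.
have e := divn_eq s m; have l := ltn_pmod s S_size.
have qE : (q * m = s %/ m * m + m)%N by rewrite /q mulSn addnC.
have -> : t = ((q * m - s) + m + (t - (q * m - s) - m))%N by lia.
rewrite phi_cat phi_cat (_ : (s + (q * m - s) = q * m)%N); last by lia.
rewrite phi_cycle (Jmul_dstoch (phi_dstoch _ _)).
exact/dstoch_mulJ/phi_dstoch.
Qed.

Variable d : nat.
Variables (X G : nat -> 'M[R]_(n, d)) (eta : R).
Hypothesis X0 : forall i j a, X 0%N i a = X 0%N j a.
Hypothesis XS : forall r, X r.+1 = mix r *m (X r - eta *: G r).

Lemma unroll s t : X (s + t)%N =
  phi s t *m X s - eta *: \sum_(u < t) phi (s + u) (t - u) *m G (s + u)%N.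
Proof.
elim: t => [|t IH]; first by rewrite addn0 big_ord0 scaler0 subr0 mul1mx.
rewrite addnS XS IH big_ord_recr /= subSn// subnn /= addn0 mulmx1.
rewrite !mulmxBr mulmxA -addrA; congr (_ + _).
rewrite -opprD scalerDr -!scalemxAr; congr (- (_ *: _ + _)).
rewrite mulmx_sumr; apply: eq_bigr => u _.
rewrite subSn /=; last by rewrite ltnW.
by rewrite -addnA subnKC ?mulmxA// ltnW.
Qed.

Definition Qmx s t : 'M[R]_n := phi s t - Jmx.

(** The state at the start r0 of the window drops out in either case: for r <= 2 m the window starts
    at round 0, where all nodes agree; otherwise the window is long enough for [phi_full]. *)
Lemma deviation r (t := minn r (2 * m)) (r0 := (r - t)%N) :
  X r - Jmx *m X r =
  - eta *: \sum_(u < t) Qmx (r0 + u) (t - u) *m G (r0 + u)%N.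
Proof.
have -> : X r = X (r0 + t)%N by rewrite subnK// geq_minl.
rewrite unroll mulmxBr mulmxA (Jmul_dstoch (phi_dstoch _ _)).
have -> : phi r0 t *m X r0 = Jmx *m X r0.
  have [rm|mr] := leqP r (2 * m).
    have -> : r0 = 0%N by rewrite /r0 /t (minn_idPl rm) subnn.
    by rewrite !dstoch_const//; [exact: dstochJ|exact: phi_dstoch].
  by rewrite phi_full// /t (minn_idPr (ltnW mr)).
rewrite opprB addrC addrA subrK -scalemxAr -scalerBr scaleNr -scalerN.
rewrite mulmx_sumr; congr (_ *: _); rewrite -opprB -sumrB; congr (- _).
apply: eq_bigr => u _.
by rewrite mulmxBl mulmxA (Jmul_dstoch (phi_dstoch _ _)).
Qed.

End rounds.
End matrices.

(** * Smooth functions *)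

Section euclid.
Variables (R : realType) (d : nat).
Implicit Types u v x y : 'rV[R]_d.

Definition dot u v : R := \sum_j u 0 j * v 0 j.

Definition sqn v : R := \sum_j v 0 j ^+ 2.

Lemma enorm_sqr v : enorm v ^+ 2 = sqn v.
Proof. by rewrite sqr_sqrtr// sumr_ge0// => j _; exact: sqr_ge0. Qed.

Lemma sqn_ge0 v : 0 <= sqn v.
Proof. by apply: sumr_ge0 => j _; exact: sqr_ge0. Qed.

Lemma sqnZ c v : sqn (c *: v) = c ^+ 2 * sqn v.
Proof. by rewrite /sqn mulr_sumr; apply: eq_bigr => j _; rewrite mxE exprMn. Qed.

Lemma sqnN v : sqn (- v) = sqn v.
Proof. by rewrite -scaleN1r sqnZ sqrrN expr1n mul1r. Qed.

Lemma dotvv v : dot v v = sqn v.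
Proof. by apply: eq_bigr => j _; rewrite expr2. Qed.

Lemma dotDl u v x : dot (u + v) x = dot u x + dot v x.
Proof. by rewrite /dot -big_split; apply: eq_bigr => j _; rewrite mxE mulrDl. Qed.

Lemma dotNl u x : dot (- u) x = - dot u x.
Proof. by rewrite /dot -sumrN; apply: eq_bigr => j _; rewrite mxE mulNr. Qed.

Lemma dotZr c u x : dot u (c *: x) = c * dot u x.
Proof. by rewrite /dot mulr_sumr; apply: eq_bigr => j _; rewrite mxE mulrCA. Qed.

Lemma dotDr u v x : dot x (u + v) = dot x u + dot x v.
Proof. by rewrite /dot -big_split; apply: eq_bigr => j _; rewrite mxE mulrDr. Qed.

Lemma sqnB u v : sqn (u - v) = sqn u - 2 * dot u v + sqn v.
Proof.
rewrite /sqn /dot mulr_sumr -sumrB -big_split; apply: eq_bigr => j _ /=.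
by rewrite !mxE; ring.
Qed.

Lemma sqnD_le u v : sqn (u + v) <= 2 * sqn u + 2 * sqn v.
Proof.
rewrite /sqn !mulr_sumr -big_split; apply: ler_sum => j _ /=.
by rewrite mxE; have := sqr_ge0 (u 0 j - v 0 j); rewrite !expr2; lra.
Qed.

Lemma dot_le s u v : 0 < s -> dot u v <= (sqn u / s + s * sqn v) / 2.
Proof.
move=> s0; have := sqn_ge0 (u - s *: v); rewrite sqnB sqnZ dotZr => h.
rewrite -(ler_pM2l s0); have -> : s * ((sqn u / s + s * sqn v) / 2) =
  (sqn u + s ^+ 2 * sqn v) / 2 by field; rewrite gt_eqF.
by lra.
Qed.

Lemma sqn_avg_le n (w : 'I_n -> R) (x : 'I_n -> 'rV[R]_d) :
  (forall i, 0 <= w i) -> \sum_i w i = 1 ->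
  sqn (\sum_i w i *: x i) <= \sum_i w i * sqn (x i).
Proof.
move=> w0 w1; under [leRHS]eq_bigr do rewrite mulr_sumr.
rewrite exchange_big; apply: ler_sum => j _ /=.
rewrite summxE; under [X in X ^+ 2]eq_bigr do rewrite mxE.
exact: jensen_sqr.
Qed.

End euclid.

Section smooth.
Variables (R : realType) (d : nat).
Implicit Types (u v x y : 'rV[R]_d) (g : 'rV[R]_d -> R).

Definition smooth2 (L : R) g : Prop := (forall x, differentiable g x) /\
  forall x y, sqn (grad g x - grad g y) <= L ^+ 2 * sqn (x - y).

Lemma smooth_smooth2 L g : 0 <= L -> smooth L g -> smooth2 L g.
Proof.
move=> L0 [dg Lg]; split=> // x y; rewrite -!enorm_sqr -exprMn.
by rewrite lerXn2r ?nnegrE ?mulr_ge0 ?sqrtr_ge0.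
Qed.

Lemma dot_grad g x v : differentiable g x -> dot (grad g x) v = 'D_v g x.
Proof.
move=> dg; rewrite deriveE// [in RHS](row_sum_delta v) linear_sum.
by apply: eq_bigr => j _; rewrite mxE deriveE// linearZ mulrC.
Qed.

Lemma line_derive g x v t : differentiable g (x + t *: v) ->
  is_derive t 1 (fun t : R => g (x + t *: v)) (dot (grad g (x + t *: v)) v).
Proof.
move=> dg.
have e : (fun h : R => h^-1 *: (((fun t : R => g (x + t *: v)) \o shift t) (h *: 1) -
    g (x + t *: v))) =
   (fun h : R => h^-1 *: ((g \o shift (x + t *: v)) (h *: v) - g (x + t *: v))).
  apply/funext => h /=; congr (_ *: (g _ - _)).
  by rewrite scalerDl -[h *: 1]/(h * 1) mulr1 addrCA.
split; first by rewrite /derivable e; exact: diff_derivable.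
by rewrite dot_grad// /derive e.
Qed.

(** The mean value theorem is applied to [psi], the difference between g on the segment and its
    quadratic upper model. That its derivative at c is at most 0 follows from [dot_le] with
    parameter L c, which matches the Lipschitz bound at distance c |v|. *)
Lemma descent L g x v : 0 < L -> smooth2 L g ->
  g (x + v) <= g x + dot (grad g x) v + L / 2 * sqn v.
Proof.
move=> L0 [dg Lg].
pose psi (t : R) := g (x + t *: v) - (dot (grad g x) v *: t + (L / 2 * sqn v) *: (t * t)).
pose dpsi (t : R) := dot (grad g (x + t *: v)) v -
   (dot (grad g x) v *: 1 + (L / 2 * sqn v) *: (t *: 1 + t *: 1)).
have psiP (t : R) : is_derive (t : R^o) (1 : R^o) (psi : R^o -> R^o) (dpsi t).
  rewrite /psi /dpsi; have := line_derive (dg (x + t *: v)) => ?.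
  exact: is_deriveB.
have [|c /andP[]] := @MVT _ psi dpsi 0 1 ltr01 (fun t _ => psiP t).
  apply: derivable_within_continuous => t _; exact: ex_derive.
rewrite !bnd_simp => c0 c1.
have psi1 : psi 1 = g (x + v) - (dot (grad g x) v + L / 2 * sqn v).
  by rewrite /psi scale1r -[dot _ _ *: _]/(_ * _) -[_ *: (1 * 1)]/(_ * _) !mulr1.
have psi0 : psi 0 = g x.
  by rewrite /psi scale0r mul0r !scaler0 !addr0 subr0.
have dpsiE : dpsi c = dot (grad g (x + c *: v)) v - (dot (grad g x) v + L * c * sqn v).
  rewrite /dpsi -[dot _ _ *: _]/(_ * _) -[c%:A]/(c * 1) -[_ *: (_ + _)]/(_ * _).
  by field.
rewrite psi1 psi0 dpsiE subr0 mulr1 => e.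
have cL : 0 < L * c by rewrite mulr_gt0.
have := dot_le (grad g (x + c *: v) - grad g x) v cL.
have xc : x + c *: v - x = c *: v by rewrite addrAC subrr add0r.
have := Lg (x + c *: v) x; rewrite xc sqnZ mulrA -exprMn dotDl dotNl.
move=> h h'.
have : sqn (grad g (x + c *: v) - grad g x) / (L * c) <= L * c * sqn v.
  by rewrite ler_pdivrMr// mulrAC -expr2.
by lra.
Qed.

(** A gradient step of length 1 / L cannot descend below the lower bound. This serves the degenerate
    case of smoothness constant 0, where it is applied with arbitrarily small positive constants. *)
Lemma sqn_grad_le L g x fstar : 0 < L -> smooth2 L g ->
  (forall y, fstar <= g y) -> sqn (grad g x) <= 2 * L * (g x - fstar).
Proof.
move=> L0 Lg gf; have := descent x (- L^-1 *: grad g x) L0 Lg.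
have := gf (x + (- L^-1 *: grad g x)).
rewrite dotZr dotvv sqnZ sqrrN => h1 h2.
have : sqn (grad g x) / (2 * L) <= g x - fstar.
  have -> : sqn (grad g x) / (2 * L) =
    L^-1 * sqn (grad g x) - L / 2 * (L^-1 ^+ 2 * sqn (grad g x)).
    by field; rewrite gt_eqF.
  by lra.
by rewrite ler_pdivrMr ?mulr_gt0// [in leRHS]mulrC.
Qed.

Lemma grad_scale_sum n (c : R) (f : 'I_n -> 'rV[R]_d -> R) x :
  (forall i, differentiable (f i) x) ->
  differentiable (fun y => c * \sum_i f i y) x /\
  grad (fun y => c * \sum_i f i y) x = c *: \sum_i grad (f i) x.
Proof.
move=> df.
have -> : (fun y => c * \sum_i f i y) = c \*: (\sum_i f i).
  by apply/funext => y /=; rewrite fct_sumE.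
have ds : differentiable (\sum_i f i) x by exact: differentiable_sum.
split; first exact: differentiableZ.
apply/rowP => j; rewrite !mxE deriveZ; last exact: diff_derivable.
rewrite summxE derive_sum; last by move=> i; exact: diff_derivable.
by congr (_ * _); apply: eq_bigr => i _; rewrite mxE.
Qed.

End smooth.

(** * Integrable random variables *)

Section expectation.
Variables (R : realType) (dO : measure_display) (Omega : measurableType dO).
Variable P : probability Omega R.
Implicit Types U V : Omega -> R.

Definition L1 U : Prop := P.-integrable [set: Omega] (EFin \o U).

Definition L2 U : Prop :=
  measurable_fun [set: Omega] U /\ L1 (fun w => U w ^+ 2).

Definition Ex U : R := (\int[P]_w U w)%R.

Lemma L1_meas U : L1 U -> measurable_fun [set: Omega] U.
Proof. by move=> /integrableP[/measurable_EFinP]. Qed.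

Lemma L1_expectation U : L1 U -> ('E_P[U])%E = (Ex U)%:E.
Proof.
move=> h; rewrite /Ex /Rintegral fineK; first by rewrite unlock.
exact: (integrable_fin_num measurableT h).
Qed.

Lemma L1_ge0 U : measurable_fun [set: Omega] U -> (forall w, 0 <= U w) ->
  (\int[P]_w (U w)%:E < +oo)%E -> L1 U.
Proof.
move=> mU U0 h; apply/integrableP; split; first exact/measurable_EFinP.
by under eq_integral do rewrite /= ger0_norm//.
Qed.

Lemma L1_le U V : measurable_fun [set: Omega] U ->
  (forall w, `|U w| <= V w) -> L1 V -> L1 U.
Proof.
move=> mU UV hV; apply: (le_integrable measurableT _ _ hV).
  exact/measurable_EFinP.
by move=> w _ /=; rewrite lee_fin (le_trans (UV w))// ler_norm.
Qed.

Lemma L1_cst c : L1 (fun=> c).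
Proof. exact: finite_measure_integrable_cst. Qed.

Lemma L1D U V : L1 U -> L1 V -> L1 (fun w => U w + V w).
Proof. by move=> hU hV; exact: (integrableD measurableT hU hV). Qed.

Lemma L1Z c U : L1 U -> L1 (fun w => c * U w).
Proof. by move=> hU; exact: (integrableZl measurableT c hU). Qed.

Lemma L1N U : L1 U -> L1 (fun w => - U w).
Proof.
by move=> /(L1Z (-1)); under eq_fun do rewrite mulN1r.
Qed.

Lemma L1B U V : L1 U -> L1 V -> L1 (fun w => U w - V w).
Proof. by move=> hU hV; apply: L1D => //; exact: L1N. Qed.

Lemma L1_sum (I : Type) (s : seq I) (U : I -> Omega -> R) :
  (forall i, L1 (U i)) -> L1 (fun w => \sum_(i <- s) U i w).
Proof.
move=> hU; elim: s => [|i s IH].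
  by under eq_fun do rewrite big_nil; exact: L1_cst.
by under eq_fun do rewrite big_cons; exact: L1D.
Qed.

Lemma Ex_cst c : Ex (fun=> c) = c.
Proof. by rewrite /Ex Rintegral_cst//= probability_setT mulr1. Qed.

Lemma ExD U V : L1 U -> L1 V -> Ex (fun w => U w + V w) = Ex U + Ex V.
Proof. exact: RintegralD. Qed.

Lemma ExZ c U : L1 U -> Ex (fun w => c * U w) = c * Ex U.
Proof. exact: RintegralZl. Qed.

Lemma ExB U V : L1 U -> L1 V -> Ex (fun w => U w - V w) = Ex U - Ex V.
Proof. exact: RintegralB. Qed.

Lemma Ex_sum (I : Type) (s : seq I) (U : I -> Omega -> R) :
  (forall i, L1 (U i)) -> Ex (fun w => \sum_(i <- s) U i w) = \sum_(i <- s) Ex (U i).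
Proof.
move=> hU; elim: s => [|i s IH].
  by under eq_fun do rewrite big_nil; rewrite Ex_cst big_nil.
under eq_fun do rewrite big_cons.
by rewrite ExD ?IH ?big_cons//; exact: L1_sum.
Qed.

Lemma Ex_le U V : L1 U -> L1 V -> (forall w, U w <= V w) -> Ex U <= Ex V.
Proof. by move=> hU hV UV; apply: le_Rintegral. Qed.

Lemma Ex_ge0 U : (forall w, 0 <= U w) -> 0 <= Ex U.
Proof. by move=> U0; apply: Rintegral_ge0. Qed.

Lemma L2_meas U : L2 U -> measurable_fun [set: Omega] U.
Proof. by case. Qed.

Lemma L2_sqr U : L2 U -> L1 (fun w => U w ^+ 2).
Proof. by case. Qed.

Lemma L2_mul U V : L2 U -> L2 V -> L1 (fun w => U w * V w).
Proof.
move=> [mU U2] [mV V2]; apply: L1_le (L1D U2 V2); first exact: measurable_funM.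
move=> w; rewrite ler_norml.
have := sqr_ge0 (U w - V w); have := sqr_ge0 (U w + V w).
have := sqr_ge0 (U w); have := sqr_ge0 (V w).
by rewrite sqrrB sqrrD !expr2 => *; apply/andP; split; lra.
Qed.

Lemma L2_cst c : L2 (fun=> c).
Proof. by split; [exact: measurable_cst|exact: L1_cst]. Qed.

Lemma L2_L1 U : L2 U -> L1 U.
Proof.
by move=> hU; have := L2_mul (L2_cst 1) hU; under eq_fun do rewrite mul1r.
Qed.

Lemma L2_le U V : measurable_fun [set: Omega] U ->
  (forall w, U w ^+ 2 <= V w) -> L1 V -> L2 U.
Proof.
move=> mU UV hV; split=> //; apply: L1_le hV.
  by under eq_fun do rewrite expr2; exact: measurable_funM.
by move=> w; rewrite ger0_norm ?sqr_ge0.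
Qed.

Lemma L2D U V : L2 U -> L2 V -> L2 (fun w => U w + V w).
Proof.
move=> hU hV; apply: (@L2_le _ (fun w => 2 * U w ^+ 2 + 2 * V w ^+ 2)).
- by apply: measurable_funD; exact: L2_meas.
- by move=> w; have := sqr_ge0 (U w - V w); rewrite !expr2; lra.
- by apply: L1D; apply: L1Z; exact: L2_sqr.
Qed.

Lemma L2Z c U : L2 U -> L2 (fun w => c * U w).
Proof.
move=> hU; apply: (@L2_le _ (fun w => c ^+ 2 * U w ^+ 2)).
- by apply: measurable_funM; [exact: measurable_cst|exact: L2_meas].
- by move=> w; rewrite exprMn.
- by apply: L1Z; exact: L2_sqr.
Qed.

Lemma L2B U V : L2 U -> L2 V -> L2 (fun w => U w - V w).
Proof.
by move=> hU /(L2Z (-1)); under eq_fun do rewrite mulN1r; exact: L2D.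
Qed.

Lemma L2_sum (I : Type) (s : seq I) (U : I -> Omega -> R) :
  (forall i, L2 (U i)) -> L2 (fun w => \sum_(i <- s) U i w).
Proof.
move=> hU; elim: s => [|i s IH].
  by under eq_fun do rewrite big_nil; exact: L2_cst.
by under eq_fun do rewrite big_cons; exact: L2D.
Qed.

Lemma Ex_sqr_sum (I : finType) (c : I -> R) (N : I -> Omega -> R) :
  (forall i, L2 (N i)) ->
  (forall i j, i != j -> Ex (fun w => N i w * N j w) = 0) ->
  Ex (fun w => (\sum_i c i * N i w) ^+ 2) =
  \sum_i c i ^+ 2 * Ex (fun w => N i w ^+ 2).
Proof.
move=> N2 orth.
have -> : (fun w => (\sum_i c i * N i w) ^+ 2) =
    (fun w => \sum_i \sum_j c i * c j * (N i w * N j w)).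
  apply/funext => w; rewrite expr2 mulr_suml; apply: eq_bigr => i _.
  by rewrite mulr_sumr; apply: eq_bigr => j _; ring.
have hL i j : L1 (fun w => c i * c j * (N i w * N j w)) by apply/L1Z/L2_mul.
rewrite Ex_sum => [|i]; last exact: L1_sum.
apply: eq_bigr => i _; rewrite Ex_sum// (bigD1 i)//= big1 ?addr0 => [|j ji].
  by rewrite ExZ; [rewrite expr2; congr (_ * Ex _); apply/funext => w; rewrite expr2|exact: L2_mul].
by rewrite ExZ ?orth ?mulr0//; [rewrite eq_sym|exact: L2_mul].
Qed.

End expectation.

(** * Unbiased stochastic gradients *)

Section caratheodory.
Variables (R : realType) (d : nat) (dT dX : measure_display).
Variables (T : measurableType dT) (X : measurableType dX).
Variable F : 'rV[R]_d -> X -> R.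
Hypothesis F_cont : forall z, continuous (F ^~ z).
Hypothesis F_meas : forall x, measurable_fun [set: X] (F x).

Let grid k (x : 'rV[R]_d) : {ffun 'I_d -> int} :=
  [ffun j => Num.floor (k.+1%:R * x 0 j)].

Let node k (q : {ffun 'I_d -> int}) : 'rV[R]_d :=
  \row_j ((q j)%:~R / k.+1%:R).

Let node_cvg x : node k (grid k x) @[k --> \oo] --> x.
Proof.
apply/cvg_ballP => e e0; near=> k.
split=> // i j; rewrite (ord1 i) /ball /= mxE ffunE.
have k0 : (0 : R) < k.+1%:R by rewrite ltr0n.
have fl := floor_itv (k.+1%:R * x 0 j).
have -> : x 0 j - (Num.floor (k.+1%:R * x 0 j))%:~R / k.+1%:R =
    (k.+1%:R * x 0 j - (Num.floor (k.+1%:R * x 0 j))%:~R) / k.+1%:R.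
  by field; rewrite gt_eqF.
rewrite normrM ger0_norm; last by rewrite subr_ge0; case/andP: fl.
rewrite gtr0_norm ?invr_gt0//; apply: (@lt_trans _ _ (k.+1%:R^-1)).
  rewrite -[ltRHS]mul1r ltr_pM2r ?invr_gt0//.
  by move: fl => /andP[_]; rewrite intrD; lra.
near: k; exact: near_infty_natSinv_lt (PosNum e0).
Unshelve. all: end_near. Qed.

(** Rounding [y t] to the grid of mesh 1 / (k+1) leaves countably many values, on each of which F is
    measurable in the sample alone; continuity in the point recovers F as the limit. *)
Lemma caratheodory_measurable (y : T -> 'rV[R]_d) (z : T -> X) :
  (forall j, measurable_fun [set: T] (fun t => y t 0 j)) ->
  measurable_fun [set: T] z ->
  measurable_fun [set: T] (fun t => F (y t) (z t)).
Proof.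
move=> my mz.
apply: (@measurable_fun_cvg _ _ _ _ (fun k t => F (node k (grid k (y t))) (z t))); last first.
  move=> t _; apply: (@continuous_cvg nat _ _ \oo _ (fun k => node k (grid k (y t)))
    (F ^~ (z t)) (y t)).
    exact: F_cont.
  exact: node_cvg.
move=> k _ B mB; rewrite setTI.
have -> : (fun t => F (node k (grid k (y t))) (z t)) @^-1` B =
   \bigcup_(q : {ffun 'I_d -> int}) ((fun t => grid k (y t)) @^-1` [set q] `&`
        (fun t => F (node k q) (z t)) @^-1` B).
  apply/seteqP; split=> [t /= Bt|t [q _ [/= <-]]//].
  by exists (grid k (y t)).
apply: countable_bigcupT_measurable => // q; apply: measurableI; last first.
  rewrite -[X in measurable X]setTI; apply: (measurableT_comp (F_meas (node k q)) mz) => //.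
have -> : (fun t => grid k (y t)) @^-1` [set q] =
   \bigcap_(j in [set: 'I_d]) ((fun t => k.+1%:R * y t 0 j) @^-1` [set` `[(q j)%:~R, (q j + 1)%:~R[]).
  apply/seteqP; split=> [t /= <- j _|t qt].
    by rewrite /= in_itv /= ffunE; exact: floor_itv.
  apply/ffunP => j; rewrite ffunE; apply: floor_def.
  by have := qt j I; rewrite /= in_itv.
apply: fin_bigcap_measurable; first exact: finite_finset.
move=> j _; rewrite -[X in measurable X]setTI.
have mk : measurable_fun [set: T] (fun t => k.+1%:R * y t 0 j).
  by apply: measurable_funM => //; exact: measurable_cst.
by apply: mk => //; exact: measurable_itv.
Qed.

End caratheodory.

(** * Increments bounded by the integral of the derivative *)

Section increment.
Variables (R : realType) (g dg : R -> R) (a b : R).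
Hypothesis ab : a <= b.
Hypothesis g_derive : forall x : R, is_derive x 1 g (dg x).
Hypothesis dg_meas : measurable_fun [set: R] dg.

Notation mu := (@lebesgue_measure R).

(* A Vitali-Caratheodory majorant [u] of |dg|: lower semicontinuity enters
   through the open sets [U k], and a supremum argument replaces the
   fundamental theorem of calculus. *)
Let increment_majorant (M : R -> \bar R) :
  measurable_fun [set: R] M -> (forall x, 0 <= M x)%E ->
  (\int[mu]_(x in `[a, b]) M x < +oo)%E ->
  (forall x, x \in `[a, b] -> exists (U : set R) m, [/\ open U, U x,
     `|dg x| < m & forall y, U y -> (m%:E <= M y)%E]) ->
  (`|g b - g a|%:E <= \int[mu]_(x in `[a, b]) M x)%E.
Proof.
move=> mM M0 Mfin HU.
have mMD (D : set R) : measurable_fun D M by exact: measurable_funTS.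
pose H x := (\int[mu]_(y in `[a, x]) M y)%E.
have Hle x y : x <= y -> (H x <= H y)%E.
  move=> xy; apply: ge0_subset_integral => //.
    exact: mMD.
  by move=> z /=; rewrite !in_itv /= => /andP[-> zx]; exact: le_trans zx xy.
have Hfin x : x <= b -> (H x) \is a fin_num.
  move=> xb; rewrite ge0_fin_numE; last exact: integral_ge0.
  exact: le_lt_trans (Hle _ _ xb) Mfin.
have gcont : continuous g.
  by move=> x; apply/differentiable_continuous/derivable1_diffP; case: (g_derive x).
(* The supremum c of S belongs to S by continuity of g and monotonicity of H. If c < b, the slope of
   g near c stays below m while M is at least m there, so S contains a point beyond c. *)
pose S := [set x | x \in `[a, b] /\ (`|g x - g a|%:E <= H x)%E].
have Sa : S a.
  split; first by rewrite in_itv /= lexx.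
  by rewrite subrr normr0; exact: integral_ge0.
have Sb : has_sup S.
  by split; [exists a|exists b => x [+ _]; rewrite in_itv => /andP[]].
pose c := sup S.
have ac : a <= c by apply: ub_le_sup => //; case: Sb.
have cb : c <= b.
  by apply: sup_le_ub; [exists a|move=> x [+ _]; rewrite in_itv => /andP[]].
have Sc : S c.
  split; first by rewrite in_itv /= ac.
  rewrite -[H c]fineK ?Hfin// lee_fin; apply/ler_addgt0Pr => e e0.
  have /cvgrPdist_lt /(_ _ e0)[r /= r0 rg] := gcont c.
  have [s Ss cs] := sup_adherent r0 Sb.
  have sc : s <= c by apply: ub_le_sup => //; case: Sb.
  have [_ gs] := Ss; have sb := le_trans sc cb.
  have := rg s; rewrite /= ger0_norm ?subr_ge0// => /(_ _) h.
  have {}h : `|g c - g s| < e by apply: h; move: cs; rewrite -/c; lra.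
  rewrite -[H s]fineK ?Hfin// lee_fin in gs.
  have := Hle _ _ sc; rewrite -[H s]fineK ?Hfin// -[H c]fineK ?Hfin// lee_fin.
  have := ler_normD (g c - g s) (g s - g a); rewrite subrKA.
  by lra.
have [cb'|bc] := ltP c b; last first.
  by have -> : b = c by [apply/eqP; rewrite eq_le bc cb]; exact: (proj2 Sc).
have [U [m [oU Uc dm mU]]] := HU c (proj1 Sc).
have [q [gq qc qE]] := (is_derive1_caratheodory g c (dg c)).1 (g_derive c).
have [r r0 rU] : exists2 r, 0 < r & forall z, `|c - z| < r -> U z /\ `|q z| < m.
  have h : \forall z \near c, U z /\ `|q z| < m.
    near=> z; split; first by near: z; exact: open_nbhs_nbhs.
    have -> : q z = q c + (q z - q c) by rewrite subrKC.
    have h' : `|q c - q z| < m - `|dg c|.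
      by near: z; move/cvgrPdist_lt : qc; apply; rewrite subr_gt0.
    have := ler_normD (q c) (q z - q c); rewrite distrC in h'.
    by rewrite -qE in h'; lra.
  by move: h => /nbhs_ballP[r /= r0 rh]; exists r.
(* Half of r keeps z strictly inside the ball around c, and b - c keeps it in the interval. *)
pose z := c + Num.min (r / 2) (b - c).
have z_c : c < z by rewrite ltrDl lt_min divr_gt0 //= subr_gt0.
have zb : z <= b.
  have : Num.min (r / 2) (b - c) <= b - c by rewrite ge_min lexx orbT.
  by rewrite /z; lra.
have zr : z - c < r.
  have : Num.min (r / 2) (b - c) <= r / 2 by rewrite ge_min lexx.
  by rewrite /z; lra.
suff : S z.
  by move=> Sz; have := ub_le_sup (proj2 Sb) Sz; rewrite -/c leNgt z_c.
split; first by rewrite in_itv /= (le_trans ac (ltW z_c)).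
have Hz : (H c + (m * (z - c))%:E <= H z)%E.
  rewrite /H (_ : `[a, z]%classic = `[a, c]%classic `|` `]c, z]%classic); last first.
    by rewrite -itv_bndbnd_setU ?bnd_simp// ltW.
  rewrite ge0_integral_setU//; last 2 first.
  - exact: mMD.
  - apply/disj_setPS => x /= []; rewrite !in_itv /= => /andP[_ xc] /andP[cx _].
    by move: (le_lt_trans xc cx); rewrite ltxx.
  rewrite leeD2l//.
  have -> : (m * (z - c))%:E = (\int[mu]_(x in `]c, z]) cst m%:E x)%E.
    by rewrite integral_cst//= lebesgue_measure_itv /= lte_fin z_c EFinM EFinB.
  apply: ge0_le_integral => //.
  - by move=> x _; rewrite lee_fin (le_trans _ (ltW dm)).
  - exact: mMD.
  - move=> x /=; rewrite in_itv /= => /andP[cx xz]; apply: mU.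
    by have [] := rU x; rewrite // distrC gtr0_norm ?subr_gt0//; lra.
apply: le_trans Hz; rewrite -[H c]fineK ?Hfin// -EFinD lee_fin.
have := proj2 Sc; rewrite -[H c]fineK ?Hfin// lee_fin => gc.
have := ler_normD (g z - g c) (g c - g a); rewrite subrKA gq normrM.
have -> : `|z - c| = z - c by rewrite gtr0_norm ?subr_gt0.
have [_ /ltW qz] : U z /\ `|q z| < m.
  by apply: rU; rewrite distrC gtr0_norm ?subr_gt0.
have : `|q z| * (z - c) <= m * (z - c).
  by apply: ler_wpM2r => //; rewrite subr_ge0 ltW.
by lra.
Unshelve. all: end_near. Qed.

(** The majorant is built from the slices [E k] on which |dg| lies between k e and (k+1) e: each
    slice is enlarged to an open set [U k] of little extra measure, and M is the sum of (k+1) e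
    times the indicators of the [U k]. A point of [E k] then has a whole neighbourhood where M
    exceeds |dg| at that point. *)
Lemma increment_le :
  (`|g b - g a|%:E <= \int[mu]_(x in `[a, b]) `|dg x|%:E)%E.
Proof.
have mabs : measurable_fun [set: R] (fun x => `|dg x|).
  exact: measurableT_comp.
set I := (\int[mu]_(x in `[a, b]) _)%E.
have I0 : (0 <= I)%E by apply: integral_ge0 => x _; rewrite lee_fin.
have [->|Ioo] := eqVneq I +oo%E; first by rewrite leey.
have Ifin : I \is a fin_num by rewrite ge0_fin_numE// ltey.
apply/lee_addgt0Pr => e0 e0_gt0.
(* Rounding up in the slices costs e (b - a) and the open enlargements cost e, in total e0. *)
pose e := e0 / (b - a + 1).
have ba1 : 0 < b - a + 1 by rewrite ltr_wpDl ?subr_ge0.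
have e_gt0 : 0 < e by rewrite divr_gt0.
pose E k := `[a, b]%classic `&` (fun x => `|dg x|) @^-1` `[k%:R * e, k.+1%:R * e[%classic.
have mE k : measurable (E k).
  by apply: measurableI => //; rewrite -[X in measurable X]setTI; exact: mabs.
have Efin k : (mu (E k) < +oo)%E.
  apply: (@le_lt_trans _ _ (mu `[a, b]%classic)).
    by apply: le_measure; rewrite ?inE//; [exact: mE|move=> x []].
  by rewrite /= lebesgue_measure_itv /=; case: ifP => _; rewrite ?ltry// -EFinB ltry.
(* With this choice (k+1) e times [del k] is e / 2^(k+1), and these errors sum to e. *)
pose del k : R := (k.+1%:R)^-1 / (2 ^ k.+1)%:R.
have del_gt0 k : 0 < del k.
  by rewrite divr_gt0 ?invr_gt0// ltr0n expn_gt0.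
pose U k := sval (cid (lebesgue_regularity_outer (mE k) (Efin k) (del_gt0 k))).
have UP k : [/\ open (U k), E k `<=` U k & (mu (U k `\` E k) < (del k)%:E)%E].
  by rewrite /U; case: cid.
have mU k : measurable (U k) by apply: open_measurable; case: (UP k).
pose h k x : \bar R := ((k.+1%:R * e)%:E * (\1_(U k) x)%:E)%E.
have h0 k x : (0 <= h k x)%E.
  by rewrite mule_ge0// lee_fin// mulr_ge0// ltW.
have mh k : measurable_fun [set: R] (h k).
  apply: emeasurable_funM; first exact: measurable_cst.
  by apply/measurable_EFinP; exact: measurable_indic.
pose M x := (\sum_(0 <= k <oo) h k x)%E.
have mM : measurable_fun [set: R] M.
  exact: (@ge0_emeasurable_sum _ _ _ _ h xpredT).
have M0 x : (0 <= M x)%E by apply: nneseries_ge0.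
have coverE : `[a, b]%classic = \bigcup_k E k.
  apply/seteqP; split=> [x abx|x [k _ []]//].
  exists (Num.truncn (`|dg x| / e)) => //; split=> //=; rewrite in_itv /=.
  have := truncn_itv (divr_ge0 (normr_ge0 (dg x)) (ltW e_gt0)).
  by rewrite ler_pdivlMr// ltr_pdivrMr.
have tE : trivIset setT E.
  apply/trivIsetP => i j _ _ ij; apply/seteqP; split => // x [[_ xi] [_ xj]].
  move: xi xj; rewrite /= !in_itv /= => /andP[i1 i2] /andP[j1 j2].
  have ltk (k l : nat) : k%:R * e < l.+1%:R * e -> (k <= l)%N.
    by rewrite ltr_pM2r// ltr_nat ltnS.
  have := ltk _ _ (le_lt_trans i1 j2); have := ltk _ _ (le_lt_trans j1 i2).
  by move: ij => /eqP; lia.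
have IE : (\sum_(0 <= k <oo) \int[mu]_(x in E k) (`|dg x| + e)%:E = I + (e * (b - a))%:E)%E.
  rewrite -ge0_integral_bigcup//; last 2 first.
  - by apply/measurable_EFinP; apply: measurable_funTS; exact: measurable_funD.
  - by move=> x _; rewrite lee_fin addr_ge0// ltW.
  rewrite -coverE.
  under eq_integral do rewrite EFinD.
  rewrite ge0_integralD//; last 2 first.
  - by apply/measurable_EFinP; exact: measurable_funTS.
  - by move=> x _; rewrite lee_fin ltW.
  rewrite integral_cst//= lebesgue_measure_itv /= lte_fin -/I.
  case: ltP => [_|ba]; first by rewrite EFinM.
  have -> : (b - a = 0)%R by apply/eqP; rewrite subr_eq0 eq_le ab ba.
  by rewrite mulr0 mule0.
have IM : (\int[mu]_(x in `[a, b]) M x <= I + (e * (b - a))%:E + e%:E)%E.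
  rewrite integral_nneseries//; last by move=> k; apply: measurable_funTS; exact: mh.
  rewrite -IE; apply: le_trans (epsilon_trick _ _ (ltW e_gt0)); last first.
    by move=> k; apply: integral_ge0 => x _; rewrite lee_fin addr_ge0// ltW.
  apply: lee_nneseries => [k _ _|k _]; first exact: integral_ge0.
  rewrite /h ge0_integralZl//; last by rewrite lee_fin mulr_ge0// ltW.
  rewrite integral_indic//.
  have [_ EU Ud] := UP k.
  have ke : 0 < k.+1%:R * e by rewrite mulr_gt0.
  apply: (@le_trans _ _ ((k.+1%:R * e)%:E * (mu (E k) + (del k)%:E))%E).
    apply: lee_wpmul2l; first by rewrite lee_fin ltW.
    apply: (@le_trans _ _ (mu (E k) + mu (U k `\` E k))%E); last first.
      by rewrite leeD2l// ltW.
    have mUE : measurable (U k `\` E k) by exact: measurableD.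
    rewrite -(measureU mu (mE k) mUE); last by rewrite setIDA setIC -setIDA setDv setI0.
    apply: le_measure; rewrite ?inE.
    - by apply: measurableI; [exact: mU|exact: measurable_itv].
    - exact: (measurableU _ _ (mE k) mUE).
    move=> x [Ux _]; have [|] := pselect (E k x); [by left|by right].
  rewrite ge0_muleDr//; last by rewrite lee_fin ltW.
  apply: leeD; last first.
    rewrite -EFinM lee_fin /del.
    by rewrite mulrA [k.+1%:R * e]mulrC mulfK.
  rewrite -(integral_cst mu (mE k)); apply: ge0_le_integral => //.
  - exact: mE.
  - by move=> x _ /=; rewrite lee_fin ltW.
  - apply/measurable_EFinP; apply: measurable_funTS; exact: measurable_funD.
  - move=> x [_] /=; rewrite in_itv /= => /andP[h1 _].
    by rewrite lee_fin -natr1 mulrDl mul1r lerD2r.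
  - exact: mU.
  - by apply/measurable_EFinP; apply: measurable_indic; exact: mU.
apply: le_trans (increment_majorant mM M0 _ _) _.
- by apply: le_lt_trans IM _; rewrite -[I]fineK// -!EFinD ltry.
- move=> x xab; have : `[a, b]%classic x by [].
  rewrite coverE => -[k _ Ekx]; have [oU EU _] := UP k.
  exists (U k), (k.+1%:R * e); split=> //; first exact: EU.
    by case: Ekx => _ /=; rewrite in_itv /= => /andP[].
  move=> y Uy; apply: le_trans (nneseries_lim_ge k.+1 _); last first.
    by move=> n _ _; exact: h0.
  have hk : h k y = (k.+1%:R * e)%:E by rewrite /h indicE mem_set// mule1.
  by rewrite big_nat_recr//= hk leeDr// sume_ge0// => l _; exact: h0.
apply: le_trans IM _; rewrite -addeA leeD2l// -EFinD lee_fin /e.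
rewrite -{2}[e0 / _]mulr1 -mulrDr divfK//; by rewrite gt_eqF.
Qed.

End increment.

Section gradient_measurable.
Variables (R : realType) (d : nat) (dX : measure_display).
Variables (X : measurableType dX) (F : 'rV[R]_d -> X -> R).
Hypothesis F_diff : forall z x, differentiable (F ^~ z) x.
Hypothesis F_meas : forall x, measurable_fun [set: X] (F x).

Lemma grad_seq_cvg (g : 'rV[R]_d -> R) x a : differentiable g x ->
  n.+1%:R * (g (x + n.+1%:R^-1 *: delta_mx 0 a) - g x) @[n --> \oo] -->
  grad g x 0 a.
Proof.
move=> dg; rewrite mxE.
have dv : derivable g x (delta_mx 0 a) by exact: diff_derivable.
have := dv => /cvg_ex[l hl]; have -> : 'D_(delta_mx 0 a) g x = l by exact: cvg_lim.
have [h _] := cvgr_dnbhsP (fun h : R => h^-1 *: ((g \o shift x) (h *: delta_mx 0 a) - g x)) 0 l.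
have := h hl (fun n => n.+1%:R^-1); move=> /(_ _) {h}.
have -> : (fun n => n.+1%:R^-1^-1 *: ((g \o shift x) (n.+1%:R^-1 *: delta_mx 0 a) - g x)) =
   (fun n => n.+1%:R * (g (x + n.+1%:R^-1 *: delta_mx 0 a) - g x)).
  by apply/funext => n /=; rewrite invrK (addrC x).
apply; split=> [n|]; first by rewrite invr_eq0 pnatr_eq0.
exact: cvg_harmonic.
Qed.

Let F_cont z : continuous (F ^~ z).
Proof. by move=> x; apply: differentiable_continuous; exact: F_diff. Qed.

Lemma measurable_value (dT : measure_display) (T : measurableType dT)
    (y : T -> 'rV[R]_d) (z : T -> X) :
  (forall j, measurable_fun [set: T] (fun t => y t 0 j)) ->
  measurable_fun [set: T] z -> measurable_fun [set: T] (fun t => F (y t) (z t)).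
Proof. exact: (caratheodory_measurable F_cont F_meas). Qed.

(** A partial derivative is the limit of difference quotients with steps 1 / (n+1), each measurable
    by [measurable_value]. *)
Lemma measurable_grad (dT : measure_display) (T : measurableType dT)
    (y : T -> 'rV[R]_d) (z : T -> X) a :
  (forall j, measurable_fun [set: T] (fun t => y t 0 j)) ->
  measurable_fun [set: T] z ->
  measurable_fun [set: T] (fun t => grad (F ^~ (z t)) (y t) 0 a).
Proof.
move=> my mz; apply: (@measurable_fun_cvg _ _ _ _
  (fun n t => n.+1%:R * (F (y t + n.+1%:R^-1 *: delta_mx 0 a) (z t) - F (y t) (z t)))).
  move=> n; apply: measurable_funM; first exact: measurable_cst.
  apply: measurable_funB; last by apply: measurable_value.
  apply: measurable_value => // j; under eq_fun do rewrite mxE.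
  by apply: measurable_funD => //; exact: measurable_cst.
by move=> t _; apply: grad_seq_cvg.
Qed.

End gradient_measurable.

Section unbiased.
Variables (R : realType) (d : nat) (dX : measure_display).
Variables (X : measurableType dX) (D : probability X R).
Variables (F : 'rV[R]_d -> X -> R) (f : 'rV[R]_d -> R) (sigma : R).
Hypothesis F_diff : forall z x, differentiable (F ^~ z) x.
Hypothesis F_int : forall x, D.-integrable [set: X] (EFin \o F x).
Hypothesis F_mean : forall x, ('E_D[F x] = (f x)%:E)%E.
Hypothesis f_diff : forall x, differentiable f x.
Hypothesis F_var : forall x, ('E_D[fun z => (enorm (grad (F ^~ z) x - grad f x) ^+ 2)%R]
  <= (sigma ^+ 2)%:E)%E.

Let F_meas x : measurable_fun [set: X] (F x).
Proof. exact: (L1_meas (F_int x)). Qed.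

Definition noise (x : 'rV[R]_d) (z : X) : 'rV[R]_d := grad (F ^~ z) x - grad f x.

Lemma measurable_noise (dT : measure_display) (T : measurableType dT)
    (y : T -> 'rV[R]_d) (z : T -> X) a :
  (forall j, measurable_fun [set: T] (fun t => y t 0 j)) ->
  measurable_fun [set: T] z ->
  measurable_fun [set: T] (fun t => noise (y t) (z t) 0 a).
Proof.
move=> my mz; rewrite /noise; under eq_fun do rewrite mxE [(- _ : 'rV_ _) _ _]mxE.
apply: measurable_funB; first exact: (measurable_grad F_diff F_meas a my mz).
(* Here f is viewed as a loss that is constant in the sample. *)
by apply: (@measurable_grad _ _ _ X (fun x _ => f x) _ _ _ _ _ z).
Qed.

Lemma measurable_sqn_noise (dT : measure_display) (T : measurableType dT)
    (y : T -> 'rV[R]_d) (z : T -> X) :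
  (forall j, measurable_fun [set: T] (fun t => y t 0 j)) ->
  measurable_fun [set: T] z ->
  measurable_fun [set: T] (fun t => sqn (noise (y t) (z t))).
Proof.
move=> my mz; apply: measurable_sum => j; under eq_fun do rewrite expr2.
by apply: measurable_funM; apply: measurable_noise.
Qed.

Lemma noise_var x : (\int[D]_z (sqn (noise x z))%:E <= (sigma ^+ 2)%:E)%E.
Proof.
have := F_var x; rewrite unlock; apply: le_trans.
by rewrite le_eqVlt; apply/orP; left; apply/eqP/eq_integral => z _; rewrite enorm_sqr.
Qed.

Lemma noise_coord_var x a :
  (\int[D]_z ((noise x z 0 a) ^+ 2)%:E <= (sigma ^+ 2)%:E)%E.
Proof.
apply: le_trans (noise_var x); apply: ge0_le_integral => //.
- by move=> z _; rewrite lee_fin sqr_ge0.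
- apply/measurable_EFinP; under eq_fun do rewrite expr2.
  by apply: measurable_funM; apply: measurable_noise.
- by apply/measurable_EFinP; exact: measurable_sqn_noise.
- move=> z _; rewrite lee_fin /sqn (bigD1 a)//= lerDl sumr_ge0// => j _.
  exact: sqr_ge0.
Qed.

Lemma noise_L2 x a : L2 D (fun z => noise x z 0 a).
Proof.
have m : measurable_fun [set: X] (fun z => noise x z 0 a) by apply: measurable_noise.
split=> //; apply: L1_ge0; [|by move=> z; exact: sqr_ge0|].
  by under eq_fun do rewrite expr2; exact: measurable_funM.
by apply: le_lt_trans (noise_coord_var x a) _; rewrite ltry.
Qed.

Let quot x a n z : R := n.+1%:R *
  ((F (x + n.+1%:R^-1 *: delta_mx 0 a) z - f (x + n.+1%:R^-1 *: delta_mx 0 a)) -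
   (F x z - f x)).

Let Ex_F x : Ex D (F x) = f x.
Proof.
by apply: EFin_inj; rewrite -F_mean; apply/esym/L1_expectation; exact: F_int.
Qed.

Let quot_L1 x a n : L1 D (quot x a n).
Proof.
by apply: L1Z; apply: L1B; apply: L1B; first [exact: L1_cst|exact: F_int].
Qed.

Let Ex_quot x a n : Ex D (quot x a n) = 0.
Proof.
have FL y : L1 D (F y) by exact: F_int.
have cL c : L1 D (fun=> c) by exact: L1_cst.
rewrite /quot ExZ; last by apply: L1B; apply: L1B.
by rewrite ExB ?ExB ?Ex_cst ?Ex_F ?subrr ?mulr0//; exact: L1B.
Qed.

Let quot_cvg x a z : quot x a n z @[n --> \oo] --> noise x z 0 a.
Proof.
rewrite /noise mxE [(- _ : 'rV_ _) _ _]mxE.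
have -> : (fun n => quot x a n z) =
  (fun n => n.+1%:R * (F (x + n.+1%:R^-1 *: delta_mx 0 a) z - F x z) -
     n.+1%:R * (f (x + n.+1%:R^-1 *: delta_mx 0 a) - f x)).
  by apply/funext => n; rewrite /quot; ring.
by apply: cvgB; [exact: (@grad_seq_cvg _ _ (F ^~ z))|exact: grad_seq_cvg].
Qed.

Notation mu := (@lebesgue_measure R).

Let path x a (t : R) : 'rV[R]_d := x + t *: delta_mx 0 a.

Let dnoise x a t z : R := noise (path x a t) z 0 a.

Let path_meas (dT : measure_display) (T : measurableType dT) x a (u : T -> R) :
  measurable_fun [set: T] u ->
  forall j, measurable_fun [set: T] (fun t => path x a (u t) 0 j).
Proof.
move=> mu_ j; rewrite /path; under eq_fun do rewrite !mxE.
apply: measurable_funD; first exact: measurable_cst.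
by apply: measurable_funM => //; exact: measurable_cst.
Qed.

Let dnoise_meas (dT : measure_display) (T : measurableType dT) x a
    (u : T -> R) (z : T -> X) :
  measurable_fun [set: T] u -> measurable_fun [set: T] z ->
  measurable_fun [set: T] (fun t => dnoise x a (u t) (z t)).
Proof. by move=> mu_ mz; apply: measurable_noise => //; exact: path_meas. Qed.

Let seg n : set R := `[0, n.+1%:R^-1]%classic.

Let mseg n : measurable (seg n). Proof. exact: measurable_itv. Qed.

Let mu_seg n : mu (seg n) = (n.+1%:R^-1)%R%:E.
Proof.
by rewrite /= /seg lebesgue_measure_itv /= lte_fin invr_gt0 ltr0n /= sube0.
Qed.

(** From |u| <= K + u^2 / (4 K): the mean, over the segment of length 1 / (n+1), of what the
    derivative of F - f may contribute beyond the level K. *)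
Let excess (K : R) x a n z : \bar R := ((n.+1%:R)%R%:E *
  \int[mu]_(t in seg n) ((dnoise x a t z) ^+ 2 / (4 * K))%R%:E)%E.

Let path_derive x a z (t : R) :
  is_derive t 1 (fun t : R => F (path x a t) z - f (path x a t)) (dnoise x a t z).
Proof.
have := line_derive (F_diff z (path x a t)); have := line_derive (f_diff (path x a t)).
rewrite /path => h1 h2; apply: is_derive_eq.
rewrite -dotNl -dotDl /dnoise -/(noise _ _) /dot (bigD1 a)//= big1 ?addr0.
  by rewrite [X in _ * X]mxE !eqxx mulr1.
by move=> j /negPf ja; rewrite [X in _ * X]mxE ja andbF mulr0.
Qed.

Let quot_bound K x a n z : 0 < K ->
  ((`|quot x a n z|)%:E <= K%:E + excess K x a n z)%E.
Proof.
move=> K0; have h0 : 0 <= n.+1%:R^-1 :> R by rewrite invr_ge0.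
have md : measurable_fun [set: R] (fun t => dnoise x a t z).
  by apply: dnoise_meas => //; exact: measurable_cst.
have md2 : measurable_fun [set: R] (fun t => dnoise x a t z ^+ 2 / (4 * K)).
  apply: measurable_funM; last exact: measurable_cst.
  by under eq_fun do rewrite expr2; exact: measurable_funM.
have := increment_le h0 (path_derive x a z) md.
have -> : F (path x a n.+1%:R^-1) z - f (path x a n.+1%:R^-1) -
    (F (path x a 0) z - f (path x a 0)) = n.+1%:R^-1 * quot x a n z.
  by rewrite /quot mulKf// /path scale0r addr0.
rewrite normrM ger0_norm// => le1.
rewrite -[`|_|](mulVKf (_ : n.+1%:R != 0))// EFinM.
have -> : (K%:E + excess K x a n z = (n.+1%:R)%R%:E * ((n.+1%:R^-1 * K)%R%:E +
    \int[mu]_(t in seg n) (dnoise x a t z ^+ 2 / (4 * K))%R%:E))%E.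
  rewrite ge0_muleDr; first by rewrite -EFinM mulVKf.
    by rewrite lee_fin mulr_ge0// ltW.
  apply: integral_ge0 => t _; rewrite lee_fin mulr_ge0 ?sqr_ge0// invr_ge0.
  by rewrite mulr_ge0// ltW.
apply: lee_wpmul2l; first by rewrite lee_fin.
apply: (le_trans le1).
have -> : (n.+1%:R^-1 * K)%R%:E = (\int[mu]_(t in seg n) K%:E)%E.
  by rewrite (integral_cst mu (mseg n)) /= mu_seg -EFinM mulrC.
have K4 : 0 < 4 * K by rewrite mulr_gt0.
rewrite -ge0_integralD//; last 3 first.
- by move=> t _; rewrite lee_fin ltW.
- by move=> t _; rewrite lee_fin divr_ge0 ?sqr_ge0// ltW.
- by apply/measurable_EFinP; exact: measurable_funTS.
apply: ge0_le_integral => //.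
- by apply/measurable_EFinP; apply: measurable_funTS; exact: measurableT_comp.
- by apply: emeasurable_funD => //; apply/measurable_EFinP; exact: measurable_funTS.
move=> t _; rewrite lee_fin -lerBlDl ler_pdivlMr//.
have := sqr_ge0 (`|dnoise x a t z| - 2 * K).
by rewrite -[dnoise _ _ _ _ ^+ 2]real_normK ?num_real//; set u := `|_|; rewrite !expr2; lra.
exact: mseg.
Qed.

Let integrand (K : R) x a n (p : X * R) : \bar R :=
  ((dnoise x a p.2 p.1 ^+ 2 / (4 * K)) * \1_(seg n) p.2)%:E.

Let excessE K x a n z :
  (excess K x a n z = (n.+1%:R)%R%:E * \int[mu]_t integrand K x a n (z, t))%E.
Proof.
rewrite /excess integral_mkcond; congr (_ * _)%E; apply: eq_integral => t _.
rewrite /integrand /patch /= indicE.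
by case: (t \in seg n); rewrite ?mulr1 ?mulr0.
Qed.

Let integrand_meas K x a n : measurable_fun [set: X * R] (integrand K x a n).
Proof.
apply/measurable_EFinP; apply: measurable_funM.
  apply: measurable_funM; last exact: measurable_cst.
  under eq_fun do rewrite expr2.
  by apply: measurable_funM; apply: dnoise_meas.
apply: (@measurableT_comp _ _ _ _ _ _ (\1_(seg n) : R -> R) _ (fun p : X * R => p.2)).
  by apply: measurable_indic; exact: mseg.
exact: measurable_snd.
Qed.

Let integrand_ge0 K x a n p : 0 < K -> (0 <= integrand K x a n p)%E.
Proof.
move=> K0; have K4 : 0 < 4 * K by rewrite mulr_gt0.
by rewrite lee_fin mulr_ge0// divr_ge0 ?sqr_ge0// ltW.
Qed.

Let excess_meas K x a n : 0 < K -> measurable_fun [set: X] (excess K x a n).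
Proof.
move=> K0; rewrite (_ : excess K x a n = fun z =>
    ((n.+1%:R)%R%:E * \int[mu]_t integrand K x a n (z, t))%E); last first.
  by apply/funext => z; exact: excessE.
apply: emeasurable_funM; first exact: measurable_cst.
apply: (measurable_fun_fubini_tonelli_F (m2 := mu) _ (@integrand_meas K x a n)).
by move=> p; exact: integrand_ge0.
Qed.

(** Tonelli exchanges sample and position on the segment; the variance bound then applies at each
    position, uniformly in n. *)
Let excess_mean K x a n : 0 < K ->
  (\int[D]_z excess K x a n z <= (sigma ^+ 2 / (4 * K))%R%:E)%E.
Proof.
move=> K0; have K4 : 0 < 4 * K by rewrite mulr_gt0.
pose A := seg n; pose h := integrand K x a n.
have mh : measurable_fun [set: X * R] h by exact: integrand_meas.
have h0 p : (0 <= h p)%E by exact: integrand_ge0.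
under eq_integral do rewrite excessE -/h.
rewrite ge0_integralZl//; last 2 first.
- exact: (measurable_fun_fubini_tonelli_F (m2 := mu) h mh h0).
- by move=> z _; apply: integral_ge0.
rewrite (fubini_tonelli (m1 := D) (m2 := mu) h mh h0).
have -> : (sigma ^+ 2 / (4 * K))%R%:E =
    ((n.+1%:R)%R%:E * \int[mu]_(t in A) (sigma ^+ 2 / (4 * K))%R%:E)%E.
  by rewrite (integral_cst mu (mseg n)) /= mu_seg -!EFinM mulrCA divff ?mulr1.
apply: lee_wpmul2l; first by rewrite lee_fin.
rewrite [leRHS]integral_mkcond; apply: ge0_le_integral => //.
- by move=> t _; apply: integral_ge0.
- exact: (measurable_fun_fubini_tonelli_G (m1 := D) h mh h0).
- by apply/(measurable_restrictT _ _).1; first exact: mseg.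
move=> t _; rewrite /h /integrand /patch /= indicE -/A.
case: (t \in A) => /=; last first.
  by under eq_integral do rewrite mulr0; rewrite integral0.
under eq_integral do rewrite mulr1 mulrC EFinM.
rewrite ge0_integralZl//; last 3 first.
- apply/measurable_EFinP; under eq_fun do rewrite expr2.
  by apply: measurable_funM; apply: dnoise_meas => //; exact: measurable_cst.
- by move=> z _; rewrite lee_fin sqr_ge0.
- by rewrite lee_fin invr_ge0 ltW.
rewrite [leRHS](_ : _ = ((4 * K)^-1)%R%:E * (sigma ^+ 2)%:E)%E.
  apply: lee_wpmul2l; first by rewrite lee_fin invr_ge0 ltW.
  exact: noise_coord_var.
by rewrite -EFinM mulrC.
Qed.

(* The quotients [quot x a n] have mean 0 and tend to the noise, but need not be
   dominated: by [quot_bound] their part above a level K is controlled by an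
   average of squared noise along a segment, of mean O(1 / K). *)
Lemma Ex_noise x a : Ex D (fun z => noise x z 0 a) = 0.
Proof.
pose N z := noise x z 0 a; rewrite -/N.
have N2 : L2 D N by exact: noise_L2.
have mN : measurable_fun [set: X] N by exact: L2_meas N2.
suff bnd K : 0 < K -> `|Ex D N| <= sigma ^+ 2 / (2 * K).
  apply/eqP; rewrite -normr_le0; apply/ler_addgt0Pr => e e0; rewrite add0r.
  have s0 : 0 <= sigma ^+ 2 by exact: sqr_ge0.
  (* This K turns the bound into e sigma^2 / (sigma^2 + 1), which is at most e; the added 1 covers
     sigma = 0. *)
  have K0 : 0 < (sigma ^+ 2 + 1) / (2 * e) by rewrite divr_gt0 ?mulr_gt0// ltr_wpDl.
  apply: le_trans (bnd _ K0) _.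
  have -> : sigma ^+ 2 / (2 * ((sigma ^+ 2 + 1) / (2 * e))) =
      e * (sigma ^+ 2 / (sigma ^+ 2 + 1)).
    by field; rewrite !gt_eqF// ltr_wpDl.
  by rewrite ler_piMr ?(ltW e0)// ler_pdivrMr ?ltr_wpDl// mul1r lerDl.
move=> K0; have K4 : 0 < 4 * K by rewrite mulr_gt0.
pose Y n z := `|N z - quot x a n z|.
(* The noise and the quotient are each at most K plus a term of mean at most sigma^2 / (4 K). Hence
   the cut at 2 K, the final bound sigma^2 / (2 K), and a bounded remainder [m n] to which dominated
   convergence applies. *)
pose m n z := Num.min (Y n z) (2 * K).
have mY n : measurable_fun [set: X] (Y n).
  apply: measurableT_comp => //; apply: measurable_funB => //.
  exact: L1_meas (quot_L1 x a n).
have mm n : measurable_fun [set: X] (m n).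
  by apply: measurable_minr => //; exact: measurable_cst.
have m0 n z : 0 <= m n z by rewrite le_min normr_ge0/= mulr_ge0// ltW.
have m2K n z : m n z <= 2 * K by rewrite ge_min lexx orbT.
have mL n : L1 D (m n).
  by apply: (L1_le (mm n) _ (L1_cst D (2 * K))) => z; rewrite ger0_norm.
have IE V : L1 D V -> (\int[D]_z (V z)%:E = (Ex D V)%:E)%E.
  by move=> /L1_expectation <-; rewrite unlock.
have YL n : L1 D (Y n).
  exact: (integrable_norm (L1B (L2_L1 N2) (quot_L1 x a n))).
have excess_ge0 n z : (0 <= excess K x a n z)%E.
  rewrite mule_ge0// integral_ge0// => t _.
  by rewrite lee_fin divr_ge0 ?sqr_ge0// ltW.
have Y_le n z : ((Y n z)%:E <= (m n z)%:E + (excess K x a n z + (N z ^+ 2 / (4 * K))%R%:E))%E.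
  have := quot_bound x a n z K0; have := excess_ge0 n z.
  case: (excess K x a n z) => [v| |//]; last first.
    by move=> _ _; rewrite addye// addey// leey.
  rewrite -!EFinD !lee_fin => v0 qv.
  have N4 : `|N z| <= K + N z ^+ 2 / (4 * K).
    rewrite -lerBlDl ler_pdivlMr//; have := sqr_ge0 (`|N z| - 2 * K).
    by rewrite -[N z ^+ 2]real_normK ?num_real//; set u := `|_|; rewrite !expr2; lra.
  have N0 : 0 <= N z ^+ 2 / (4 * K) by rewrite divr_ge0 ?sqr_ge0// ltW.
  have := ler_normB (N z) (quot x a n z); rewrite -/(Y n z) /m.
  by case: (leP (Y n z) (2 * K)) => _; lra.
have step n : `|Ex D N| - sigma ^+ 2 / (2 * K) <= Ex D (m n).
  rewrite lerBlDr; apply: (@le_trans _ _ (Ex D (Y n))).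
    rewrite -[Ex D N]subr0 -(Ex_quot x a n) -ExB//; last exact: L2_L1.
    apply: le_normr_Rintegral => //; exact: (L1B (L2_L1 N2) (quot_L1 x a n)).
  rewrite -lee_fin -(IE _ (YL n)).
  have mNK : measurable_fun [set: X] (fun z => N z ^+ 2 / (4 * K)).
    apply: measurable_funM; last exact: measurable_cst.
    by under eq_fun do rewrite expr2; exact: measurable_funM.
  have NK0 z : 0 <= N z ^+ 2 / (4 * K) by rewrite divr_ge0 ?sqr_ge0// ltW.
  apply: (@le_trans _ _ (\int[D]_z ((m n z)%:E +
      (excess K x a n z + (N z ^+ 2 / (4 * K))%R%:E)))%E).
    apply: ge0_le_integral => //.
    - by move=> z _; rewrite lee_fin normr_ge0.
    - by apply/measurable_EFinP; exact: mY.
    - apply: emeasurable_funD; first by apply/measurable_EFinP; exact: mm.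
      by apply: emeasurable_funD; [exact: excess_meas|exact/measurable_EFinP].
  rewrite ge0_integralD//; last 4 first.
  - by move=> z _; rewrite lee_fin.
  - by apply/measurable_EFinP; exact: mm.
  - by move=> z _; rewrite adde_ge0// lee_fin.
  - by apply: emeasurable_funD; [exact: excess_meas|exact/measurable_EFinP].
  rewrite ge0_integralD//; last 3 first.
  - exact: excess_meas.
  - by move=> z _; rewrite lee_fin.
  - exact/measurable_EFinP.
  rewrite IE// EFinD; apply: leeD => //.
  have -> : sigma ^+ 2 / (2 * K) = sigma ^+ 2 / (4 * K) + sigma ^+ 2 / (4 * K).
    by field; rewrite gt_eqF.
  rewrite EFinD; apply: leeD; first exact: excess_mean.
  under eq_integral do rewrite mulrC EFinM.
  rewrite ge0_integralZl//; last 3 first.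
  - by apply/measurable_EFinP; under eq_fun do rewrite expr2; exact: measurable_funM.
  - by move=> z _; rewrite lee_fin sqr_ge0.
  - by rewrite lee_fin invr_ge0 ltW.
  rewrite [leRHS](_ : _ = ((4 * K)^-1)%R%:E * (sigma ^+ 2)%:E)%E.
    apply: lee_wpmul2l; first by rewrite lee_fin invr_ge0 ltW.
    exact: noise_coord_var.
  by rewrite -EFinM mulrC.
have m_cvg : Ex D (m n) @[n --> \oo] --> 0.
  apply: (@fine_cvg _ _ _ _ (fun n => \int[D]_z (m n z)%:E)%E).
  rewrite -[X in _ --> X](integral0 D [set: X]).
  apply: (@dominated_cvg _ _ _ D _ measurableT (fun n z => (m n z)%:E)
    (cst 0%E) (fun=> (2 * K)%:E)) => //.
  - by move=> n; apply/measurable_EFinP; exact: mm.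
  - move=> z _; apply: cvg_EFin; first exact: nearW.
    have Y0 : Y n z @[n --> \oo] --> 0.
      rewrite -[X in _ --> X](normr0 R) -[X in `|X|](subrr (N z)).
      by apply: cvg_norm; apply: cvgB; [exact: cvg_cst|exact: quot_cvg].
    apply: (squeeze_cvgr _ (cvg_cst 0) Y0); apply: nearW => n /=.
    by rewrite m0/= ge_min lexx.
  - exact: L1_cst.
  - by move=> n z _ /=; rewrite lee_fin ger0_norm.
rewrite -subr_le0 leNgt; apply/negP => d0.
have /cvgrPdist_lt /(_ _ d0)[n _ /(_ n (leqnn n))] := m_cvg.
by rewrite sub0r normrN ger0_norm ?Ex_ge0// ltNge step.
Qed.

End unbiased.

(** * Independence of the samples *)

Section independence.
Variables (R : realType) (dO dX : measure_display).
Variables (Omega : measurableType dO) (X : measurableType dX).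
Variables (P : probability Omega R) (D : probability X R) (Z : Omega -> X).
Hypothesis mZ : measurable_fun [set: Omega] Z.
Hypothesis Z_law : forall C, measurable C -> P (Z @^-1` C) = D C.
Variable G : set (set Omega).
Hypothesis G_meas : G `<=` measurable.
Hypothesis G_setI : setI_closed G.
Hypothesis G_T : G [set: Omega].
Hypothesis G_indep : forall B C, G B -> measurable C ->
  P (B `&` Z @^-1` C) = (P B * P (Z @^-1` C))%E.

(** The space Omega with the coarser sigma-algebra generated by G, the events of the past. *)
Let OG : measurableType _ := g_sigma_algebraType G.

Let mZC C : measurable C -> measurable (Z @^-1` C).
Proof. by move=> mC; rewrite -[X in measurable X]setTI; exact: mZ. Qed.

Lemma sub_sigma_measurable : <<s G >> `<=` @measurable _ Omega.
Proof.
apply: smallest_sub => //; split; [exact: measurable0|move=> A mA|].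
  by rewrite setTD; exact: measurableC.
by move=> F mF; exact: bigcupT_measurable.
Qed.

Lemma measurable_id_sigma : measurable_fun [set: Omega] (fun w => w : OG).
Proof. by move=> _ B mB; rewrite setTI; exact: sub_sigma_measurable. Qed.

(** As functions of B both sides are finite measures that agree on the pi-system G. *)
Let sigma_indep B C : <<s G >> B -> measurable C ->
  P (B `&` Z @^-1` C) = (P B * D C)%E.
Proof.
move=> sB mC; have mE := mZC mC.
have r0 : (0 <= fine (D C))%R by rewrite fine_ge0.
have := @g_sigma_algebra_measure_unique _ _ _ G G_meas (fun=> setT) (fun=> G_T) _
  (mrestr P mE) (mscale (NngNum r0) P) G_setI _ _ B sB.
rewrite /= /mrestr /mscale /= => -> //.
- by rewrite fineK ?fin_num_measure// muleC.
- by rewrite bigcup_const.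
- by move=> A GA; rewrite G_indep// Z_law// fineK ?fin_num_measure// muleC.
- by move=> _; rewrite setTI; apply: (le_lt_trans (probability_le1 P mE)); rewrite ltry.
Qed.

Let pair_mfun : measurable_fun [set: Omega] (fun w => (w : OG, Z w)).
Proof. by apply: measurable_fun_pair => //; exact: measurable_id_sigma. Qed.

(** The joint law of the past and of the fresh sample is a product measure, so the fresh sample can
    be integrated out with the past frozen. This plays the part of conditioning on the past. *)
Lemma tonelli_indep (h : OG * X -> \bar R) :
  measurable_fun [set: OG * X] h -> (forall p, 0 <= h p)%E ->
  (\int[P]_w h (w, Z w) = \int[P]_w \int[D]_z h (w, z))%E.
Proof.
move=> mh h0.
pose idM := isMeasurableFun.Build _ _ _ _ _ measurable_id_sigma.
pose idG : {mfun Omega >-> OG} := HB.pack (fun w : Omega => w : OG) idM.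
pose phM := isMeasurableFun.Build _ _ _ _ _ pair_mfun.
pose phi : {mfun Omega >-> (OG * X)%type} := HB.pack (fun w : Omega => (w : OG, Z w)) phM.
have e1 := @ge0_integral_distribution _ _ _ _ _ P phi h mh h0.
have e2 := @ge0_integral_distribution _ _ _ _ _ P idG (fun w => \int[D]_z h (w, z))%E.
rewrite -[LHS]e1 -[RHS]e2; last 2 first.
- exact: (measurable_fun_fubini_tonelli_F (m2 := D) h mh h0).
- by move=> w; exact: integral_ge0.
rewrite -(fubini_tonelli1 (m1 := distribution P idG) (m2 := D) h mh h0).
apply: eq_measure_integral => A mA _; apply/esym.
by apply: product_measure_unique => // B C mB mC; rewrite -sigma_indep.
Qed.

Lemma measurable_sigma (U : OG -> R) : measurable_fun [set: OG] U ->
  measurable_fun [set: Omega] (U : Omega -> R).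
Proof.
by move=> mU; exact: (measurableT_comp mU measurable_id_sigma).
Qed.

Variables (d : nat) (F : 'rV[R]_d -> X -> R) (f : 'rV[R]_d -> R) (sigma : R).
Hypothesis F_diff : forall z x, differentiable (F ^~ z) x.
Hypothesis F_int : forall x, D.-integrable [set: X] (EFin \o F x).
Hypothesis F_mean : forall x, ('E_D[F x] = (f x)%:E)%E.
Hypothesis f_diff : forall x, differentiable f x.
Hypothesis F_var : forall x, ('E_D[fun z => (enorm (grad (F ^~ z) x - grad f x) ^+ 2)%R]
  <= (sigma ^+ 2)%:E)%E.

Variable y : OG -> 'rV[R]_d.
Hypothesis my : forall j, measurable_fun [set: OG] (fun w => y w 0 j).

Let my' j : measurable_fun [set: Omega] (fun w => y w 0 j).
Proof. exact: measurable_sigma. Qed.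

Let F_meas x : measurable_fun [set: X] (F x).
Proof. exact: (L1_meas (F_int x)). Qed.

Let my1 j : measurable_fun [set: OG * X] (fun p => y p.1 0 j).
Proof. exact: (measurableT_comp (my j) measurable_fst). Qed.

Lemma noise_process_var :
  (\int[P]_w (sqn (noise F f (y w) (Z w)))%:E <= (sigma ^+ 2)%:E)%E.
Proof.
rewrite (@tonelli_indep (fun p => (sqn (noise F f (y p.1) p.2))%:E)) /=; last 2 first.
- by apply/measurable_EFinP; apply: measurable_sqn_noise.
- by move=> p; rewrite lee_fin sqn_ge0.
apply: (@le_trans _ _ (\int[P]_w (sigma ^+ 2)%:E)%E); last first.
  by rewrite integral_cst//= probability_setT mule1.
apply: ge0_le_integral => //.
- by move=> w _; apply: integral_ge0 => z _; rewrite lee_fin sqn_ge0.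
- have mG : measurable_fun [set: OG] (fun w : OG => \int[D]_z (sqn (noise F f (y w) z))%:E)%E.
    apply: (measurable_fun_fubini_tonelli_F (m2 := D) (fun p => (sqn (noise F f (y p.1) p.2))%:E)).
      by apply/measurable_EFinP; apply: measurable_sqn_noise.
    by move=> p; rewrite lee_fin sqn_ge0.
  exact: (measurableT_comp mG measurable_id_sigma).
- by move=> w _; exact: (noise_var F_var).
Qed.

Lemma noise_process_L1 : L1 P (fun w => sqn (noise F f (y w) (Z w))).
Proof.
apply: L1_ge0; [by apply: measurable_sqn_noise|by move=> w; exact: sqn_ge0|].
by apply: le_lt_trans noise_process_var _; rewrite ltry.
Qed.

Lemma noise_process_Ex : Ex P (fun w => sqn (noise F f (y w) (Z w))) <= sigma ^+ 2.
Proof.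
rewrite -lee_fin -(L1_expectation noise_process_L1) unlock.
exact: noise_process_var.
Qed.

Lemma noise_process_L2 a : L2 P (fun w => noise F f (y w) (Z w) 0 a).
Proof.
apply: L2_le noise_process_L1; first by apply: measurable_noise.
move=> w; rewrite /sqn (bigD1 a)//= lerDl sumr_ge0// => j _; exact: sqr_ge0.
Qed.

Let posneg (v : R) : v = Num.max v 0 - Num.max (- v) 0.
Proof. by case: (leP v 0) => h; case: (leP (- v) 0) => h'; lra. Qed.

Let L1_max (dT : measure_display) (T : measurableType dT) (Q : probability T R)
  (V : T -> R) : L1 Q V -> L1 Q (fun w => Num.max (V w) 0).
Proof.
move=> LV; apply: (L1_le _ _ (integrable_norm LV)).
  by apply: measurable_maxr; [exact: L1_meas LV|exact: measurable_cst].
by move=> w /=; rewrite ger0_norm ?le_max ?lexx ?orbT// ge_max ler_norm normr_ge0.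
Qed.

Let Ex_posneg (dT : measure_display) (T : measurableType dT) (Q : probability T R)
  (V : T -> R) : L1 Q V ->
  Ex Q V = Ex Q (fun w => Num.max (V w) 0) - Ex Q (fun w => Num.max (- V w) 0).
Proof.
move=> LV; rewrite -ExB; [|exact: L1_max|by apply: L1_max; exact: L1N].
by congr (Ex Q _); apply/funext => w; exact: posneg.
Qed.

Let Ex_integral (dT : measure_display) (T : measurableType dT) (Q : probability T R)
  (V : T -> R) : L1 Q V -> (\int[Q]_w (V w)%:E = (Ex Q V)%:E)%E.
Proof. by move=> /L1_expectation <-; rewrite unlock. Qed.

(** For a frozen past w the inner mean is U w times the mean of the noise, which is 0 by [Ex_noise].
    The Tonelli formula being for nonnegative functions, it is applied to the positive and negative
    parts separately. *)
Lemma noise_process_orth (U : OG -> R) a :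
  measurable_fun [set: OG] U -> L2 P U ->
  Ex P (fun w => U w * noise F f (y w) (Z w) 0 a) = 0.
Proof.
move=> mU U2.
pose V (p : OG * X) : R := U p.1 * noise F f (y p.1) p.2 0 a.
have mV : measurable_fun [set: OG * X] V.
  apply: measurable_funM; first exact: (measurableT_comp mU measurable_fst).
  by apply: measurable_noise.
have LV : L1 P (fun w => V (w, Z w)) by exact: (L2_mul U2 (noise_process_L2 a)).
have Vz w : L1 D (fun z => V (w, z)).
  apply: (@L1Z _ _ _ D (U w) (fun z => noise F f (y w) z 0 a)).
  by apply: L2_L1; exact: (noise_L2 F_diff F_int f_diff F_var).
have Vz0 w : Ex D (fun z => V (w, z)) = 0.
  rewrite /V /= ExZ; first by rewrite (Ex_noise F_diff F_int F_mean f_diff F_var) mulr0.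
  by apply: L2_L1; exact: (noise_L2 F_diff F_int f_diff F_var).
have tonelli (g : R -> R) : (forall v, 0 <= g v) -> measurable_fun [set: R] g ->
    (\int[P]_w (g (V (w, Z w)))%:E = \int[P]_w \int[D]_z (g (V (w, z)))%:E)%E.
  move=> g0 mg; apply: (@tonelli_indep (fun p => (g (V p))%:E)) => [|p].
    by apply/measurable_EFinP; exact: measurableT_comp.
  by rewrite lee_fin.
rewrite (Ex_posneg LV); apply/eqP; rewrite subr_eq0; apply/eqP/EFin_inj.
rewrite -!Ex_integral; [|by apply: L1_max; exact: L1N|exact: L1_max].
rewrite (tonelli (fun v => Num.max v 0)); last 2 first.
- by move=> v; rewrite le_max lexx orbT.
- by apply: measurable_maxr => //; exact: measurable_cst.
rewrite (tonelli (fun v => Num.max (- v) 0)); last 2 first.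
- by move=> v; rewrite le_max lexx orbT.
- by apply: measurable_maxr; [exact: oppr_measurable|exact: measurable_cst].
apply: eq_integral => w _.
rewrite !Ex_integral; [|by apply: L1_max; exact: L1N|exact: L1_max].
congr EFin; apply/eqP; rewrite -subr_eq0 -Ex_posneg//; apply/eqP; exact: Vz0.
Qed.

End independence.

Section samples.
Variables (R : realType) (n : nat) (dO dX : measure_display).
Variables (Omega : measurableType dO) (X : measurableType dX).
Variables (P : probability Omega R) (D : 'I_n -> probability X R).
Variable xi : 'I_n -> nat -> Omega -> X.
Hypothesis hxi : independent_samples P D xi.

Notation index := ('I_n * nat)%type.

Let Y (i : index) := xi i.1 i.2.

(* The pi-system generating the sigma-algebra of the samples with index in A. *)
Definition cylinders (A : pred index) : set (set Omega) :=
  [set B | exists (s : seq index) (C : index -> set X),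
    [/\ uniq s, all A s, forall i, measurable (C i)
      & B = \bigcap_(i in [set` s]) (Y i @^-1` C i)]].

Let mY i : measurable_fun [set: Omega] (Y i).
Proof. by case: hxi => h _ _; exact: h. Qed.

Let mYC i C : measurable C -> measurable (Y i @^-1` C).
Proof. by move=> mC; rewrite -[X in measurable X]setTI; exact: mY. Qed.

Lemma cylinders_measurable A : cylinders A `<=` measurable.
Proof.
move=> B [s [C [_ _ mC ->]]]; apply: fin_bigcap_measurable.
  exact: finite_seq.
by move=> i _; exact: mYC.
Qed.

Lemma cylinders_setI A : setI_closed (cylinders A).
Proof.
move=> B B' [s [C [us sA mC ->]]] [s' [C' [us' sA' mC' ->]]].
(* An index missing from one of the lists is left unconstrained by that list, through the value
   [setT]. *)
pose E (t : seq index) (K : index -> set X) i := if i \in t then K i else setT.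
exists (undup (s ++ s')), (fun i => E s C i `&` E s' C' i); split.
- exact: undup_uniq.
- apply/allP => i; rewrite mem_undup mem_cat => /orP[].
    exact: (allP sA).
  exact: (allP sA').
- by move=> i; apply: measurableI; rewrite /E; case: ifP.
apply/seteqP; split=> [w [h h'] i /=|w h].
  rewrite mem_undup mem_cat /E => _; split.
    by case: ifP => // /h.
  by case: ifP => // /h'.
split=> i /= si; have := h i; rewrite /= mem_undup mem_cat si ?orbT => /(_ isT)[].
  by rewrite /E si.
by rewrite /E si.
Qed.

Lemma cylindersT A : cylinders A [set: Omega].
Proof.
exists [::], (fun=> setT); split => //.
by apply/seteqP; split.
Qed.

Lemma cylinders_indep (A : pred index) j B C : ~~ A j -> cylinders A B ->
  measurable C -> P (B `&` Y j @^-1` C) = (P B * P (Y j @^-1` C))%E.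
Proof.
move=> Aj [s [K [us sA mK ->]]] mC.
have js : j \notin s by apply: contra Aj; exact: (allP sA).
have [_ _ ind] := hxi.
pose K' i := if i == j then C else K i.
have mK' i : measurable (K' i) by rewrite /K'; case: ifP.
have := ind (j :: s) K'; rewrite /= js us => /(_ isT mK').
rewrite big_cons /K' eqxx (eq_big_seq (fun i => P (Y i @^-1` K i))); last first.
  by move=> i si; case: eqP => // ij; move: js; rewrite -ij si.
rewrite -(ind s K us mK) muleC => <-; congr (P _).
apply/seteqP; split=> [w [h hj] i /=|w h].
  rewrite inE => /predU1P[->|si]; first by rewrite eqxx.
  by case: eqP => [->//|_]; exact: h.
split=> [i si|]; last by have := h j; rewrite /= eqxx mem_head; apply.
have := h i; rewrite /= inE si orbT => /(_ isT); case: eqP => // ij.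
by move: js; rewrite -ij si.
Qed.

Lemma sample_law j r C : measurable C -> P (xi j r @^-1` C) = D j C.
Proof. by case: hxi => _ + _; apply. Qed.

Lemma measurable_sample (A : pred index) i : A i ->
  measurable_fun [set: g_sigma_algebraType (cylinders A)]
    (Y i : g_sigma_algebraType (cylinders A) -> X).
Proof.
move=> Ai _ C mC; rewrite setTI; apply: sub_sigma_algebra.
exists [:: i], (fun=> C); split=> //=; first by rewrite Ai.
apply/seteqP; split=> [w Cw j /=|w h].
  by rewrite inE => /eqP ->.
by apply: (h i); rewrite /= mem_head.
Qed.

Variables (d : nat) (S : seq 'M[R]_n) (eta : R) (F : 'I_n -> 'rV[R]_d -> X -> R).
Variable x0 : 'I_n -> 'rV[R]_d.
Hypothesis F_diff : forall i z x, differentiable (F i ^~ z) x.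
Hypothesis F_int : forall i x, (D i).-integrable [set: X] (EFin \o F i x).

(** The iterate at round r is a function of the samples of rounds before r only, so it is measurable
    for any sigma-algebra containing these. *)
Lemma measurable_dsgd (A : pred index) r i a :
  (forall j s, (s < r)%N -> A (j, s)) ->
  measurable_fun [set: g_sigma_algebraType (cylinders A)]
    (fun w : g_sigma_algebraType (cylinders A) => dsgd S eta F xi x0 r w i 0 a).
Proof.
elim: r i a => [|r IH] i a hA /=; first exact: measurable_cst.
under eq_fun do rewrite summxE.
apply: measurable_sum => j; under eq_fun do rewrite !mxE.
apply: measurable_funM; first exact: measurable_cst.
have hA' j' s : (s < r)%N -> A (j', s) by move=> sr; apply: hA; exact: ltnW.
apply: measurable_funB; first exact: IH.
apply: measurable_funM; first exact: measurable_cst.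
have mF x : measurable_fun [set: X] (F j x) := L1_meas (F_int j x).
have := measurable_grad (F_diff j) mF a (fun b => IH j b hA')
  (measurable_sample (hA j r (ltnSn r))).
by under eq_fun do rewrite mxE.
Qed.

Variables (f : 'I_n -> 'rV[R]_d -> R) (sigma : R).
Hypothesis F_mean : forall i x, ('E_(D i)[F i x] = (f i x)%:E)%E.
Hypothesis f_diff : forall i x, differentiable (f i) x.
Hypothesis F_var : forall i x,
  ('E_(D i)[fun z => (enorm (grad (F i ^~ z) x - grad (f i) x) ^+ 2)%R]
    <= (sigma ^+ 2)%:E)%E.

Definition gnoise j r w : 'rV[R]_d :=
  noise (F j) (f j) (dsgd S eta F xi x0 r w j) (xi j r w).

(** The samples of the other nodes in the same round r count as past for (j, r); this yields
    orthogonality across nodes as well as across rounds. *)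
Let past j r : pred index := [pred i | (i.2 < r)%N || (i.2 == r) && (i.1 != j)].

Let past_lt j r j' s : (s < r)%N -> past j r (j', s).
Proof. by rewrite /past /= => ->. Qed.

Let past_self j r : ~~ past j r (j, r).
Proof. by rewrite /past /= ltnn !eqxx. Qed.

Let past_dsgd j r i a : measurable_fun [set: g_sigma_algebraType (cylinders (past j r))]
  (fun w : g_sigma_algebraType (cylinders (past j r)) => dsgd S eta F xi x0 r w i 0 a).
Proof. by apply: measurable_dsgd => *; exact: past_lt. Qed.

Let indep_past j r B C : cylinders (past j r) B -> measurable C ->
  P (B `&` xi j r @^-1` C) = (P B * P (xi j r @^-1` C))%E.
Proof. by move=> hB mC; exact: (cylinders_indep (past_self j r) hB mC). Qed.

Lemma gnoise_Ex j r : Ex P (fun w => sqn (gnoise j r w)) <= sigma ^+ 2.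
Proof.
exact: (noise_process_Ex (mY (j, r)) (sample_law j r) (@cylinders_measurable (past j r))
  (@cylinders_setI _) (@cylindersT _) (@indep_past j r) (F_diff j) (F_int j)
  (f_diff j) (F_var j) (@past_dsgd j r j)).
Qed.

Lemma gnoise_L2 j r a : L2 P (fun w => gnoise j r w 0 a).
Proof.
exact: (noise_process_L2 (mY (j, r)) (sample_law j r) (@cylinders_measurable (past j r))
  (@cylinders_setI _) (@cylindersT _) (@indep_past j r) (F_diff j) (F_int j)
  (f_diff j) (F_var j) (@past_dsgd j r j)).
Qed.

Let gnoise_orth_past j r (U : Omega -> R) a :
  measurable_fun [set: g_sigma_algebraType (cylinders (past j r))]
    (U : g_sigma_algebraType (cylinders (past j r)) -> R) -> L2 P U ->
  Ex P (fun w => U w * gnoise j r w 0 a) = 0.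
Proof.
exact: (noise_process_orth (mY (j, r)) (sample_law j r) (@cylinders_measurable (past j r))
  (@cylinders_setI _) (@cylindersT _) (@indep_past j r) (F_diff j) (F_int j)
  (F_mean j) (f_diff j) (F_var j) (@past_dsgd j r j)).
Qed.

(** Any functional of the current iterates belongs to the past. Its measurability is asked along
    measurable families [y], so that it can be read on the sigma-algebra of the past. *)
Lemma gnoise_orth_state j r a (U : ('I_n -> 'rV[R]_d) -> R) :
  (forall (T : measurableType (sigma_display (cylinders (past j r))))
       (y : T -> 'I_n -> 'rV[R]_d),
     (forall i b, measurable_fun [set: T] (fun w => y w i 0 b)) ->
     measurable_fun [set: T] (fun w => U (y w))) ->
  L2 P (fun w => U (dsgd S eta F xi x0 r w)) ->
  Ex P (fun w => U (dsgd S eta F xi x0 r w) * gnoise j r w 0 a) = 0.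
Proof.
move=> mU U2; apply: gnoise_orth_past => //.
exact: (mU _ (fun w : g_sigma_algebraType (cylinders (past j r)) =>
  dsgd S eta F xi x0 r w) (@past_dsgd j r)).
Qed.

(** The noise at p only involves samples in the past of q when q is not earlier, so it takes the
    place of U. *)
Let gnoise_orth_le (p q : index) a : p != q -> (p.2 <= q.2)%N ->
  Ex P (fun w => gnoise p.1 p.2 w 0 a * gnoise q.1 q.2 w 0 a) = 0.
Proof.
case: p q => [i s] [j r] /= pq sr; apply: gnoise_orth_past; last exact: gnoise_L2.
have mF x : measurable_fun [set: X] (F i x) := L1_meas (F_int i x).
apply: (measurable_noise (F_diff i) (F_int i) (f_diff i)).
  by move=> b; apply: measurable_dsgd => j' s' s's; apply: past_lt; exact: leq_trans s's sr.
apply: (@measurable_sample (past j r) (i, s)).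
rewrite /past /=; move: sr; rewrite leq_eqVlt => /orP[/eqP sr|->//].
rewrite sr eqxx ltnn /=; apply: contraNneq pq => ij.
by rewrite ij sr.
Qed.

Lemma gnoise_orth (p q : index) a : p != q ->
  Ex P (fun w => gnoise p.1 p.2 w 0 a * gnoise q.1 q.2 w 0 a) = 0.
Proof.
move=> pq; case: (leqP p.2 q.2) => [|/ltnW] h; first exact: gnoise_orth_le.
under eq_fun do rewrite mulrC.
by apply: gnoise_orth_le => //; rewrite eq_sym.
Qed.

End samples.

(** * Convergence of DSGD *)

Section deviation_bounds.
Variables (R : realType) (n : nat).
Hypothesis n_gt0 : (0 < n)%N.

(** Both W and the averaging matrix J fix C, so (W - J) Y = W (I - J) (Y - C), and neither factor
    increases the norm. C is free to be any matrix with equal rows. *)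
Lemma fro2_dstoch_dev d (W : 'M[R]_n) (Y C : 'M[R]_(n, d)) : dstoch W ->
  (forall i j a, C i a = C j a) ->
  fro2 ((W - Jmx R n) *m Y) <= fro2 (Y - C).
Proof.
move=> hW hC; have hJ := dstochJ R n_gt0.
have -> : (W - Jmx R n) *m Y = W *m ((Y - C) - Jmx R n *m (Y - C)).
  rewrite mulmxBl !mulmxBr mulmxA (dstoch_mulJ hW) mulmxA (dstoch_mulJ hW).
  by rewrite (dstoch_const hW hC) (dstoch_const hJ hC) opprB addrA subrK.
exact: le_trans (fro2_dstoch _ hW) (fro2_dev _ _).
Qed.

(** The column is the image of a unit vector, so the previous bound with C = 0 applies. *)
Lemma dstoch_dev_col (W : 'M[R]_n) j : dstoch W ->
  \sum_i ((W - Jmx R n) i j) ^+ 2 <= 1.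
Proof.
move=> hW; pose e : 'cV[R]_n := delta_mx j 0.
have h : fro2 ((W - Jmx R n) *m e) <= fro2 (e - 0).
  by apply: fro2_dstoch_dev => // i i' a; rewrite !mxE.
have e1 : fro2 (e - 0) = 1.
  rewrite subr0 /fro2 (bigD1 j)//= big_ord1 !mxE !eqxx expr1n big1 ?addr0// => i ij.
  by rewrite big_ord1 mxE (negPf ij) expr0n.
rewrite -e1; apply: le_trans h; rewrite /fro2 le_eqVlt; apply/orP; left; apply/eqP.
apply: eq_bigr => i _; rewrite big_ord1; congr (_ ^+ 2).
rewrite [RHS]mxE (bigD1 j)//= [e j 0]mxE !eqxx mulr1 big1 ?addr0// => l lj.
by rewrite [e l 0]mxE (negPf lj) mulr0.
Qed.

End deviation_bounds.

Section dsgd_analysis.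
Variables (R : realType) (n d : nat) (dO dX : measure_display).
Variables (Omega : measurableType dO) (X : measurableType dX).
Variables (P : probability Omega R) (D : 'I_n -> probability X R).
Variable xi : 'I_n -> nat -> Omega -> X.
Hypothesis n_gt0 : (0 < n)%N.
Hypothesis hxi : independent_samples P D xi.
Variables (S : seq 'M[R]_n) (eta L sigma zeta fstar : R).
Variables (F : 'I_n -> 'rV[R]_d -> X -> R) (f : 'I_n -> 'rV[R]_d -> R).
Variables (f_avg : 'rV[R]_d -> R) (x0 : 'I_n -> 'rV[R]_d).
Hypothesis F_diff : forall i z x, differentiable (F i ^~ z) x.
Hypothesis F_int : forall i x, (D i).-integrable [set: X] (EFin \o F i x).
Hypothesis F_mean : forall i x, ('E_(D i)[F i x] = (f i x)%:E)%E.
Hypothesis F_var : forall i x,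
  ('E_(D i)[fun z => (enorm (grad (F i ^~ z) x - grad (f i) x) ^+ 2)%R]
    <= (sigma ^+ 2)%:E)%E.
Hypothesis f_avgE : forall x, f_avg x = n%:R^-1 * \sum_(i < n) f i x.
Hypothesis f_smooth : forall i, smooth2 L (f i).
Hypothesis f_lower : forall x, fstar <= f_avg x.
Hypothesis f_hetero : forall x,
  n%:R^-1 * \sum_(i < n) sqn (grad (f i) x - grad f_avg x) <= zeta ^+ 2.
Hypothesis x0_eq : forall i j, x0 i = x0 j.
Hypothesis S_gossip : {in S, forall E, gossip E}.
Hypothesis S_size : (0 < size S)%N.
Hypothesis S_avg : forall (x : 'I_n -> R) i, run S x i = n%:R^-1 * \sum_j x j.
Hypothesis L_gt0 : 0 < L.
Hypothesis eta_gt0 : 0 < eta.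

Notation m := (size S).

Let nR : n%:R != 0 :> R. Proof. by rewrite pnatr_eq0 -lt0n. Qed.

Let n_inv_sum : \sum_(i < n) n%:R^-1 = 1 :> R.
Proof. by rewrite sumr_const card_ord -[_ *+ _]mulr_natl divff. Qed.

Lemma avg_diff x : differentiable f_avg x.
Proof.
have -> : f_avg = fun y => n%:R^-1 * \sum_i f i y by apply/funext.
by apply: (grad_scale_sum _ (fun i => (f_smooth i).1 x)).1.
Qed.

Lemma grad_avg x : grad f_avg x = n%:R^-1 *: \sum_i grad (f i) x.
Proof.
have -> : f_avg = fun y => n%:R^-1 * \sum_i f i y by apply/funext.
exact: (grad_scale_sum _ (fun i => (f_smooth i).1 x)).2.
Qed.

Let avgE (u : 'I_n -> 'rV[R]_d) : n%:R^-1 *: \sum_i u i = \sum_i n%:R^-1 *: u i.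
Proof. by rewrite scaler_sumr. Qed.

Let sqn_avg (u : 'I_n -> 'rV[R]_d) :
  sqn (n%:R^-1 *: \sum_i u i) <= n%:R^-1 * \sum_i sqn (u i).
Proof.
rewrite avgE mulr_sumr; apply: sqn_avg_le => // i; by rewrite invr_ge0.
Qed.

Lemma avg_smooth : smooth2 L f_avg.
Proof.
split; first exact: avg_diff.
move=> x y; rewrite !grad_avg -scalerBr -sumrB; apply: le_trans (sqn_avg _) _.
rewrite ler_pdivrMl ?ltr0n// mulr_natl -[n in _ *+ n]card_ord -sumr_const.
by apply: ler_sum => i _; exact: (f_smooth i).2.
Qed.

Let x r w : 'I_n -> 'rV[R]_d := dsgd S eta F xi x0 r w.
Let N j r w := gnoise xi S eta F x0 f j r w.
Let gf j r w := grad (f j) (x r w j).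
Let xbar r w := average (x r w).

Let Xm r w : 'M[R]_(n, d) := \matrix_(i, a) x r w i 0 a.
Let Gf r w : 'M[R]_(n, d) := \matrix_(i, a) gf i r w 0 a.
Let Nm r w : 'M[R]_(n, d) := \matrix_(i, a) N i r w 0 a.

Let XmS r w : Xm r.+1 w = mix S r *m (Xm r w - eta *: (Gf r w + Nm r w)).
Proof.
apply/matrixP => i a; rewrite [LHS]mxE [LHS]summxE [RHS]mxE.
apply: eq_bigr => j _; rewrite [LHS]mxE; congr (_ * _); rewrite !mxE /N /gnoise /noise /gf ?mxE.
by congr (_ - _ * _); rewrite addrC subrK.
Qed.

Let Xm0 w i j a : Xm 0 w i a = Xm 0 w j a.
Proof. by rewrite !mxE /x /= (x0_eq i j). Qed.

Let JXm r w i a : (Jmx R n *m Xm r w) i a = xbar r w 0 a.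
Proof.
rewrite mulJmx mxE summxE; congr (_ * _).
by apply: eq_bigr => j _; rewrite mxE.
Qed.

Let dev r w := fro2 (Xm r w - Jmx R n *m Xm r w).

Let devE r w : dev r w = \sum_i sqn (x r w i - xbar r w).
Proof.
apply: eq_bigr => i _; apply: eq_bigr => a _; congr (_ ^+ 2).
by rewrite [LHS]mxE [X in _ + X]mxE JXm !mxE.
Qed.

Let ghat r w := n%:R^-1 *: \sum_i gf i r w.
Let nhat r w := n%:R^-1 *: \sum_i N i r w.

Let xbarS r w : xbar r.+1 w = xbar r w - eta *: (ghat r w + nhat r w).
Proof.
apply/rowP => a; pose i0 := Ordinal n_gt0.
rewrite -(JXm _ _ i0) XmS mulmxA (Jmul_dstoch (mix_dstoch S_gossip S_size r)).
rewrite mulmxBr -scalemxAr mxE JXm [X in _ + X]mxE [X in - X]mxE mulJmx.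
rewrite [RHS]mxE [X in _ = _ + X]mxE [X in _ = _ - X]mxE; congr (_ - _ * _).
rewrite /ghat /nhat -scalerDr -big_split /= [RHS]mxE summxE; congr (_ * _).
apply: eq_bigr => j _; rewrite [LHS]mxE [RHS]mxE.
by congr (_ + _); rewrite mxE.
Qed.

Let f_diff i y : differentiable (f i) y. Proof. exact: (f_smooth i).1. Qed.

Let N_L2 j r a : L2 P (fun w => N j r w 0 a).
Proof. exact: (gnoise_L2 hxi S eta x0 F_diff F_int f_diff F_var). Qed.

Let meas_grad (dT : measure_display) (T : measurableType dT)
    (g : 'rV[R]_d -> R) (y : T -> 'rV[R]_d) a :
  (forall x, differentiable g x) ->
  (forall j, measurable_fun [set: T] (fun t => y t 0 j)) ->
  measurable_fun [set: T] (fun t => grad g (y t) 0 a).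
Proof.
by move=> dg my; apply: (@measurable_grad _ _ _ T (fun x _ => g x) _ _ _ _ _ id).
Qed.

Let sqn_L1 (u : Omega -> 'rV[R]_d) : (forall a, L2 P (fun w => u w 0 a)) ->
  L1 P (fun w => sqn (u w)).
Proof. by move=> hu; apply: L1_sum => a; exact: L2_sqr. Qed.

Let coord_sqn (u : 'rV[R]_d) a : u 0 a ^+ 2 <= sqn u.
Proof. by rewrite /sqn (bigD1 a)//= lerDl sumr_ge0// => j _; exact: sqr_ge0. Qed.

(** A Lipschitz gradient grows at most linearly, so square integrability passes from the iterates to
    the gradients, and from there to the next iterates. *)
Let smooth_L2 (g : 'rV[R]_d -> R) (u : Omega -> 'rV[R]_d) a : smooth2 L g ->
  (forall a, L2 P (fun w => u w 0 a)) -> L2 P (fun w => grad g (u w) 0 a).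
Proof.
move=> [dg Lg] hu.
apply: (@L2_le _ _ _ _ _ (fun w => 2 * L ^+ 2 * sqn (u w) + 2 * sqn (grad g 0))).
- by apply: meas_grad => // j; exact: L2_meas (hu j).
- move=> w; apply: le_trans (coord_sqn _ _) _.
  have := sqnD_le (grad g (u w) - grad g 0) (grad g 0); rewrite subrK.
  by have := Lg (u w) 0; rewrite subr0; lra.
- by apply: L1D; [apply/L1Z/sqn_L1|exact: L1_cst].
Qed.

Let x_L2 r i a : L2 P (fun w => x r w i 0 a).
Proof.
elim: r i a => [|r IH] i a; first exact: L2_cst.
have -> : (fun w => x r.+1 w i 0 a) = (fun w => \sum_j mix S r i j *
    (x r w j 0 a - eta * (gf j r w 0 a + N j r w 0 a))).
  apply/funext => w; have := congr1 (fun M : 'M[R]_(n, d) => M i a) (XmS r w).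
  rewrite [LHS]mxE => ->; rewrite [LHS]mxE; apply: eq_bigr => j _.
  rewrite [X in _ * X]mxE [X in _ * (_ + X)]mxE [X in _ * (_ - X)]mxE.
  by rewrite [X in _ * (_ - _ * X)]mxE; congr (_ * (_ - _ * (_ + _))); rewrite mxE.
apply: L2_sum => j; apply/L2Z/L2B; first exact: IH.
apply/L2Z/L2D; last exact: N_L2.
by apply: smooth_L2 => // b; exact: IH.
Qed.

Let xbar_L2 r a : L2 P (fun w => xbar r w 0 a).
Proof.
rewrite /xbar /average; under eq_fun do rewrite mxE summxE.
by apply/L2Z/L2_sum => i; exact: x_L2.
Qed.

Let gf_L2 j r a : L2 P (fun w => gf j r w 0 a).
Proof. by apply: smooth_L2 => // b; exact: x_L2. Qed.

Let dev_L1 r : L1 P (dev r).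
Proof.
rewrite (_ : dev r = fun w => \sum_i sqn (x r w i - xbar r w)); last first.
  by apply/funext => w; exact: devE.
apply: L1_sum => i; apply: sqn_L1 => a; under eq_fun do rewrite mxE [X in _ + X]mxE.
exact: L2B.
Qed.

(** C has equal rows, which is what [fro2_dstoch_dev] allows to subtract. Passing through the
    gradient of f i at the mean splits the error into a smoothness part and the heterogeneity. *)
Let grad_dev r w (C : 'M[R]_(n, d) := \matrix_(i, a) grad f_avg (xbar r w) 0 a) :
  fro2 (Gf r w - C) <= 2 * L ^+ 2 * dev r w + 2 * n%:R * zeta ^+ 2.
Proof.
have -> : fro2 (Gf r w - C) = \sum_i sqn (gf i r w - grad f_avg (xbar r w)).
  apply: eq_bigr => i _; apply: eq_bigr => a _; congr (_ ^+ 2).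
  by rewrite [LHS]mxE [X in _ + X]mxE [RHS]mxE [X in _ = _ + X]mxE !(mxE matrix_key).
apply: (@le_trans _ _ (\sum_i (2 * (L ^+ 2 * sqn (x r w i - xbar r w)) +
    2 * sqn (grad (f i) (xbar r w) - grad f_avg (xbar r w))))).
  apply: ler_sum => i _.
  have := sqnD_le (gf i r w - grad (f i) (xbar r w))
    (grad (f i) (xbar r w) - grad f_avg (xbar r w)).
  by rewrite subrKA; have := (f_smooth i).2 (x r w i) (xbar r w); rewrite -/(gf i r w); lra.
rewrite big_split -!mulr_sumr /= devE; have := f_hetero (xbar r w).
by rewrite ler_pdivrMl ?ltr0n//; lra.
Qed.

Let Q s t := Qmx S s t.

Let grad_part r (t := minn r (2 * m)) (r0 := (r - t)%N) w :
  fro2 (\sum_(u < t) Q (r0 + u) (t - u) *m Gf (r0 + u) w) <=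
  t%:R * \sum_(u < t) (2 * L ^+ 2 * dev (r0 + u) w + 2 * n%:R * zeta ^+ 2).
Proof.
apply: le_trans (fro2_sum _) _; apply: ler_wpM2l => //; apply: ler_sum => u _.
apply: le_trans (grad_dev (r0 + u) w).
apply: fro2_dstoch_dev => // [|i j a]; last by rewrite !mxE.
exact: (phi_dstoch S_gossip S_size).
Qed.

(** Orthogonality over the pairs of round and node kills all cross terms, so t appears once here and
    twice in [grad_part]; the coefficients of each pair are a column covered by [dstoch_dev_col]. *)
Let noise_part r (t := minn r (2 * m)) (r0 := (r - t)%N)
    (V := fun w => fro2 (\sum_(u < t) Q (r0 + u) (t - u) *m Nm (r0 + u) w)) :
  L1 P V /\ Ex P V <= t%:R * (n%:R * sigma ^+ 2).
Proof.
pose c (i : 'I_n) (p : 'I_t * 'I_n) : R := Q (r0 + p.1) (t - p.1) i p.2.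
pose M (a : 'I_d) (p : 'I_t * 'I_n) w : R := N p.2 (r0 + p.1)%N w 0 a.
have VE : V = fun w => \sum_i \sum_a (\sum_p c i p * M a p w) ^+ 2.
  apply/funext => w; apply: eq_bigr => i _; apply: eq_bigr => a _; congr (_ ^+ 2).
  rewrite summxE; transitivity (\sum_(u < t) \sum_j c i (u, j) * M a (u, j) w).
    by apply: eq_bigr => u _; rewrite mxE; apply: eq_bigr => j _; rewrite [X in _ * X]mxE.
  by rewrite pair_bigA; apply: eq_bigr => -[u j] _.
have ML2 a p : L2 P (M a p) by exact: N_L2.
have Mo a p q : p != q -> Ex P (fun w => M a p w * M a q w) = 0.
  move=> pq; apply: (gnoise_orth hxi S eta x0 F_diff F_int F_mean f_diff F_var
    a (p := (p.2, (r0 + p.1)%N)) (q := (q.2, (r0 + q.1)%N))).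
  apply: contra_neq pq; case: p q => [u j] [u' j'] /= [-> /eqP].
  by rewrite eqn_add2l => /eqP/val_inj ->.
have L1a i a : L1 P (fun w => (\sum_p c i p * M a p w) ^+ 2).
  by apply/L2_sqr/L2_sum => p; exact: L2Z.
rewrite VE; split; first by apply: L1_sum => i; exact: L1_sum.
rewrite Ex_sum => [|i]; last exact: L1_sum.
under eq_bigr => i _ do rewrite Ex_sum//.
under eq_bigr => i _ do under eq_bigr => a _ do rewrite (Ex_sqr_sum (c i) (ML2 a) (Mo a)).
under eq_bigr => i _ do rewrite exchange_big.
rewrite exchange_big /=.
apply: (@le_trans _ _ (\sum_(p : 'I_t * 'I_n) sigma ^+ 2)).
  apply: ler_sum => p _; under eq_bigr => i _ do rewrite -mulr_sumr.
  rewrite -mulr_suml -Ex_sum => [|a]; last exact: L2_sqr.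
  apply: (@le_trans _ _ (1 * Ex P (fun w => sqn (N p.2 (r0 + p.1)%N w)))).
    apply: ler_wpM2r; first by apply: Ex_ge0 => w; exact: sqn_ge0.
    by apply: dstoch_dev_col => //; exact: (phi_dstoch S_gossip S_size).
  by rewrite mul1r; exact: (gnoise_Ex hxi S eta x0 F_diff F_int f_diff F_var).
by rewrite sumr_const card_prod !card_ord -[_ *+ _]mulr_natl natrM mulrA.
Qed.

Let mR : 1 <= m%:R :> R. Proof. by rewrite ler1n. Qed.

(** Twice the direct contribution of heterogeneity and noise: the spare half absorbs the feedback of
    earlier deviations in the induction. *)
Let dev_bound : R :=
  n%:R * (32 * eta ^+ 2 * m%:R ^+ 2 * zeta ^+ 2 + 8 * eta ^+ 2 * m%:R * sigma ^+ 2).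

(* The last 2 m rounds contain a full cycle, which averages exactly, so only
   they contribute to the deviation from the mean. *)
Lemma Ex_dev_le r : eta * L * m%:R <= 6^-1 -> Ex P (dev r) <= dev_bound.
Proof.
move=> small; elim/ltn_ind: r => r IH.
pose t := minn r (2 * m); pose r0 := (r - t)%N.
pose V w := fro2 (\sum_(u < t) Q (r0 + u) (t - u) *m Nm (r0 + u) w).
have [VL VE] : L1 P V /\ Ex P V <= t%:R * (n%:R * sigma ^+ 2) by exact: noise_part.
pose H w := \sum_(u < t) (2 * L ^+ 2 * dev (r0 + u) w + 2 * n%:R * zeta ^+ 2).
have ut (u : 'I_t) : (r0 + u < r)%N.
  by have := ltn_ord u; rewrite /r0; have := geq_minl r (2 * m); rewrite -/t; lia.
have HL : L1 P H by apply: L1_sum => u; apply: L1D; [apply: L1Z; exact: dev_L1|exact: L1_cst].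
have path w : dev r w <= 2 * eta ^+ 2 * t%:R * H w + 2 * eta ^+ 2 * V w.
  have := @deviation R n n_gt0 S S_gossip S_size S_avg d (fun r => Xm r w)
    (fun r => Gf r w + Nm r w) eta (Xm0 w) (XmS ^~ w) r.
  rewrite /= -/t -/r0 => e; rewrite /dev e fro2Z sqrrN.
  have -> : \sum_(u < t) Qmx S (r0 + u) (t - u) *m (Gf (r0 + u) w + Nm (r0 + u) w) =
      \sum_(u < t) Q (r0 + u) (t - u) *m Gf (r0 + u) w +
      \sum_(u < t) Q (r0 + u) (t - u) *m Nm (r0 + u) w.
    by rewrite -big_split; apply: eq_bigr => u _; rewrite mulmxDr.
  apply: (@le_trans _ _ (eta ^+ 2 * (2 * (t%:R * H w) + 2 * V w))).
    apply: ler_wpM2l; first exact: sqr_ge0.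
    apply: le_trans (fro2D _ _) _; rewrite lerD2r; apply: ler_wpM2l => //.
    exact: grad_part.
  by rewrite le_eqVlt; apply/orP; left; apply/eqP; ring.
apply: (@le_trans _ _ (2 * eta ^+ 2 * t%:R * Ex P H + 2 * eta ^+ 2 * Ex P V)).
  rewrite -(ExZ _ HL) -(ExZ _ VL) -ExD; [|exact: L1Z|exact: L1Z].
  by apply: (Ex_le (dev_L1 r)) => //; apply: L1D; exact: L1Z.
have B0 : 0 <= dev_bound.
  by rewrite /dev_bound mulr_ge0// addr_ge0// !(sqr_ge0, mulr_ge0).
have EH : Ex P H <= t%:R * (2 * L ^+ 2 * dev_bound + 2 * n%:R * zeta ^+ 2).
  have hL u : L1 P (fun w => 2 * L ^+ 2 * dev (r0 + u) w) by apply: L1Z; exact: dev_L1.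
  rewrite Ex_sum => [|u]; last by apply: L1D => //; exact: L1_cst.
  apply: (@le_trans _ _ (\sum_(u < t) (2 * L ^+ 2 * dev_bound + 2 * n%:R * zeta ^+ 2))).
    2: by rewrite sumr_const card_ord [leRHS]mulr_natl.
  apply: ler_sum => u _.
  rewrite ExD//; last exact: L1_cst.
  rewrite Ex_cst ExZ; last exact: dev_L1.
  by rewrite lerD2r ler_wpM2l ?IH// mulr_ge0 ?sqr_ge0.
have t2m : t%:R <= 2 * m%:R :> R by rewrite -natrM ler_nat geq_minr.
have t0 : 0 <= t%:R :> R by [].
set K := 2 * L ^+ 2 * dev_bound + 2 * n%:R * zeta ^+ 2 in EH.
have K0 : 0 <= K by rewrite /K; apply: addr_ge0; apply: mulr_ge0 => //; try exact: sqr_ge0;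
    apply: mulr_ge0 => //; exact: sqr_ge0.
have e0 : 0 <= eta ^+ 2 := sqr_ge0 _.
have s0 : 0 <= n%:R * sigma ^+ 2 by rewrite mulr_ge0 ?sqr_ge0.
apply: (@le_trans _ _ (2 * eta ^+ 2 * ((2 * m%:R) * ((2 * m%:R) * K)) +
    2 * eta ^+ 2 * (2 * m%:R * (n%:R * sigma ^+ 2)))).
  apply: lerD.
    rewrite -mulrA; apply: ler_wpM2l; first by rewrite mulr_ge0.
    apply: ler_pM => //; first by apply: Ex_ge0 => w; apply: sumr_ge0 => u _;
      rewrite addr_ge0// !(sqr_ge0, mulr_ge0) ?fro2_ge0.
    by apply: le_trans EH _; apply: ler_wpM2r.
  apply: ler_wpM2l; first by rewrite mulr_ge0.
  by apply: le_trans VE _; apply: ler_wpM2r.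
(* The feedback factor is 16 / 36, at most 1/2, when eta L m <= 1/6. *)
have : 16 * (eta * L * m%:R) ^+ 2 * dev_bound <= 2^-1 * dev_bound.
  apply: ler_wpM2r => //.
  have : 0 <= eta * L * m%:R by rewrite !mulr_ge0// ltW.
  by set q := eta * L * m%:R in small *; rewrite expr2; nra.
rewrite /K /dev_bound; set B := n%:R * (_ + _); move=> h.
have BE : B = 32 * eta ^+ 2 * m%:R ^+ 2 * (n%:R * zeta ^+ 2) +
    8 * eta ^+ 2 * m%:R * (n%:R * sigma ^+ 2) by rewrite /B; ring.
apply: (@le_trans _ _ (16 * (eta * L * m%:R) ^+ 2 * B +
   2^-1 * (32 * eta ^+ 2 * m%:R ^+ 2 * (n%:R * zeta ^+ 2) +
    8 * eta ^+ 2 * m%:R * (n%:R * sigma ^+ 2)))).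
  by rewrite le_eqVlt; apply/orP; left; apply/eqP; field.
by rewrite -BE; lra.
Qed.

(** The coefficient of the mean noise in the descent inequality, a function of the current iterates
    alone; hence the cross term has mean 0. *)
Let Ust a (y : 'I_n -> 'rV[R]_d) : R := - eta * grad f_avg (average y) 0 a +
  L * eta ^+ 2 * (n%:R^-1 *: \sum_i grad (f i) (y i)) 0 a.

Let cross r w := \sum_a Ust a (x r w) * nhat r w 0 a.

Let sqnD (u v : 'rV[R]_d) : sqn (u + v) = sqn u + 2 * dot u v + sqn v.
Proof.
rewrite /sqn /dot mulr_sumr -!big_split; apply: eq_bigr => j _ /=.
by rewrite mxE; ring.
Qed.

Let sqn_grad_ghat r w :
  sqn (grad f_avg (xbar r w) - ghat r w) <= L ^+ 2 / n%:R * dev r w.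
Proof.
rewrite grad_avg /ghat -scalerBr -sumrB; apply: le_trans (sqn_avg _) _.
rewrite [leRHS](_ : _ = n%:R^-1 * (L ^+ 2 * dev r w)); last by ring.
rewrite ler_pM2l ?invr_gt0 ?ltr0n// devE mulr_sumr; apply: ler_sum => i _.
by rewrite -sqnN opprB; exact: (f_smooth i).2.
Qed.

(** The inner product of the gradient at the mean with the mean gradient [ghat] is polarized. The
    resulting - eta / 2 times the square of [ghat] cancels the quadratic term of the descent lemma
    because eta L <= 1, and their distance is controlled by the deviation. *)
Let descent_step r w : eta * L <= 1 ->
  eta / 2 * sqn (grad f_avg (xbar r w)) <=
  f_avg (xbar r w) - f_avg (xbar r.+1 w) +
  (eta / 2 * (L ^+ 2 / n%:R) * dev r w + cross r w + L * eta ^+ 2 / 2 * sqn (nhat r w)).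
Proof.
move=> eL; have := descent (xbar r w) (- eta *: (ghat r w + nhat r w)) L_gt0 avg_smooth.
rewrite scaleNr -xbarS -scaleNr dotZr sqnZ sqrrN dotDr sqnD.
set a := grad f_avg (xbar r w); set g := ghat r w; set v := nhat r w.
have -> : cross r w = - eta * dot a v + L * eta ^+ 2 * dot g v.
  rewrite /cross /dot !mulr_sumr -big_split; apply: eq_bigr => j _ /=.
  by rewrite /Ust mulrDl -!mulrA.
have h1 : eta / 2 * sqn (a - g) <= eta / 2 * (L ^+ 2 / n%:R) * dev r w.
  rewrite -[leRHS]mulrA; apply: ler_wpM2l; first by rewrite divr_ge0// ltW.
  exact: sqn_grad_ghat.
have h2 : L * eta ^+ 2 / 2 * sqn g <= eta / 2 * sqn g.
  apply: ler_wpM2r; first exact: sqn_ge0.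
  rewrite ler_pM2r ?invr_gt0// expr2 mulrA [L * eta]mulrC -[leRHS]mul1r.
  by rewrite ler_pM2r.
move: h1; rewrite sqnB => h1 h3.
have -> : L * eta ^+ 2 * dot g v = L / 2 * (eta ^+ 2 * (2 * dot g v)) by field.
have e1 : L / 2 * (eta ^+ 2 * (sqn g + 2 * dot g v + sqn v)) =
   L * eta ^+ 2 / 2 * sqn g + L / 2 * (eta ^+ 2 * (2 * dot g v)) +
   L * eta ^+ 2 / 2 * sqn v by field.
rewrite e1 in h3.
have e2 : eta / 2 * (sqn a - 2 * dot a g + sqn g) =
  eta / 2 * sqn a - eta * dot a g + eta / 2 * sqn g by field.
rewrite e2 in h1; rewrite mulrDr in h3; lra.
Qed.

Let Ust_L2 r a : L2 P (fun w => Ust a (x r w)).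
Proof.
apply: L2D; apply: L2Z; first by apply: smooth_L2 (avg_smooth) _ => b; exact: xbar_L2.
under eq_fun do rewrite mxE summxE; apply/L2Z/L2_sum => i; exact: gf_L2.
Qed.

Let nhat_L2 r a : L2 P (fun w => nhat r w 0 a).
Proof.
by rewrite /nhat; under eq_fun do rewrite mxE summxE; apply/L2Z/L2_sum => j; exact: N_L2.
Qed.

Let cross_L1 r : L1 P (cross r).
Proof. by apply: L1_sum => a; apply: L2_mul. Qed.

Let Ust_meas dT (T : measurableType dT) a (y : T -> 'I_n -> 'rV[R]_d) :
  (forall i b, measurable_fun [set: T] (fun w => y w i 0 b)) ->
  measurable_fun [set: T] (fun w => Ust a (y w)).
Proof.
move=> my; apply: measurable_funD; apply: measurable_funM; try exact: measurable_cst.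
  apply: meas_grad; first exact: avg_diff.
  move=> b; rewrite /average; under eq_fun do rewrite mxE summxE.
  apply: measurable_funM; first exact: measurable_cst.
  by apply: measurable_sum => i.
under eq_fun do rewrite mxE summxE.
apply: measurable_funM; first exact: measurable_cst.
by apply: measurable_sum => i; apply: meas_grad.
Qed.

Let Ex_cross r : Ex P (cross r) = 0.
Proof.
rewrite /cross Ex_sum => [|a]; last exact: L2_mul.
apply: big1 => a _.
have -> : (fun w => Ust a (x r w) * nhat r w 0 a) =
    (fun w => \sum_j n%:R^-1 * (Ust a (x r w) * N j r w 0 a)).
  apply/funext => w; rewrite /nhat mxE summxE mulrCA -mulr_sumr; congr (_ * _).
  by rewrite mulr_sumr.
have UNL j : L1 P (fun w => Ust a (x r w) * N j r w 0 a) by exact: L2_mul.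
rewrite Ex_sum => [|j]; last exact: L1Z.
apply: big1 => j _; rewrite ExZ//.
suff -> : Ex P (fun w => Ust a (x r w) * N j r w 0 a) = 0 by rewrite mulr0.
apply: (gnoise_orth_state hxi F_diff F_int F_mean f_diff F_var a (U := Ust a)); last exact: Ust_L2.
by move=> T y my; exact: Ust_meas.
Qed.

(** Orthogonality across the nodes of one round gives the factor 1 / n, the source of the linear
    speed-up in n. *)
Let Ex_nhat r : Ex P (fun w => sqn (nhat r w)) <= sigma ^+ 2 / n%:R.
Proof.
pose M a j w : R := N j r w 0 a.
have ML2 a j : L2 P (M a j) by exact: N_L2.
have Mo a i j : i != j -> Ex P (fun w => M a i w * M a j w) = 0.
  move=> ij; apply: (gnoise_orth hxi S eta x0 F_diff F_int F_mean f_diff F_var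
    a (p := (i, r)) (q := (j, r))).
  by apply: contra_neq ij => -[].
rewrite /sqn Ex_sum => [|a]; last exact/L2_sqr/nhat_L2.
have -> : \sum_a Ex P (fun w => nhat r w 0 a ^+ 2) =
    \sum_a \sum_j n%:R^-1 ^+ 2 * Ex P (fun w => M a j w ^+ 2).
  apply: eq_bigr => a _; rewrite -(Ex_sqr_sum (fun=> n%:R^-1) (ML2 a) (Mo a)).
  congr (Ex P _); apply/funext => w; rewrite /nhat mxE summxE mulr_sumr.
  by [].
rewrite exchange_big /=.
apply: (@le_trans _ _ (\sum_(j < n) n%:R^-1 ^+ 2 * sigma ^+ 2)).
  apply: ler_sum => j _; rewrite -mulr_sumr; apply: ler_wpM2l; first exact: sqr_ge0.
  rewrite -Ex_sum => [|a]; last exact: L2_sqr.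
  exact: (gnoise_Ex hxi S eta x0 F_diff F_int f_diff F_var).
rewrite sumr_const card_ord -[_ *+ _]mulr_natl le_eqVlt; apply/orP; left; apply/eqP.
by field.
Qed.

Lemma sqn_grad_avg_L1 r : L1 P (fun w => sqn (grad f_avg (xbar r w))).
Proof. by apply: sqn_L1 => a; apply: smooth_L2 avg_smooth _ => b; exact: xbar_L2. Qed.

(** The descent inequality is telescoped pathwise and the lower bound on [f_avg] is used before
    expectations are taken, so only the gradients and the error terms [E r] have to be
    integrated. *)
Lemma dsgd_bound K : eta * L * m%:R <= 6^-1 ->
  \sum_(r < K) Ex P (fun w => sqn (grad f_avg (xbar r w))) <=
  2 / eta * (f_avg (average x0) - fstar) +
  K%:R * (L ^+ 2 * (32 * eta ^+ 2 * m%:R ^+ 2 * zeta ^+ 2 +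
    8 * eta ^+ 2 * m%:R * sigma ^+ 2) + L * eta * (sigma ^+ 2 / n%:R)).
Proof.
move=> small; have eL : eta * L <= 1.
  have : eta * L <= eta * L * m%:R by rewrite ler_peMr// mulr_ge0// ltW.
  by lra.
pose c1 := eta / 2 * (L ^+ 2 / n%:R); pose c2 := L * eta ^+ 2 / 2.
have gL := sqn_grad_avg_L1.
pose E r w := c1 * dev r w + cross r w + c2 * sqn (nhat r w).
have nL r : L1 P (fun w => sqn (nhat r w)) by apply: sqn_L1 => a; exact: nhat_L2.
have EL r : L1 P (E r).
  by apply: L1D; [apply: L1D => //; exact: L1Z|exact: L1Z].
have path w : eta / 2 * \sum_(r < K) sqn (grad f_avg (xbar r w)) <=
    (f_avg (average x0) - fstar) + \sum_(r < K) E r w.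
  have tele k : eta / 2 * \sum_(r < k) sqn (grad f_avg (xbar r w)) <=
      f_avg (average x0) - f_avg (xbar k w) + \sum_(r < k) E r w.
    elim: k => [|k IH]; first by rewrite !big_ord0 mulr0 addr0 subrr.
    rewrite !big_ord_recr /= mulrDr; have := descent_step k w eL.
    by rewrite -/c1 -/c2 -/(E k w); lra.
  by apply: le_trans (tele K) _; rewrite lerD2r lerD2l lerN2.
have EE r : Ex P (E r) <= c1 * dev_bound + c2 * (sigma ^+ 2 / n%:R).
  rewrite ExD; [|by apply: L1D => //; exact: L1Z|exact: L1Z].
  rewrite ExD//; last exact: L1Z.
  rewrite Ex_cross addr0 !ExZ//; apply: lerD; apply: ler_wpM2l.
  - by rewrite /c1 !mulr_ge0 ?invr_ge0 ?sqr_ge0// ltW.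
  - exact: Ex_dev_le.
  - by rewrite /c2 !mulr_ge0 ?invr_ge0 ?sqr_ge0// ltW.
  - exact: Ex_nhat.
have : eta / 2 * \sum_(r < K) Ex P (fun w => sqn (grad f_avg (xbar r w))) <=
   (f_avg (average x0) - fstar) + K%:R * (c1 * dev_bound + c2 * (sigma ^+ 2 / n%:R)).
  rewrite -Ex_sum// -ExZ; last exact: L1_sum.
  apply: (@le_trans _ _ (Ex P (fun w => (f_avg (average x0) - fstar) + \sum_(r < K) E r w))).
    apply: Ex_le path; first by apply: L1Z; exact: L1_sum.
    by apply: L1D; [exact: L1_cst|exact: L1_sum].
  rewrite ExD; [|exact: L1_cst|exact: L1_sum].
  rewrite Ex_cst lerD2l Ex_sum//.
  apply: (@le_trans _ _ (\sum_(r < K) (c1 * dev_bound + c2 * (sigma ^+ 2 / n%:R)))).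
    by apply: ler_sum => r _; exact: EE.
  by rewrite sumr_const card_ord [leRHS]mulr_natl.
have e2 : 0 < 2 / eta by rewrite divr_gt0.
set Sg := \sum_(r < K) _; rewrite -(ler_pM2l e2) => h.
have -> : Sg = 2 / eta * (eta / 2 * Sg) by field; rewrite gt_eqF.
apply: le_trans h _; rewrite mulrDr lerD2l.
rewrite le_eqVlt; apply/orP; left; apply/eqP; rewrite /c1 /c2 /dev_bound.
by field; rewrite nR gt_eqF.
Qed.

End dsgd_analysis.

(** * Choice of the step size *)

Section tuning.
Variables (R : realType) (nu m sigma zeta eps : R).
Hypotheses (nu_gt0 : 0 < nu) (m_ge1 : 1 <= m).
Hypotheses (sigma_ge0 : 0 <= sigma) (zeta_ge0 : 0 <= zeta) (eps_gt0 : 0 < eps).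

(* The step size is [(L * inv_step)^-1]: the summands make it at most
   [1 / (6 L m)] and bound each error term of [dsgd_bound] by [eps / 6]. *)
Definition inv_step : R :=
  6 * m + 6 * (sigma ^+ 2 / (nu * eps)) +
  (14 * (m * zeta) + 7 * (sigma * Num.sqrt m)) / Num.sqrt eps.

Let m_ge0 : 0 <= m. Proof. exact: le_trans m_ge1. Qed.
Let s_gt0 : 0 < Num.sqrt eps. Proof. by rewrite sqrtr_gt0. Qed.

Let t2_ge0 : 0 <= sigma ^+ 2 / (nu * eps).
Proof. by rewrite divr_ge0 ?sqr_ge0// mulr_ge0// ltW. Qed.

Let t3_ge0 : 0 <= m * zeta / Num.sqrt eps.
Proof. by rewrite divr_ge0 ?mulr_ge0// ltW. Qed.

Let t4_ge0 : 0 <= sigma * Num.sqrt m / Num.sqrt eps.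
Proof. by rewrite divr_ge0 ?mulr_ge0 ?sqrtr_ge0// ltW. Qed.

Let inv_stepE : inv_step = 6 * m + 6 * (sigma ^+ 2 / (nu * eps)) +
  14 * (m * zeta / Num.sqrt eps) + 7 * (sigma * Num.sqrt m / Num.sqrt eps).
Proof. by rewrite /inv_step; ring. Qed.

Lemma inv_step_ge : 6 * m <= inv_step.
Proof. by rewrite inv_stepE; move: t2_ge0 t3_ge0 t4_ge0 m_ge1; lra. Qed.

Lemma inv_step_gt0 : 0 < inv_step.
Proof. by have := inv_step_ge; move: m_ge1; lra. Qed.

Let sqr_bound (c x : R) : 0 <= c -> 0 <= x -> c * (x / Num.sqrt eps) <= inv_step ->
  c ^+ 2 * x ^+ 2 <= inv_step ^+ 2 * eps.
Proof.
move=> c0 x0; rewrite mulrA ler_pdivrMr// => h.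
rewrite -(sqr_sqrtr (ltW eps_gt0)) -!exprMn ler_sqr ?nnegrE ?mulr_ge0//.
by rewrite ltW// inv_step_gt0.
Qed.

Lemma step_error L (eta := (L * inv_step)^-1) : 0 < L ->
  L ^+ 2 * (32 * eta ^+ 2 * m ^+ 2 * zeta ^+ 2 + 8 * eta ^+ 2 * m * sigma ^+ 2) +
    L * eta * (sigma ^+ 2 / nu) <= eps / 2.
Proof.
move=> L0; have A0 := inv_step_gt0.
have -> : L ^+ 2 * (32 * eta ^+ 2 * m ^+ 2 * zeta ^+ 2 + 8 * eta ^+ 2 * m * sigma ^+ 2) +
    L * eta * (sigma ^+ 2 / nu) =
    (32 * (m * zeta) ^+ 2 + 8 * (m * sigma ^+ 2) + inv_step * (sigma ^+ 2 / nu)) /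
      inv_step ^+ 2.
  by rewrite /eta; field; rewrite !gt_eqF.
rewrite ler_pdivrMr ?exprn_gt0//.
have h1 : 14 ^+ 2 * (m * zeta) ^+ 2 <= inv_step ^+ 2 * eps.
  apply: sqr_bound; rewrite ?mulr_ge0// inv_stepE.
  by move: t2_ge0 t3_ge0 t4_ge0 m_ge1; lra.
have h2 : 7 ^+ 2 * (sigma * Num.sqrt m) ^+ 2 <= inv_step ^+ 2 * eps.
  apply: sqr_bound; rewrite ?mulr_ge0 ?sqrtr_ge0// inv_stepE.
  by move: t2_ge0 t3_ge0 t4_ge0 m_ge1; lra.
rewrite exprMn sqr_sqrtr// in h2.
have h3 : 6 * (inv_step * (sigma ^+ 2 / nu)) <= inv_step ^+ 2 * eps.
  have h : 6 * (sigma ^+ 2 / nu) <= inv_step * eps.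
    rewrite -ler_pdivrMr//; apply: (@le_trans _ _ (6 * (sigma ^+ 2 / (nu * eps)))).
      by rewrite le_eqVlt; apply/orP; left; apply/eqP; field; rewrite !gt_eqF.
    by rewrite inv_stepE; move: t2_ge0 t3_ge0 t4_ge0 m_ge1; lra.
  by have := ler_wpM2l (ltW A0) h; lra.
have h4 : 0 <= inv_step ^+ 2 * eps by rewrite mulr_ge0 ?sqr_ge0// ltW.
(* The three error terms add up because 32 / 14^2 + 8 / 7^2 + 1 / 6 <= 1 / 2. *)
lra.
Qed.

End tuning.

(** * The step size in terms of the logarithm of n *)

Section log_size.
Variables (R : realType) (n k : nat).
Hypothesis hk : (1 <= k <= n - 1)%N.

Let ln_gt0 : 0 < ln (k.+1%:R : R).
Proof. by rewrite ln_gt0// ltr1n; case/andP: hk. Qed.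

Lemma le_log_base q : (k.+1 ^ q <= n)%N -> q%:R <= log_base k.+1%:R n%:R :> R.
Proof.
move=> qn; rewrite /log_base ler_pdivlMr// mulr_natl -lnXn ?ltr0n//.
by rewrite ler_ln ?posrE ?exprn_gt0 ?ltr0n// -?natrX ?ler_nat//; lia.
Qed.

Lemma log_base_ge1 : 1 <= log_base k.+1%:R n%:R :> R.
Proof. by apply: (@le_log_base 1); rewrite expn1; lia. Qed.

Lemma size_le_log (m q : nat) : (m <= 2 * q + 2)%N -> (k.+1 ^ q <= n)%N ->
  m%:R <= 4 * log_base k.+1%:R n%:R :> R.
Proof.
move=> mq /le_log_base ql; have := log_base_ge1.
have : m%:R <= (2 * q + 2)%:R :> R by rewrite ler_nat.
by rewrite natrD natrM; lra.
Qed.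

(** Expanding gives the coefficients 24, 24, 56 and 28. Replacing m by 4 lg, and the square root of
    m by twice that of lg, turns them into 96, 24, 224 and 56; the heterogeneity term thus sets the
    constant 224. *)
Lemma inv_step_le_rate (m sigma zeta eps : R) :
  0 <= sigma -> 0 <= zeta -> 0 < eps -> 1 <= m -> m <= 4 * log_base k.+1%:R n%:R ->
  4 * (inv_step n%:R m sigma zeta eps / eps) <= 224 * rate n k sigma zeta eps.
Proof.
move=> s0 z0 e0 m1; rewrite /rate /inv_step; set lg := log_base _ _ => ml.
have n0 : 0 < n%:R :> R by rewrite ltr0n; lia.
have lg1 : 1 <= lg by exact: log_base_ge1.
have e32 : eps `^ (3%:R / 2%:R) = eps * Num.sqrt eps.
  rewrite (_ : 3%:R / 2%:R = 1 + 2^-1); last by field.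
  by rewrite powRD ?powRr1 ?powR12_sqrt ?ltW// gt_eqF ?implybT.
have r0 : 0 < Num.sqrt eps by rewrite sqrtr_gt0.
have sm : Num.sqrt m <= 2 * Num.sqrt lg.
  have -> : 2 = Num.sqrt (2 ^+ 2) :> R by rewrite sqrtr_sqr ger0_norm.
  by rewrite -sqrtrM// ler_sqrt; lra.
rewrite e32; set t := eps * Num.sqrt eps; have t0 : 0 < t by rewrite mulr_gt0.
have -> : 4 * ((6 * m + 6 * (sigma ^+ 2 / (n%:R * eps)) +
    (14 * (m * zeta) + 7 * (sigma * Num.sqrt m)) / Num.sqrt eps) / eps) =
    24 * (m / eps) + 24 * (sigma ^+ 2 / (n%:R * eps ^+ 2)) +
    56 * (m * zeta / t) + 28 * (sigma * Num.sqrt m / t).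
  by rewrite /t; field; rewrite !gt_eqF.
have h1 : m / eps <= 4 * (lg / eps) by rewrite mulrA ler_pM2r ?invr_gt0.
have h2 : m * zeta / t <= 4 * (zeta * lg / t).
  by rewrite [leRHS]mulrA ler_pM2r ?invr_gt0// [zeta * _]mulrC mulrA ler_wpM2r.
have h3 : sigma * Num.sqrt m / t <= 2 * (sigma * Num.sqrt lg / t).
  by rewrite [leRHS]mulrA ler_pM2r ?invr_gt0// mulrCA ler_wpM2l.
have h4 : 0 <= sigma ^+ 2 / (n%:R * eps ^+ 2).
  by rewrite divr_ge0 ?sqr_ge0// mulr_ge0 ?sqr_ge0// ltW.
have h5 : 0 <= lg / eps by rewrite divr_ge0; lra.
have h6 : 0 <= sigma * Num.sqrt lg / t.
  by rewrite divr_ge0 ?mulr_ge0 ?sqrtr_ge0// ltW.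
lra.
Qed.

End log_size.

Theorem theorem2 (R : realType) :
  exists C : R, 0 < C /\
  forall (n k d : nat) (hk : (1 <= k <= n - 1)%N)
    (dX : measure_display) (X : measurableType dX)
    (D : 'I_n -> probability X R)
    (F : 'I_n -> 'rV[R]_d -> X -> R) (f : 'I_n -> 'rV[R]_d -> R)
    (f_avg : 'rV[R]_d -> R) (fstar L sigma zeta eps : R)
    (hF_diff : forall i xi x, differentiable (F i ^~ xi) x)
    (hF_int : forall i x, (D i).-integrable [set: X] (EFin \o F i x))
    (hf : forall i x, 'E_(D i)[F i x]%E = (f i x)%:E)
    (hf_avg : forall x, f_avg x = n%:R^-1 * \sum_(i < n) f i x)
    (hL : 0 <= L) (hsigma : 0 <= sigma) (hzeta : 0 <= zeta) (heps : 0 < eps)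
    (h1 : forall x, fstar <= f_avg x)
    (h2 : forall i, smooth L (f i))
    (h3 : forall i x,
       ('E_(D i)[fun xi => (enorm (grad (F i ^~ xi) x - grad (f i) x) ^+ 2)%R]
          <= (sigma ^+ 2)%:E)%E)
    (h4 : forall x,
       n%:R^-1 * \sum_(i < n) enorm (grad (f i) x - grad f_avg x) ^+ 2
         <= zeta ^+ 2)
    (Gs : seq 'M[R]_n) (hGs : base_graph k Gs)
    (dO : measure_display) (Omega : measurableType dO)
    (P : probability Omega R) (xi : 'I_n -> nat -> Omega -> X)
    (hxi : independent_samples P D xi)
    (x0 : 'I_n -> 'rV[R]_d) (hx0 : forall i j, x0 i = x0 j),
  exists2 eta : R, 0 < eta &
  exists2 T : nat,
    T%:R <= C * rate n k sigma zeta eps * (L * (f_avg (average x0) - fstar)) &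
    forall N : nat, (T <= N)%N ->
      ((N.+1%:R^-1)%:E *
         \sum_(0 <= r < N.+1)
           'E_P[fun w =>
                 (enorm (grad f_avg (average (dsgd Gs eta F xi x0 r w))) ^+ 2)%R]
       <= eps%:E)%E.
Proof.
exists 224; split => // n k d hk dX X D F f f_avg fstar L sigma zeta eps hF_diff hF_int hf
  hf_avg hL hsigma hzeta heps h1 h2 h3 h4 Gs hGs dO Omega P xi hxi x0 hx0.
have n0 : (0 < n)%N by lia.
have [runGs gossipGs Gs0 [q [Gsq kq]]] := base_graphP hk hGs.
have f_smooth i : smooth2 L (f i) by exact: smooth_smooth2.
have f_hetero x : n%:R^-1 * \sum_(i < n) sqn (grad (f i) x - grad f_avg x) <= zeta ^+ 2.
  by have := h4 x; under eq_bigr do rewrite enorm_sqr.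
pose G eta r w := sqn (grad f_avg (average (dsgd Gs eta F xi x0 r w))).
have EE eta r : 'E_P[fun w =>
    (enorm (grad f_avg (average (dsgd Gs eta F xi x0 r w))) ^+ 2)%R]%E = (Ex P (G eta r))%:E.
  rewrite (_ : (fun w => _) = G eta r); last by apply/funext => w; exact: enorm_sqr.
  apply: L1_expectation.
  exact: (sqn_grad_avg_L1 n0 hxi Gs eta x0 hF_diff hF_int h3 hf_avg f_smooth).
have sumE eta N : (\sum_(0 <= r < N.+1) 'E_P[fun w =>
    (enorm (grad f_avg (average (dsgd Gs eta F xi x0 r w))) ^+ 2)%R])%E =
    (\sum_(r < N.+1) Ex P (G eta r))%:E.
  by rewrite big_mkord -sumEFin; apply: eq_bigr => r _; exact: EE.
have avgS := avg_smooth n0 hf_avg f_smooth.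
have F0_ge0 : 0 <= f_avg (average x0) - fstar by rewrite subr_ge0.
(* With L = 0 the budget of iterations is 0 and the step 1 / (L A) is meaningless. The gradient of
   [f_avg] then vanishes everywhere, since [f_avg] is c-smooth for every c > 0 and bounded below, so
   T = 0 works with any step. *)
have [L0|L0] := eqVneq L 0.
  exists 1 => //; exists 0%N; first by rewrite L0 mul0r mulr0.
  move=> N _; rewrite sumE big1 => [|r _]; first by rewrite mule0 lee_fin ltW.
  rewrite (_ : G 1 r = cst 0) ?Ex_cst//; apply/funext => w; rewrite /G; set y := average _.
  apply/eqP; rewrite eq_le sqn_ge0 andbT; apply/ler_addgt0Pl => e e0.
  (* Chosen so that 2 c (f - fstar) stays at most e; the added 1 keeps the denominator positive when
     the gap is 0. *)
  rewrite addr0; pose c := e / (2 * (f_avg y - fstar + 1)).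
  have gy : 0 <= f_avg y - fstar by rewrite subr_ge0.
  have c0 : 0 < c by rewrite divr_gt0// mulr_gt0//; lra.
  have cS : smooth2 c f_avg.
    split=> [|u v]; first exact: avgS.1.
    apply: le_trans (avgS.2 u v) _; rewrite L0 expr0n mul0r.
    by rewrite mulr_ge0 ?sqr_ge0 ?sqn_ge0.
  apply: le_trans (sqn_grad_le y c0 cS h1) _.
  rewrite /c; set g := f_avg y - fstar in gy *.
  have -> : 2 * (e / (2 * (g + 1))) * g = e * (g / (g + 1)) by field; lra.
  by apply: ler_piMr; [exact: ltW|rewrite ler_pdivrMr; lra].
have {}hL : 0 < L by rewrite lt_neqAle eq_sym L0.
have nu0 : 0 < n%:R :> R by rewrite ltr0n.
have m1 : 1 <= (size Gs)%:R :> R by rewrite ler1n.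
set A := inv_step n%:R (size Gs)%:R sigma zeta eps.
have A0 : 0 < A by exact: inv_step_gt0.
have LA0 : 0 < L * A by rewrite mulr_gt0.
set F0 := f_avg (average x0) - fstar in F0_ge0 *.
(* From this T on, the initial gap contributes at most eps / 2. Rounding down is enough because the
   average is over N + 1 > 4 (A / eps) L F0 terms. *)
pose T := Num.truncn (4 * (A / eps) * (L * F0)).
have T_ge0 : 0 <= 4 * (A / eps) * (L * F0).
  by rewrite !mulr_ge0 ?invr_ge0// ltW.
exists (L * A)^-1; first by rewrite invr_gt0.
exists T.
  apply: (@le_trans _ _ (4 * (A / eps) * (L * F0))); first by rewrite Num.Theory.truncn_le.
  apply: ler_wpM2r; first by rewrite mulr_ge0// ltW.
  by apply: inv_step_le_rate => //; exact: size_le_log kq.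
move=> N TN; rewrite sumE -EFinM lee_fin ler_pdivrMl ?ltr0n//.
have small : (L * A)^-1 * L * (size Gs)%:R <= 6^-1.
  have -> : (L * A)^-1 * L * (size Gs)%:R = (size Gs)%:R / A by field; rewrite !gt_eqF.
  by rewrite ler_pdivrMr//; have := inv_step_ge nu0 m1 hsigma hzeta heps; rewrite -/A; lra.
have eta0 : 0 < (L * A)^-1 by rewrite invr_gt0.
apply: le_trans (dsgd_bound n0 hxi hF_diff hF_int hf h3 hf_avg f_smooth h1 f_hetero
  hx0 gossipGs Gs0 runGs hL eta0 N.+1 small) _.
have NT : 4 * (A / eps) * (L * F0) <= N.+1%:R.
  by apply/ltW/(lt_le_trans (truncnS_gt _)); rewrite ler_nat.
have e1 : 2 / (L * A)^-1 * F0 <= N.+1%:R * (eps / 2).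
  rewrite invrK; have -> : 2 * (L * A) * F0 = 4 * (A / eps) * (L * F0) * (eps / 2).
    by field; rewrite gt_eqF.
  by apply: ler_wpM2r => //; rewrite divr_ge0// ltW.
have e2 := step_error nu0 m1 hsigma hzeta heps hL.
have N0 : 0 <= N.+1%:R :> R by [].
apply: le_trans (lerD e1 (ler_wpM2l N0 e2)) _; lra.
Qed.
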